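(* The space $Z(\mathcal T_s^2)$ is not asymptotically Hilbertian, nor does its basis $(v_j)_{j=1}^\infty$ have the $E(n,n,K)$-property (i.e. there is no $K\ge1$ such that $(v_j)_{j=1}^\infty$ has the $E(n,n,K)$-property for every $n\in\mathbb N$).
   Context: All Banach spaces are complex; $d_E=d(E,\ell_2^{\dim E})$ is the Banach-Mazur distance for a finite-dimensional $E$. **Derived spaces.** Let $\omega$ be the space of all complex sequences with coordinatewise convergence and $(e_j)$ the unit vectors. Let $X$ be a Banach sequence space and let its dual $X^*$ be regarded as a sequence space through the bilinear pairing $\langle x,y\rangle=\sum_j x_jy_j$; assume $(e_j)$ is an unconditional basis of both $X$ and $X^*$. Let $\mathbb S=\{z\in\mathbb C:0\le \mathrm{Re}\, z\le 1\}$. $\mathcal F_\infty(X,X^* )$ is the space of functions $F:\mathbb S\to\omega$ that are bounded and continuous on $\mathbb S$, analytic in the interior of $\mathbb S$, and such that $t\mapsto F(it)\in X$ and $t\mapsto F(1+it)\in X^*$ are bounded continuous functions, with norm $\|F\|=\max(\sup_t\|F(it)\|_X,\sup_t\|F(1+it)\|_{X^*})$. The interpolation space $(X,X^* )_{1/2}=\{F(1/2):F\in\mathcal F_\infty(X,X^* )\}$ carries the quotient norm. When $(X,X^* )_{1/2}=\ell_2$ (with equivalent norms), the derived space $Z(X)$ is the space of pairs $(x,y)\in\omega\times\omega$ for which $\|(x,y)\|_{Z(X)}=\inf\{\|F\|:F\in\mathcal F_\infty(X,X^* ),\ F(1/2)=y,\ F'(1/2)=x\}$ is finite. Its natural basis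 is $(v_j)_{j\ge1}$ with $v_{2j-1}=(e_j,0)$, $v_{2j}=(0,e_j)$. **The space $\mathcal T_s^2$.** The Tsirelson space $\mathcal T$ is the completion of the space $c_{00}$ of finitely supported sequences under the norm satisfying $\|x\|_{\mathcal T}=\max\{\|x\|_\infty,\frac12\sup\sum_{j=1}^k\|E_jx\|_{\mathcal T}\}$, the supremum over $k$ and finite sets $k\le E_1<E_2<\dots<E_k$ of integers ($Ex$ is the restriction of $x$ to $E$). Its 2-convexification $\mathcal T^2$ has norm $\|x\|_{\mathcal T^2}=\|(|x_n|^2)_n\|_{\mathcal T}^{1/2}$. The Casazza-Nielsen symmetric version $\mathcal T_s^2$ of $\mathcal T^2$ (also denoted $S(\mathcal T^2)$) is, up to equivalence of norms, the completion of $c_{00}$ under $\|x\|=\sup\{|\sum_nx_ny_n|:y\in c_{00},\ \sup_\pi\|(y_{\pi(n)})_n\|_{(\mathcal T^2)^*}\le1\}$, where $\pi$ ranges over the permutations of $\mathbb N$. Its unit vector basis is symmetric and is dominated by the $\ell_2$ basis, and $(\mathcal T_s^2,(\mathcal T_s^2)^* )_{1/2}=\ell_2$ with equivalent norms. **Properties.** A space $X$ is asymptotically Hilbertian if there is $C>0$ such that for every $n\in\mathbb N$ there is a finite-codimensional subspace $X_n$ of $X$ so that every $n$-dimensional subspace $E$ of $X_n$ satisfies $d_E\le C$. A family $(b_j)$ indexed by a subset of $\mathbb N$ is $(m,K)$-euclidean if for every subset $A$ of the index set with $|A|\le m$, $(b_j)_{j\in A}$ is $K$-equivalent to the unit vector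 basis of $\ell_2^{|A|}$. A basis $(b_j)_{j\ge1}$ has the $E(n,m,K)$-property if there is $I\subseteq\mathbb N$ with $|I|=n$ such that $\{b_j:j\in\mathbb N\setminus I\}$ is $(m,K)$-euclidean. *)

(* Defs.v *)
From HB Require Import structures.
From mathcomp Require Import all_boot all_order all_algebra finmap.
From mathcomp Require Import all_classical all_reals all_analysis.
From mathcomp Require Import complex.

Set Implicit Arguments.
Unset Strict Implicit.
Unset Printing Implicit Defensive.

Import Order.TTheory GRing.Theory Num.Theory.
Import numFieldNormedType.Exports.
Import Normc.

Local Open Scope classical_set_scope.
Local Open Scope ring_scope.
Local Open Scope complex_scope.

(* Conventions.  The library is MathComp-Analysis and the scalars are [R[i]] for
   an arbitrary [R : realType].  The sequence (x_1, x_2, ...) is coded by a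
   function on [nat], index [n : nat] standing for the n.+1-st coordinate.  A
   Banach space inside an ambient vector space [V] is given by its extended norm
   [N : V -> \bar R]: its elements are the [x] with [N x < +oo]. *)

(* The topology of coordinatewise convergence is not put on this type: every
   topological requirement is stated for each coordinate. *)
Notation omega R := (nat -> R[i]^o).

Section sequences.
Variable R : realType.
Implicit Types x y : omega R.

Definition c00 : set (omega R) :=
  [set x | exists n, forall m, (n <= m)%N -> x m = 0].

Definition unit_vector (j : nat) : omega R := fun n => (n == j)%:R.

Definition restr (E : {fset nat}) x : omega R :=
  fun n => if n \in E then x n else 0.

(* Meaningful as soon as [x] or [y] is in [c00]. *)
Definition pairing x y : R[i] := \sum_(n \in [set: nat]) x n * y n.

(* A functional on a space in which [c00] is dense is identified with its
   sequence of values on the unit vectors; its norm can be computed on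
   [c00]. *)
Definition dual_norm (N : omega R -> \bar R) y : \bar R :=
  ereal_sup [set (normc (pairing x y))%:E
            | x in [set x | c00 x /\ (N x <= 1)%E]].

(* The completion of [c00] realized in [omega]: the limit of an [N]-Cauchy
   sequence is represented by its coordinatewise limit, and has for norm the
   limit of the norms. *)
Definition completion_norm (N : omega R -> \bar R) x : \bar R :=
  ereal_inf [set r%:E | r in [set r : R | exists u : nat -> omega R,
    [/\ forall k, c00 (u k),
        forall e : R, 0 < e -> exists K, forall k l, (K <= k)%N -> (K <= l)%N ->
          (N (u k - u l)%R <= e%:E)%E,
        forall j, (fun k => u k j) @ \oo --> x j &
        N (u k) @[k --> \oo] --> r%:E]]].

End sequences.

Section tsirelson.
Variable R : realType.

(* k <= E_1 < ... < E_k.  Empty sets are allowed: they contribute nothing. *)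
Definition admissible (k : nat) (E : 'I_k -> {fset nat}) : Prop :=
  (forall i n, n \in E i -> (k <= n.+1)%N) /\
  (forall i j : 'I_k, (i < j)%N ->
     forall m n, m \in E i -> n \in E j -> (m < n)%N).

Record is_tsirelson_norm (N : omega R -> R) : Prop := IsTsirelsonNorm {
  tsirelson_eq0 : forall x, c00 x -> N x = 0 -> x = 0;
  tsirelsonZ : forall (a : R[i]) x, c00 x -> N (a *: x) = normc a * N x;
  tsirelsonD : forall x y, c00 x -> c00 y -> N (x + y) <= N x + N y;
  tsirelsonE : forall x, c00 x ->
    (N x)%:E = Order.max
      (ereal_sup [set (normc (x n))%:E | n in [set: nat]])
      (2^-1%:E * ereal_sup [set s | exists k (E : 'I_k -> {fset nat}),
         admissible E /\ s = (\sum_(j < k) N (restr (E j) x))%:E])%E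
}.

End tsirelson.

(* The norm is the increasing limit of the norms obtained by iterating the
   right-hand side of [tsirelsonE], starting from the sup norm. *)
Section tsirelson_existence.
Variable R : realType.
Implicit Types x y : omega R.

Let sup0 x : \bar R := ereal_sup [set (normc (x n))%:E | n in [set: nat]].

Let step (f : omega R -> \bar R) x : \bar R := ereal_sup [set s | exists k (E : 'I_k -> {fset nat}),
         admissible E /\ s = (\sum_(j < k) f (restr (E j) x))%E].

Let Fixpoint ts k x : \bar R :=
  if k is k'.+1 then (maxe (sup0 x) (2^-1%:E * step (ts k') x))%E else sup0 x.

Let t x : \bar R := ereal_sup (range (ts^~ x)).

Let nge0 (z : R[i]) : 0 <= normc z.
Proof. by case: z => a b; exact: sqrtr_ge0. Qed.

Let sup0_ub x n : ((normc (x n))%:E <= sup0 x)%E.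
Proof. by apply: ereal_sup_ubound; exists n. Qed.

Let sup0_ge0 x : (0 <= sup0 x)%E.
Proof. by apply: le_trans (sup0_ub x 0%N); rewrite lee_fin nge0. Qed.

Let ts_sup0 k x : (sup0 x <= ts k x)%E.
Proof. by case: k => [|k] //=; rewrite le_max lexx. Qed.

Let ts_ge0 k x : (0 <= ts k x)%E.
Proof. exact: le_trans (sup0_ge0 x) (ts_sup0 k x). Qed.

Let step_ub f k (E : 'I_k -> {fset nat}) x : admissible E ->
  (\sum_(j < k) f (restr (E j) x) <= step f x)%E.
Proof. by move=> aE; apply: ereal_sup_ubound; exists k, E. Qed.

Let step_le f x c : (forall k (E : 'I_k -> {fset nat}), admissible E ->
   (\sum_(j < k) f (restr (E j) x) <= c)%E) -> (step f x <= c)%E.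
Proof. by move=> H; apply: ge_ereal_sup => _ [k [E [aE ->]]]; exact: H. Qed.

Let half_ge0 : (0 <= (2^-1 : R)%:E)%E.
Proof. by rewrite lee_fin invr_ge0. Qed.

Let ts_mono k x : (ts k x <= ts k.+1 x)%E.
Proof.
elim: k x => [|k IH] x; first by rewrite /= le_max lexx.
rewrite [in X in (X <= _)%E]/= ge_max ts_sup0 /= le_max; apply/orP; right.
apply: lee_pmul => //; first last.
  apply: step_le => n E aE; apply: le_trans (step_ub _ _ aE).
  by apply: lee_sum => i _; exact: IH.
apply: le_trans (step_ub _ _ (_ : admissible (fun _ : 'I_0 => fset0))).
  by rewrite big_ord0.
by split; case.
Qed.

Let step_ge0 k x : (0 <= step (ts k) x)%E.
Proof.
apply: le_trans (step_ub _ _ (_ : admissible (fun _ : 'I_0 => fset0))).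
  by rewrite big_ord0.
by split; case.
Qed.

Let restrZ E (a : R[i]) x : restr E (a *: x) = a *: restr E x.
Proof.
apply/funext => n; rewrite /restr.
have sE (z : omega R) m : (a *: z) m = a *: z m by [].
by rewrite !sE; case: ifP => // _; rewrite scaler0.
Qed.

Let restrD E x y : restr E (x + y) = restr E x + restr E y.
Proof.
apply/funext => n; rewrite /restr.
have sE (z w : omega R) m : (z + w) m = z m + w m by [].
by rewrite !sE; case: ifP => // _; rewrite addr0.
Qed.

Let tsZ k (a : R[i]) x : (ts k (a *: x) <= (normc a)%:E * ts k x)%E.
Proof.
have na := nge0 a.
have S x' : (sup0 (a *: x') <= (normc a)%:E * sup0 x')%E.
  apply: ge_ereal_sup => _ [n _ <-].
  have -> : (a *: x') n = a * x' n by [].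
  by rewrite normcM EFinM; apply: lee_wpmul2l; rewrite ?lee_fin.
elim: k x => [|k IH] x; first exact: S.
rewrite [in X in (X <= _)%E]/= ge_max; apply/andP; split.
  by apply: le_trans (S x) _; apply: lee_wpmul2l; rewrite ?lee_fin ?ts_sup0.
apply: (@le_trans _ _ ((normc a)%:E * (2^-1%:E * step (ts k) x))%E); last first.
  by apply: lee_wpmul2l; rewrite ?lee_fin //= le_max lexx orbT.
rewrite muleCA; apply: lee_wpmul2l => //.
apply: step_le => n E aE.
apply: (@le_trans _ _ ((normc a)%:E * (\sum_(j < n) ts k (restr (E j) x)))%E).
  rewrite ge0_sume_distrr; last by move=> *; exact: ts_ge0.
  by apply: lee_sum => i _; rewrite restrZ; exact: IH.
by apply: lee_wpmul2l; rewrite ?lee_fin // step_ub.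
Qed.

Let tsD k x y : (ts k (x + y)%R <= ts k x + ts k y)%E.
Proof.
have S x' y' : (sup0 (x' + y')%R <= sup0 x' + sup0 y')%E.
  apply: ge_ereal_sup => _ [n _ <-].
  have -> : (x' + y') n = x' n + y' n by [].
  apply: (@le_trans _ _ ((normc (x' n))%:E + (normc (y' n))%:E)%E).
    by rewrite -EFinD lee_fin; exact: le_normcD.
  by apply: leeD.
elim: k x y => [|k IH] x y; first exact: S.
rewrite [in X in (X <= _)%E]/= ge_max; apply/andP; split.
  by apply: le_trans (S x y) _; apply: leeD; exact: ts_sup0.
apply: (@le_trans _ _ ((2^-1%:E * step (ts k) x) + (2^-1%:E * step (ts k) y))%E).
  rewrite -ge0_muleDr; [|exact: step_ge0|exact: step_ge0].
  apply: lee_wpmul2l => //.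
  apply: step_le => n E aE.
  apply: (@le_trans _ _ (\sum_(j < n) ts k (restr (E j) x) + \sum_(j < n) ts k (restr (E j) y))%E).
    by rewrite -big_split /=; apply: lee_sum => i _; rewrite restrD; exact: IH.
  by apply: leeD; exact: step_ub.
by apply: leeD; rewrite /= le_max lexx orbT.
Qed.

Let restr_supp E x n : (forall m, (n <= m)%N -> x m = 0) ->
  forall m, (n <= m)%N -> restr E x m = 0.
Proof. by move=> H m nm; rewrite /restr H //; case: ifP. Qed.

Let n0 : normc (0 : R[i]) = 0.
Proof. exact: normc0. Qed.

Let ts_l1 k x n : (forall m, (n <= m)%N -> x m = 0) ->
  (ts k x <= (\sum_(i < n) normc (x i))%:E)%E.
Proof.
have S x' : (forall m, (n <= m)%N -> x' m = 0) -> (sup0 x' <= (\sum_(i < n) normc (x' i))%:E)%E.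
  move=> H; apply: ge_ereal_sup => _ [m _ <-]; rewrite lee_fin.
  case: (ltnP m n) => mn; last by rewrite H // n0 sumr_ge0.
  by rewrite (bigD1 (Ordinal mn)) //= lerDl sumr_ge0.
elim: k x => [|k IH] x H; first exact: S.
rewrite /= ge_max S //=.
apply: (@le_trans _ _ (2^-1%:E * (\sum_(i < n) normc (x i))%:E)%E); last first.
  by rewrite -EFinM lee_fin ler_piMl ?sumr_ge0 // invf_le1 ?ler1n.
apply: lee_wpmul2l => //.
apply: step_le => p E [_ dE].
apply: (@le_trans _ _ (\sum_(j < p) (\sum_(i < n) normc (restr (E j) x i))%:E)%E).
  by apply: lee_sum => j _; apply: IH; exact: restr_supp.
rewrite sumEFin lee_fin exchange_big /=.
apply: ler_sum => i _.
have [[j ij]|no] := pselect (exists j, (i : nat) \in E j).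
  rewrite (bigD1 j) //= big1 ?addr0 /restr ?ij // => l lj.
  case: ifP => // il.
  case: (ltngtP l j) => h.
  - by have := dE _ _ h _ _ il ij; rewrite ltnn.
  - by have := dE _ _ h _ _ ij il; rewrite ltnn.
  - by move/eqP: lj; case; apply: val_inj.
rewrite big1 // => j _; rewrite /restr; case: ifP => // ij.
by exfalso; apply: no; exists j.
Qed.

Let t_ub k x : (ts k x <= t x)%E.
Proof. by apply: ereal_sup_ubound; exists k. Qed.

Let t_ge0 x : (0 <= t x)%E.
Proof. exact: le_trans (ts_ge0 0 x) (t_ub 0 x). Qed.

Let N x : R := fine (t x).

Let NE x : c00 x -> (N x)%:E = t x.
Proof.
move=> [n H]; rewrite /N fineK // fin_real //; apply/andP; split.
  exact: lt_le_trans (t_ge0 x).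
apply: (@le_lt_trans _ _ (\sum_(i < n) normc (x i))%:E); last exact: ltry.
by apply: ge_ereal_sup => _ [k _ <-]; exact: ts_l1.
Qed.

Let c00_restr E x : c00 x -> c00 (restr E x).
Proof. by move=> [n H]; exists n; exact: restr_supp. Qed.

Let tZ (a : R[i]) x : (t (a *: x) <= (normc a)%:E * t x)%E.
Proof.
apply: ge_ereal_sup => _ [k _ <-]; apply: le_trans (tsZ _ _ _) _.
by apply: lee_wpmul2l; rewrite ?lee_fin.
Qed.

Let c00Z (a : R[i]) x : c00 x -> c00 (a *: x).
Proof.
move=> [n H]; exists n => m nm.
have -> : (a *: x) m = a *: x m by [].
by rewrite H // scaler0.
Qed.

Let NZ (a : R[i]) x : c00 x -> N (a *: x) <= normc a * N x.
Proof. by move=> cx; rewrite -lee_fin EFinM !NE //; exact: c00Z. Qed.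

Lemma tsirelson_norm_exists : exists N : omega R -> R, is_tsirelson_norm N.
Proof.
exists N; split.
- move=> x cx Nx; apply/funext => n; apply: eq0_normc.
  apply/eqP; rewrite eq_le nge0 andbT -lee_fin.
  by rewrite (le_trans (sup0_ub x n))// -Nx NE //; exact: (t_ub 0 x).
- move=> a x cx; apply/eqP; rewrite eq_le NZ //=.
  have [->|a0] := eqVneq a 0.
    by rewrite n0 mul0r fine_ge0.
  rewrite -{1}(scale1r x) -(mulVf a0) -scalerA.
  apply: le_trans (ler_wpM2l (nge0 a) (NZ _ (c00Z _ cx))) _.
  by rewrite mulrA -normcM mulfV // normc1 mul1r.
- move=> x y cx cy.
  have cxy : c00 (x + y).
    case: cx cy => [n H] [m H']; exists (maxn n m) => p; rewrite geq_max => /andP[np mp].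
    have -> : (x + y) p = x p + y p by [].
    by rewrite H // H' // addr0.
  rewrite -lee_fin EFinD !NE //.
  apply: ge_ereal_sup => _ [k _ <-]; apply: le_trans (tsD _ _ _) _.
  exact: leeD.
- move=> x cx.
  have -> : [set s | exists k (E : 'I_k -> {fset nat}),
         admissible E /\ s = (\sum_(j < k) N (restr (E j) x))%:E] =
      [set s | exists k (E : 'I_k -> {fset nat}),
         admissible E /\ s = (\sum_(j < k) t (restr (E j) x))%E].
    by apply/seteqP; split => _ [k [E [aE ->]]]; exists k, E; split => //;
      rewrite -sumEFin; apply: eq_bigr => j _; rewrite NE //; exact: c00_restr.
  rewrite NE // -/(step t x) -/(sup0 x).
  apply/eqP; rewrite eq_le; apply/andP; split.
    apply: ge_ereal_sup => _ [[|k] _ <-] /=; first by rewrite le_max lexx.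
    rewrite ge_max le_max lexx /= le_max; apply/orP; right.
    apply: lee_wpmul2l => //; apply: step_le => n E aE.
    apply: le_trans (step_ub _ _ aE); apply: lee_sum => j _; exact: t_ub.
  rewrite ge_max (t_ub 0 x) /=.
  rewrite lee_pdivrMl //.
  apply: step_le => n E aE.
  have cv : (\sum_(j < n) ts k (restr (E j) x))%E @[k --> \oo] -->
            (\sum_(j < n) t (restr (E j) x))%E.
    apply: cvg_nnesum => j _.
      by apply: nearW => k; exact: ts_ge0.
    apply: ereal_nondecreasing_cvgn.
    by apply/nondecreasing_seqP => k; exact: ts_mono.
  rewrite -(cvg_lim _ cv) //; apply: lime_le; first by apply/cvg_ex; eexists; exact: cv.
  apply: nearW => k.
  rewrite -lee_pdivrMl //; apply: le_trans (t_ub k.+1 x).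
  rewrite /= le_max; apply/orP; right; apply: lee_wpmul2l => //; exact: step_ub.
Qed.
End tsirelson_existence.

Section symmetric_tsirelson.
Variable R : realType.

Definition convexification2 (N : omega R -> R) (x : omega R) : R :=
  Num.sqrt (N (fun n => ((normc (x n)) ^+ 2)%:C)).

(* The norm, on [c00], of the symmetric version of the space whose norm on
   [c00] is [N]. *)
Definition symmetric_version (N : omega R -> \bar R) (x : omega R) : \bar R :=
  ereal_sup [set (normc (pairing x y))%:E | y in [set y | c00 y /\
    (ereal_sup [set dual_norm N (fun n => y (p n))
               | p in [set p : nat -> nat | bijective p]] <= 1)%E]].

Definition Ts2_norm (tnorm : omega R -> R) : omega R -> \bar R :=
  completion_norm
    (symmetric_version (fun x => (convexification2 tnorm x)%:E)).

End symmetric_tsirelson.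

Section derived.
Variables (R : realType) (NX : omega R -> \bar R).

Definition strip : set R[i]^o := [set z | 0 <= complex.Re z <= 1].
Definition open_strip : set R[i]^o := [set z | 0 < complex.Re z < 1].

Definition bounded_continuous_in (N : omega R -> \bar R) (f : R -> omega R) :=
  (exists M : R, forall t, (N (f t) <= M%:E)%E) /\
  (forall t, N (f s - f t) @[s --> t] --> 0%E).

(* [open_strip] is the interior of [strip].  The scalars being complex,
   [derivable _ z 1] is complex differentiability at [z].  The values of [F]
   outside [strip] are irrelevant. *)
Record calF (F : R[i] -> omega R) : Prop := CalF {
  calF_bounded : forall j, exists M : R,
    forall z, strip z -> normc (F z j) <= M;
  calF_continuous : forall j,
    {within strip, continuous (fun z : R[i]^o => F z j)};
  calF_analytic : forall j z, open_strip z ->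
    derivable (fun z : R[i]^o => F z j) z 1;
  calF_left : bounded_continuous_in NX (fun t => F (0 +i* t));
  calF_right : bounded_continuous_in (dual_norm NX) (fun t => F (1 +i* t))
}.

Definition calF_norm (F : R[i] -> omega R) : \bar R :=
  Order.max (ereal_sup [set NX (F (0 +i* t)) | t in [set: R]])
            (ereal_sup [set dual_norm NX (F (1 +i* t)) | t in [set: R]]).

Definition derived_norm (xy : omega R * omega R) : \bar R :=
  ereal_inf [set calF_norm F | F in [set F | [/\ calF F, F 2^-1 = xy.2 &
    forall j, derive1 (fun z : R[i]^o => F z j) 2^-1 = xy.1 j]]].

End derived.

(* The natural basis, with [derived_basis j] = v_(j+1). *)
Definition derived_basis (R : realType) (j : nat) : omega R * omega R :=
  if odd j then (0, unit_vector R j./2) else (unit_vector R j./2, 0).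

Section hilbertian.
Variables (R : realType) (V : lmodType R[i]) (N : V -> \bar R).

Definition l2norm (n : nat) (a : 'rV[R[i]]_n) : R :=
  Num.sqrt (\sum_(i < n) normc (a ord0 i) ^+ 2).

Definition linear_iso_onto (n : nat) (E : set V) (T : 'rV[R[i]]_n -> V) :=
  [/\ linear T, injective T & range T = E].

Definition has_dim (E : set V) (n : nat) : Prop :=
  exists T : 'rV[R[i]]_n -> V, linear_iso_onto E T.

(* The Banach-Mazur distance d(E, l_2^n) for E of dimension n: the infimum of
   |T| |T^-1| over the linear isomorphisms T of l_2^n onto E. *)
Definition hilbert_distance (E : set V) (n : nat) : \bar R :=
  ereal_inf [set (ereal_sup [set N (T a) | a in [set a | (l2norm a <= 1)%R]] *
      ereal_sup [set (l2norm a)%:E | a in [set a | N (T a) <= 1]])%E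
    | T in [set T : 'rV[R[i]]_n -> V | linear_iso_onto E T]].

Definition is_subspace (Y : set V) : Prop :=
  [/\ Y 0, (forall x, Y x -> (N x < +oo)%E) &
      forall (a : R[i]) x y, Y x -> Y y -> Y (a *: x + y)].

Definition finite_codim (Y : set V) : Prop :=
  exists (k : nat) (w : 'I_k -> V), (forall i, (N (w i) < +oo)%E) /\
    forall x, (N x < +oo)%E ->
      exists c : 'I_k -> R[i], Y (x - \sum_(i < k) c i *: w i).

Definition asymptotically_hilbertian : Prop :=
  exists2 C : R, 0 < C & forall n : nat, exists Y : set V,
    [/\ is_subspace Y, finite_codim Y &
        forall E : set V, E `<=` Y -> has_dim E n ->
          (hilbert_distance E n <= C%:E)%E].

(* K-equivalence to the unit vector basis of l_2^|A|: the linear map sending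
   one basis to the other satisfies |T| |T^-1| <= K. *)
Definition equivalent_to_l2 (A : {fset nat}) (b : nat -> V) (K : R) : Prop :=
  exists c d : R, [/\ 0 < c, 0 < d, d <= K * c &
    forall a : nat -> R[i],
      let h := Num.sqrt (\sum_(j <- A) normc (a j) ^+ 2) in
      ((c * h)%:E <= N (\sum_(j <- A) a j *: b j)%R)%E /\
      (N (\sum_(j <- A) a j *: b j)%R <= (d * h)%:E)%E].

(* The family is [(b j)] for [j] in [J]. *)
Definition euclidean (J : set nat) (b : nat -> V) (m : nat) (K : R) : Prop :=
  forall A : {fset nat}, [set` A] `<=` J -> (#|` A| <= m)%N ->
    equivalent_to_l2 A b K.

Definition E_property (b : nat -> V) (n m : nat) (K : R) : Prop :=
  exists2 I : {fset nat}, #|` I| = n & euclidean (~` [set` I]) b m K.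

End hilbertian.

(* Main.v *)
From HB Require Import structures.
Require Import Defs.
From mathcomp Require Import all_boot all_order all_algebra finmap.
From mathcomp Require Import all_classical all_reals all_analysis.
From mathcomp Require Import complex ring lra.

Set Implicit Arguments.
Unset Strict Implicit.
Unset Printing Implicit Defensive.

Import Order.TTheory GRing.Theory Num.Theory.
Import numFieldNormedType.Exports.
Import Normc.

Local Open Scope classical_set_scope.
Local Open Scope ring_scope.
Local Open Scope complex_scope.

(** The space [Z(X)], with [X] the symmetric Tsirelson space, is a twisted Hilbert
    space: the vectors [(x, 0)] form a copy of [l_2] with quotient [l_2].  The
    vectors [(0, y)] do not see this [l_2] behaviour, and both claims fail
    because of them.

    The key fact, [derived_norm_unbounded], is that no inequality
    [|(0, x)| <= K |x|_2] holds for all [x] supported in any given infinite set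
    of coordinates.  Let [F] be admissible in the definition of [|(0, x)|], with
    boundary values of norm at most [K], and let [x_n = sqrt (a_n b_n)] where [a]
    and [b] are nonnegative, [a] is in the unit ball of [X] and [b] in the unit
    ball of its dual.  The functions
    [G_n(z) = x_n exp (ln (a_n / b_n) (z - 1/2))] have modulus [b_n] on the line
    [Re z = 0] and [a_n] on the line [Re z = 1], so that [h(z) = sum F_n(z) G_n(z)]
    is bounded by [K] on the boundary of the strip.  Since [F(1/2) = x] and
    [F'(1/2) = 0], its derivative at [1/2] is [sum a_n b_n ln (a_n / b_n)], and
    Cauchy's estimate bounds this sum by [10 (K + 1)] ([entropy_le]).  On the other
    hand [a b ln (a / b) >= a b (ln mu + 1) - mu b^2] for every [mu > 0], so the
    sum is large as soon as [sum a_n b_n >= 1/2] while [sum b_n^2] is small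
    ([entropy_ge]).

    Such pairs exist because the Tsirelson space does not contain [l_1]
    ([small_average], after Figiel and Johnson): it has probability vectors [v]
    of small norm, and [sqrt v] is then a unit vector of [l_2] which is small
    in the 2-convexification, hence large in its dual.  Normalized there, it
    becomes a functional [b] which is small in [l_2], and [a] is a vector that
    nearly norms it ([good_pair_exists]).  All the norms being symmetric, a pair can be
    moved to any coordinates.

    The first claim is harder to reach.  A finite-codimensional subspace [Y] need
    not contain any basis vector, but it contains vectors [(0, d_j)] with disjoint
    supports, [l_1] norm at most [3], and a coordinate [a_j] where [d_j] is [1]
    ([flat_kernel_vector]); the bound [3] does not depend on the codimension.  If
    the span of [m] of these is [C]-isomorphic to [l_2^m], then the type 2
    inequality of Hilbert space bounds [sum s_j x_j (0, d_j)] for a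
    choice of signs [s_j] ([upper_l2_estimate]).  Restricting to the
    coordinates [a_j] and correcting the signs are coordinatewise multiplications,
    contractive on [Z(X)] ([derived_norm_act]), and leave [x] spread over the
    [a_j].  For the second claim, the same estimate is read off directly from the
    vectors [v_2j], whose norms are at most [1].

    The derivative estimate is proved from Goursat's theorem: integrating
    [g(z) / (z - 1/2)^2] around a long rectangle in the strip minus a small square
    ([rectangle_estimate]).  Only real parts of contour integrals occur, written
    as increments of real primitives along the sides. *)


(** * Primitives of real functions *)

Section real_primitives.
Variable R : realType.
Implicit Types (f g P Q : R -> R) (a b x : R).

Lemma is_derive_continuous f x d : is_derive x 1 f d -> {for x, continuous f}.
Proof.
move=> [fx _]; apply: differentiable_continuous.
exact/derivable1_diffP.
Qed.

Lemma within_continuous f a b :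
  (forall x, a <= x <= b -> {for x, continuous f}) ->
  {within `[a, b], continuous f}.
Proof.
move=> cf; apply: continuous_in_subspaceT => x; rewrite inE /= in_itv /=.
exact: cf.
Qed.

Lemma primitive_exists g a b :
  (forall x, a <= x <= b -> {for x, continuous g}) ->
  exists P, forall x, a < x < b -> is_derive x 1 P (g x).
Proof.
move=> cg.
exists (fun x => (\int[lebesgue_measure]_(t in `[a, x]) g t)%R) => x /andP[ax xb].
have ig : lebesgue_measure.-integrable `[a, b] (EFin \o g).
  apply: continuous_compact_integrable; first exact: segment_compact.
  exact: within_continuous.
have [] := continuous_FTC1_closed xb ig ax (cg _ _).
  by rewrite !ltW.
by move=> dP e; apply: (DeriveDef dP); rewrite -derive1E.
Qed.

(** Integrals enter only as increments of primitives, so this is the form that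
    the triangle inequality for integrals takes. *)
Lemma increment_le P Q p q a b : a <= b ->
  (forall x, a <= x <= b -> is_derive x 1 P (p x)) ->
  (forall x, a <= x <= b -> is_derive x 1 Q (q x)) ->
  (forall x, a <= x <= b -> p x <= q x) ->
  P b - P a <= Q b - Q a.
Proof.
move=> ab dP dQ pq.
have d x : a <= x <= b -> is_derive x 1 (Q - P) (q x - p x).
  by move=> xab; have := dP _ xab; have := dQ _ xab => ? ?; exact: is_deriveB.
have d' x : x \in `]a, b[ -> is_derive x 1 (Q - P) (q x - p x).
  by rewrite in_itv /= => /andP[? ?]; apply: d; rewrite !ltW.
have cQP : {within `[a, b], continuous (Q - P)}.
  by apply: within_continuous => x xab; exact: is_derive_continuous (d _ xab).
have [c] := MVT_segment ab d' cQP.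
rewrite in_itv /= => cab e.
rewrite -subr_ge0; have -> : Q b - Q a - (P b - P a) = (Q - P) b - (Q - P) a.
  by rewrite !fctE; ring.
by rewrite e mulr_ge0 // subr_ge0 ?pq.
Qed.

Lemma increment_bound P p a b M : a <= b ->
  (forall x, a <= x <= b -> is_derive x 1 P (p x)) ->
  (forall x, a <= x <= b -> `|p x| <= M) ->
  `|P b - P a| <= M * (b - a).
Proof.
move=> ab dP pM.
have dM (c : R) x : is_derive x 1 (fun y => c * y) c.
  by have := is_deriveZ c (is_derive_id x 1); rewrite /GRing.scale /= mulr1.
rewrite ler_norml; apply/andP; split.
  rewrite -mulNr mulrBr; apply: (@increment_le _ _ (fun=> - M) p a b ab) => // x xab.
  by rewrite lerNl; apply: le_trans (pM _ xab); rewrite -normrN ler_norm.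
rewrite mulrBr; apply: (@increment_le _ _ p (fun=> M) a b ab) => // x xab.
by apply: le_trans (pM _ xab); rewrite ler_norm.
Qed.

Lemma primitive_unique P Q p a b : a <= b ->
  (forall x, a <= x <= b -> is_derive x 1 P (p x)) ->
  (forall x, a <= x <= b -> is_derive x 1 Q (p x)) ->
  P b - P a = Q b - Q a.
Proof.
by move=> ab dP dQ; apply/eqP; rewrite eq_le;
  apply/andP; split; apply: (increment_le ab) => // x _; exact: lexx.
Qed.

End real_primitives.

(** * Complex moduli and the bisection argument *)

Section complex_modulus.
Variable R : realType.
Implicit Types z w : R[i].

Lemma normc_ge0 z : 0 <= normc z.
Proof. by case: z => a b; exact: sqrtr_ge0. Qed.

Lemma ReB z w : complex.Re (z - w) = complex.Re z - complex.Re w.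
Proof. by case: z w => ? ? [? ?]. Qed.

Lemma ImB z w : complex.Im (z - w) = complex.Im z - complex.Im w.
Proof. by case: z w => ? ? [? ?]. Qed.

Lemma Re_le_normc z : `|complex.Re z| <= normc z.
Proof. by case: z => a b /=; rewrite -sqrtr_sqr ler_wsqrtr // lerDl sqr_ge0. Qed.

Lemma Im_le_normc z : `|complex.Im z| <= normc z.
Proof. by case: z => a b /=; rewrite -sqrtr_sqr ler_wsqrtr // lerDr sqr_ge0. Qed.

Lemma normc_le_ReIm z : normc z <= `|complex.Re z| + `|complex.Im z|.
Proof.
case: z => a b /=; rewrite -[leRHS]ger0_norm ?addr_ge0 // -sqrtr_sqr ler_wsqrtr //.
rewrite sqrrD !real_normK ?num_real // lerD2r lerDl.
by rewrite mulrn_wge0 // mulr_ge0.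
Qed.

Lemma normc_real (a : R) : normc a%:C = `|a|.
Proof. by rewrite /= expr0n /= addr0 sqrtr_sqr. Qed.

Lemma normc_eq0P z : normc z = 0 <-> z = 0.
Proof. by split=> [|->]; [exact: eq0_normc | exact: normc0]. Qed.

Lemma normc_distC z w : normc (z - w) = normc (w - z).
Proof. by rewrite -normcN opprB. Qed.

End complex_modulus.

(** Complex differentiability through inequalities between moduli, which is how
    the bisection argument consumes it. *)
Definition has_cderiv (R : realType) (f : R[i] -> R[i]) (z L : R[i]) : Prop :=
  forall e : R, 0 < e -> exists2 d : R, 0 < d & forall w, normc (w - z) < d ->
    normc (f w - f z - L * (w - z)) <= e * normc (w - z).

Section goursat.
Variable R : realType.
Variable f : R[i] -> R[i].
Variables U W : R -> R -> R.

(** Real part of the integral of [f] along the boundary of a rectangle, when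
    [U y] and [W x] are primitives of [Re f] and [Im f] along the line of
    ordinate [y] and the line of abscissa [x]. *)
Let Phi x1 x2 y1 y2 : R :=
  (U y1 x2 - U y1 x1) - (U y2 x2 - U y2 x1)
  - (W x2 y2 - W x2 y1) + (W x1 y2 - W x1 y1).

Let line_derive (al l m a x : R) :
  is_derive x 1 (fun t => al * t + l * (t - a) ^+ 2 / 2 - m * t)
    (al + l * (x - a) - m).
Proof.
have dB : is_derive x 1 (fun t : R => t - a) 1.
  have := is_deriveB (is_derive_id x (1 : R)) (is_derive_cst a x (1 : R)).
  by rewrite subr0.
have dX : is_derive x 1 ((fun t : R => t - a) * (fun t : R => t - a))
    ((x - a) * 1 + (x - a) * 1) by exact: is_deriveM.
have dl := is_deriveZ (l / 2) dX.
have da := is_deriveZ (al - m) (is_derive_id x (1 : R)).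
have := is_deriveD da dl.
set g := (X in is_derive x 1 X _); set g' := (X in is_derive _ _ _ X) => d.
have -> : (fun t => al * t + l * (t - a) ^+ 2 / 2 - m * t) = g.
  apply/funext => t; transitivity ((al - m) * t + l / 2 * ((t - a) * (t - a))) => //.
  by field.
have -> : al + l * (x - a) - m = g' by rewrite /g' /GRing.scale /=; field.
exact: d.
Qed.

Variables x0 y0 d1 d2 : R.
Hypotheses (d1_ge0 : 0 <= d1) (d2_ge0 : 0 <= d2).
Hypothesis dU : forall x y, x0 <= x <= x0 + d1 -> y0 <= y <= y0 + d2 ->
  is_derive x 1 (U y) (complex.Re (f (x +i* y))).
Hypothesis dW : forall x y, x0 <= x <= x0 + d1 -> y0 <= y <= y0 + d2 ->
  is_derive y 1 (W x) (complex.Im (f (x +i* y))).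
Hypothesis df : forall x y, x0 <= x <= x0 + d1 -> y0 <= y <= y0 + d2 ->
  exists L, has_cderiv f (x +i* y) L.

(** The contour integral of an affine function vanishes, so only the
    first-order error of [f] at the point contributes. *)
Let small_rectangle a b e : x0 <= a <= x0 + d1 -> y0 <= b <= y0 + d2 -> 0 < e ->
  exists2 d, 0 < d & forall x1 x2 y1 y2 s,
    x0 <= x1 <= a -> a <= x2 <= x0 + d1 -> y0 <= y1 <= b -> b <= y2 <= y0 + d2 ->
    x2 - x1 <= s -> y2 - y1 <= s -> s *+ 2 < d ->
    `|Phi x1 x2 y1 y2| <= e * s ^+ 2 *+ 8.
Proof.
move=> xa yb e0.
have [L dL] := df xa yb.
have [d d0 hd] := dL e e0.
exists d => // x1 x2 y1 y2 s /andP[x01 x1a] /andP[ax2 x2d] /andP[y01 y1b] /andP[by2 y2d] xs ys sd.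
have s0 : 0 <= s by apply: le_trans xs; rewrite subr_ge0 (le_trans x1a).
case E : (f (a +i* b)) => [al be].
case EL : L => [l m].
have close x y : x1 <= x <= x2 -> y1 <= y <= y2 ->
    `|complex.Re (f (x +i* y)) - (al + l * (x - a) - m * (y - b))| <= e * s *+ 2 /\
    `|complex.Im (f (x +i* y)) - (be + l * (y - b) - - m * (x - a))| <= e * s *+ 2.
  move=> /andP[xx1 xx2] /andP[yy1 yy2].
  have nz : normc ((x +i* y) - (a +i* b)) <= s *+ 2.
    apply: le_trans (normc_le_ReIm _) _; rewrite ReB ImB /= mulr2n lerD //.
      by rewrite ler_norml; apply/andP; split; lra.
    by rewrite ler_norml; apply/andP; split; lra.
  have H := hd _ (le_lt_trans nz sd).
  have {H} : normc (f (x +i* y) - f (a +i* b) - L * ((x +i* y) - (a +i* b))) <= e * s *+ 2.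
    by apply: le_trans H _; rewrite -mulrnAr ler_pM2l.
  rewrite E EL; case: (f _) => u v H.
  have eRe : u - (al + l * (x - a) - m * (y - b)) =
      complex.Re ((u +i* v) - (al +i* be) - (l +i* m) * ((x +i* y) - (a +i* b))).
    by rewrite /=; ring.
  have eIm : v - (be + l * (y - b) - - m * (x - a)) =
      complex.Im ((u +i* v) - (al +i* be) - (l +i* m) * ((x +i* y) - (a +i* b))).
    by rewrite /=; ring.
  by rewrite /= eRe eIm; split; [apply: le_trans (Re_le_normc _) H | apply: le_trans (Im_le_normc _) H].
have hor y : y1 <= y <= y2 ->
    `|U y x2 - U y x1 - (al * (x2 - x1) + l * ((x2 - a) ^+ 2 - (x1 - a) ^+ 2) / 2
        - m * (y - b) * (x2 - x1))| <= e * s ^+ 2 *+ 2.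
  move=> yy; have yy' : y0 <= y <= y0 + d2 by case/andP: yy => *; apply/andP; split; lra.
  set g := fun t => al * t + l * (t - a) ^+ 2 / 2 - m * (y - b) * t.
  have -> : U y x2 - U y x1 - (al * (x2 - x1) + l * ((x2 - a) ^+ 2 - (x1 - a) ^+ 2) / 2
        - m * (y - b) * (x2 - x1)) = (U y - g) x2 - (U y - g) x1.
    by rewrite /g !fctE; field.
  apply: le_trans (increment_bound (p := fun x => complex.Re (f (x +i* y)) -
      (al + l * (x - a) - m * (y - b))) (M := e * s *+ 2) _ _ _) _.
  - by lra.
  - move=> x /andP[xx1 xx2]; have xx' : x0 <= x <= x0 + d1 by apply/andP; split; lra.
    by have := is_deriveB (dU xx' yy') (line_derive al l (m * (y - b)) a x).
  - by move=> x xx; have [] := close x y xx yy.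
  - rewrite (_ : e * s ^+ 2 *+ 2 = e * s *+ 2 * s); last by rewrite expr2; ring.
    by rewrite ler_wpM2l // mulrn_wge0 // mulr_ge0 // ltW.
have ver x : x1 <= x <= x2 ->
    `|W x y2 - W x y1 - (be * (y2 - y1) + l * ((y2 - b) ^+ 2 - (y1 - b) ^+ 2) / 2
        - (- m * (x - a)) * (y2 - y1))| <= e * s ^+ 2 *+ 2.
  move=> xx; have xx' : x0 <= x <= x0 + d1 by case/andP: xx => *; apply/andP; split; lra.
  set g := fun t => be * t + l * (t - b) ^+ 2 / 2 - (- m * (x - a)) * t.
  have -> : W x y2 - W x y1 - (be * (y2 - y1) + l * ((y2 - b) ^+ 2 - (y1 - b) ^+ 2) / 2
        - (- m * (x - a)) * (y2 - y1)) = (W x - g) y2 - (W x - g) y1.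
    by rewrite /g !fctE; field.
  apply: le_trans (increment_bound (p := fun y => complex.Im (f (x +i* y)) -
      (be + l * (y - b) - - m * (x - a))) (M := e * s *+ 2) _ _ _) _.
  - by lra.
  - move=> y /andP[yy1 yy2]; have yy' : y0 <= y <= y0 + d2 by apply/andP; split; lra.
    by have := is_deriveB (dW xx' yy') (line_derive be l (- m * (x - a)) b y).
  - by move=> y yy; have [] := close x y xx yy.
  - rewrite (_ : e * s ^+ 2 *+ 2 = e * s *+ 2 * s); last by rewrite expr2; ring.
    by rewrite ler_wpM2l // mulrn_wge0 // mulr_ge0 // ltW.
have h1 : y1 <= y2 by lra.
have h2 : x1 <= x2 by lra.
have v2 : x1 <= x2 <= x2 by rewrite h2 /=.
have v1 : x1 <= x1 <= x2 by rewrite h2 andbT.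
have u2 : y1 <= y2 <= y2 by rewrite h1 /=.
have u1 : y1 <= y1 <= y2 by rewrite h1 andbT.
move: (ver _ v2) (ver _ v1) (hor _ u2) (hor _ u1); rewrite /Phi; set B := e * s ^+ 2; rewrite !ler_norml => /andP[? ?] /andP[? ?] /andP[? ?] /andP[? ?].
apply/andP; split; lra.
Qed.

Let Phin n (p : R * R) := Phi p.1 (p.1 + d1 / 2 ^+ n) p.2 (p.2 + d2 / 2 ^+ n).

Let half_step (d : R) n : d / 2 ^+ n = d / 2 ^+ n.+1 + d / 2 ^+ n.+1.
Proof. by rewrite exprS invfM; field; rewrite expf_neq0. Qed.

Let quarter n (p : R * R) : exists q : R * R,
  [/\ p.1 <= q.1, q.1 + d1 / 2 ^+ n.+1 <= p.1 + d1 / 2 ^+ n,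
      p.2 <= q.2, q.2 + d2 / 2 ^+ n.+1 <= p.2 + d2 / 2 ^+ n &
      `|Phin n p| <= `|Phin n.+1 q| *+ 4].
Proof.
case: p => x y; rewrite /= ; have := half_step d1 n; have := half_step d2 n.
rewrite /Phin; set h1 := d1 / 2 ^+ n.+1; set h2 := d2 / 2 ^+ n.+1 => -> ->.
have h1_ge0 : 0 <= h1 by rewrite divr_ge0 // exprn_ge0.
have h2_ge0 : 0 <= h2 by rewrite divr_ge0 // exprn_ge0.
set P := `|_|.
have four : P <= `|Phi x (x + h1) y (y + h2)| + `|Phi (x + h1) (x + h1 + h1) y (y + h2)|
   + `|Phi x (x + h1) (y + h2) (y + h2 + h2)|
   + `|Phi (x + h1) (x + h1 + h1) (y + h2) (y + h2 + h2)|.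
  rewrite /P /= !addrA (_ : Phi _ _ _ _ = Phi x (x + h1) y (y + h2) + Phi (x + h1) (x + h1 + h1) y (y + h2)
   + Phi x (x + h1) (y + h2) (y + h2 + h2)
   + Phi (x + h1) (x + h1 + h1) (y + h2) (y + h2 + h2)); last by rewrite /Phi; ring.
  by do 3 (apply: le_trans (ler_normD _ _) _; apply: lerD => //).
have [c1|c1] := leP P (`|Phi x (x + h1) y (y + h2)| *+ 4).
  by exists (x, y); split => //=; lra.
have [c2|c2] := leP P (`|Phi (x + h1) (x + h1 + h1) y (y + h2)| *+ 4).
  by exists (x + h1, y); split => //=; lra.
have [c3|c3] := leP P (`|Phi x (x + h1) (y + h2) (y + h2 + h2)| *+ 4).
  by exists (x, y + h2); split => //=; lra.
exists (x + h1, y + h2); split => //=; lra.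
Qed.

Lemma nested_point (u : nat -> R) (d : R) : 0 <= d ->
  (forall n, u n <= u n.+1 /\ u n.+1 + d / 2 ^+ n.+1 <= u n + d / 2 ^+ n) ->
  exists a, forall n, u n <= a <= u n + d / 2 ^+ n.
Proof.
move=> d_ge0 hu.
have up m n : (m <= n)%N -> u m <= u n.
  by move=> mn; apply: (@homo_leq _ u (fun x y => x <= y)) => //;
    [exact: le_trans | move=> k; case: (hu k)].
have dn m n : (m <= n)%N -> u n + d / 2 ^+ n <= u m + d / 2 ^+ m.
  move=> mn; apply: (@homo_leq _ (fun k => u k + d / 2 ^+ k) (fun x y => y <= x)) => //.
    by move=> x y z xy yz; exact: le_trans yz xy.
  by move=> k; case: (hu k).
have ud n : 0 <= d / 2 ^+ n by rewrite divr_ge0 // exprn_ge0.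
have ub m n : u m <= u n + d / 2 ^+ n.
  have [mn|nm] := leqP m n.
    by apply: le_trans (up _ _ mn) _; rewrite lerDl.
  by apply: le_trans (dn _ _ (ltnW nm)); rewrite lerDl.
have S : has_sup (range u).
  by split; [exists (u 0%N), 0%N | exists (u 0%N + d / 2 ^+ 0) => _ [n _ <-]].
exists (sup (range u)) => n; apply/andP; split.
  by apply: sup_upper_bound => //; exists n.
by apply: ge_sup => [|_ [m _ <-] //]; exists (u 0%N), 0%N.
Qed.

Lemma pow2_small (d e : R) : 0 <= d -> 0 < e -> exists n, d / 2 ^+ n < e.
Proof.
move=> d0 e0; exists (Num.bound (d / e)).
have := @archi_boundP _ (d / e) (divr_ge0 d0 (ltW e0)).
set n := Num.bound _ => h.
rewrite ltr_pdivrMr ?exprn_gt0 // mulrC -ltr_pdivrMr //.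
by apply: lt_le_trans h _; rewrite -natrX ler_nat ltnW // ltn_expl.
Qed.

Lemma goursat_bisection : Phi x0 (x0 + d1) y0 (y0 + d2) = 0.
Proof.
pose next n p := sval (cid (quarter n p)).
have nextP n p := svalP (cid (quarter n p)).
pose fix p n := if n is k.+1 then next k (p k) else (x0, y0).
have pS n : p n.+1 = next n (p n) by [].
have [a ha] : exists a, forall n, (p n).1 <= a <= (p n).1 + d1 / 2 ^+ n.
  by apply: nested_point => // n; rewrite pS; case: (nextP n (p n)).
have [b hb] : exists b, forall n, (p n).2 <= b <= (p n).2 + d2 / 2 ^+ n.
  by apply: nested_point => // n; rewrite pS; case: (nextP n (p n)).
have in1 n : x0 <= (p n).1 /\ (p n).1 + d1 / 2 ^+ n <= x0 + d1.
  elim: n => [|n [IH1 IH2]]; first by rewrite /= expr0 divr1.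
  rewrite pS; case: (nextP n (p n)) => h1 h2 _ _ _.
  by split; [apply: le_trans h1 | apply: le_trans h2 _].
have in2 n : y0 <= (p n).2 /\ (p n).2 + d2 / 2 ^+ n <= y0 + d2.
  elim: n => [|n [IH1 IH2]]; first by rewrite /= expr0 divr1.
  rewrite pS; case: (nextP n (p n)) => _ _ h1 h2 _.
  by split; [apply: le_trans h1 | apply: le_trans h2 _].
have big n : `|Phin 0 (x0, y0)| <= `|Phin n (p n)| * 4 ^+ n.
  elim: n => [|n IH]; first by rewrite expr0 mulr1.
  apply: le_trans IH _; rewrite exprS mulrA ler_wpM2r ?exprn_ge0 //.
  by rewrite pS mulr_natr; case: (nextP n (p n)).
have Ee e : 0 < e -> `|Phin 0 (x0, y0)| <= e * (d1 + d2) ^+ 2 *+ 8.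
  move=> e0.
  have xa : x0 <= a <= x0 + d1 by have := ha 0%N; rewrite /= expr0 divr1.
  have yb : y0 <= b <= y0 + d2 by have := hb 0%N; rewrite /= expr0 divr1.
  have [d d0 hd] := small_rectangle xa yb e0.
  have [n hn] : exists n, (d1 + d2) / 2 ^+ n < d / 2.
    by apply: pow2_small; [rewrite addr_ge0 | rewrite divr_gt0].
  apply: le_trans (big n) _.
  have := hd (p n).1 ((p n).1 + d1 / 2 ^+ n) (p n).2 ((p n).2 + d2 / 2 ^+ n)
    ((d1 + d2) / 2 ^+ n).
  have [i1 i2] := in1 n; have [j1 j2] := in2 n.
  have /andP[k1 k2] := ha n; have /andP[l1 l2] := hb n.
  rewrite i1 i2 j1 j2 k1 k2 l1 l2 /= => /(_ isT isT isT isT) H.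
  have {H} H : `|Phin n (p n)| <= e * ((d1 + d2) / 2 ^+ n) ^+ 2 *+ 8.
    apply: H; last by lra.
    - by rewrite addrAC subrr add0r ler_wpM2r ?invr_ge0 ?exprn_ge0 // lerDl.
    - by rewrite addrAC subrr add0r ler_wpM2r ?invr_ge0 ?exprn_ge0 // lerDr.
  apply: le_trans (ler_wpM2r _ H) _; first by rewrite exprn_ge0.
  rewrite exprMn exprVn -exprM mulnC exprM (_ : (2 : R) ^+ 2 = 4); last by ring.
  have : (4 : R) ^+ n != 0 by rewrite expf_neq0.
  by move=> h4; rewrite le_eqVlt; apply/orP; left; apply/eqP; field.
have : `|Phin 0 (x0, y0)| = 0.
  apply/eqP; rewrite eq_le normr_ge0 andbT; apply/ler_addgt0Pl => e e0; rewrite addr0.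
  have D : 0 < ((d1 + d2) ^+ 2 + 1) *+ 8 by rewrite pmulrn_lgt0 // ltr_wpDl ?sqr_ge0.
  apply: le_trans (Ee (e / (((d1 + d2) ^+ 2 + 1) *+ 8)) _) _; first exact: divr_gt0.
  rewrite -mulrnAr mulrAC ler_pdivrMr // ler_pM2l // ler_wMn2r // lerDl //.
by move/normr0_eq0; rewrite /Phin /= expr0 !divr1.
Qed.

End goursat.

(** * Goursat's theorem on rectangles *)

Section complex_derivative.
Variable R : realType.
Implicit Types (f : R[i] -> R[i]) (z L : R[i]).

Lemma normC_normc z : `|z| = (normc z)%:C.
Proof. by []. Qed.

Lemma ltc0_real (e : R[i]) : 0 < e -> exists2 r : R, 0 < r & e = r%:C.
Proof.
case: e => a b; rewrite ltcE /= => /andP[/eqP b0 a0].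
by exists a => //; rewrite b0.
Qed.

Lemma is_derive_has_cderiv f z L :
  is_derive (z : R[i]^o) 1 (f : R[i]^o -> R[i]^o) L -> has_cderiv f z L.
Proof.
move=> [df dL] e e0.
have : h^-1 *: ((f : R[i]^o -> R[i]^o) (h *: (1 : R[i]^o) + z) - f z) @[h --> (0 : R[i]^o)^'] --> (L : R[i]^o).
  by rewrite -dL; exact: df.
move/cvgrPdist_le => /(_ e%:C); rewrite ltcR e0 => /(_ isT).
rewrite /dnbhs /within /=.
move/nbhs_ballP => [d /= /ltc0_real[r r0 ->] hd].
exists r => // w wz.
have [->|nz] := eqVneq w z.
  by rewrite !subrr mulr0 subrr !normc0 mulr0.
have nz' : w - z != 0 by rewrite subr_eq0.
have := hd (w - z); rewrite /ball /= /ball_ /= sub0r normrN normC_normc ltcR => /(_ wz nz').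
rewrite normC_normc lecR /GRing.scale /= mulr1 subrK => H.
have -> : f w - f z - L * (w - z) = - (L - (w - z)^-1 * (f w - f z)) * (w - z).
  by field.
by rewrite normcM normcN ler_wpM2r ?normc_ge0.
Qed.

Lemma has_cderiv_is_derive f z L :
  has_cderiv f z L -> is_derive (z : R[i]^o) 1 (f : R[i]^o -> R[i]^o) L.
Proof.
move=> H.
have cv : h^-1 *: ((f : R[i]^o -> R[i]^o) (h *: (1 : R[i]^o) + z) - f z) @[h --> (0 : R[i]^o)^'] --> (L : R[i]^o).
  apply/cvgrPdist_le => e /ltc0_real[r r0 ->].
  have [d d0 hd] := H r r0.
  rewrite /dnbhs /within /=; apply/nbhs_ballP; exists d%:C; first by rewrite /= ltcR.
  move=> h; rewrite /ball /= /ball_ /= sub0r normrN normC_normc ltcR => hlt h0.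
  have := hd (h + z); rewrite addrK => /(_ hlt).
  rewrite normC_normc lecR /GRing.scale /= mulr1 => H'.
  have -> : L - h^-1 * (f (h + z) - f z) = - ((f (h + z) - f z - L * h) * h^-1) by field.
  rewrite normcN normcM normcV ler_pdivrMr //.
  by rewrite lt_def normc_ge0 andbT; apply: contra h0 => /eqP /normc_eq0P ->.
apply: DeriveDef; first by apply/cvg_ex; exists L.
by apply: cvg_lim => //.
Qed.

Lemma has_cderiv_eq f z L L' : has_cderiv f z L -> L = L' -> has_cderiv f z L'.
Proof. by move=> H <-. Qed.

Lemma has_cderiv_continuous f z L : has_cderiv f z L ->
  forall e : R, 0 < e -> exists2 d : R, 0 < d & forall w, normc (w - z) < d ->
    normc (f w - f z) <= e.
Proof.
move=> H e e0; have [d d0 hd] := H 1 ltr01.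
pose K := normc L + 1; have K0 : 0 < K by rewrite ltr_wpDl ?normc_ge0.
exists (Num.min d (e / K)); first by rewrite lt_min d0 divr_gt0.
move=> w; rewrite lt_min => /andP[wd we].
have -> : f w - f z = (f w - f z - L * (w - z)) + L * (w - z) by rewrite subrK.
apply: le_trans (le_normcD _ _) _; rewrite normcM.
have := hd _ wd; rewrite mul1r => h1.
rewrite ltr_pdivlMr // in we; apply/ltW; apply: le_lt_trans we.
have -> : normc (w - z) * K = normc (w - z) + normc L * normc (w - z) by rewrite /K; ring.
by rewrite lerD2r.
Qed.

Lemma continuous_horizontal f x y L : has_cderiv f (x +i* y) L ->
  {for x, continuous (fun t : R => complex.Re (f (t +i* y)))}.
Proof.
move=> H; apply/cvgrPdist_le => e e0.
have [d d0 hd] := has_cderiv_continuous H e0.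
near=> t; rewrite distrC -ReB; apply: le_trans (Re_le_normc _) _; apply: hd.
have -> : (t +i* y) - (x +i* y) = (t - x)%:C by apply/eqP; rewrite eq_complex /= subrr !eqxx.
rewrite normc_real distrC; near: t; exact: cvgr_dist_lt.
Unshelve. all: by end_near. Qed.

Lemma continuous_vertical f x y L : has_cderiv f (x +i* y) L ->
  {for y, continuous (fun t : R => complex.Im (f (x +i* t)))}.
Proof.
move=> H; apply/cvgrPdist_le => e e0.
have [d d0 hd] := has_cderiv_continuous H e0.
near=> t; rewrite distrC -ImB; apply: le_trans (Im_le_normc _) _; apply: hd.
apply: le_lt_trans (normc_le_ReIm _) _; rewrite ReB ImB /= subrr normr0 add0r.
rewrite distrC; near: t; exact: cvgr_dist_lt.
Unshelve. all: by end_near. Qed.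

End complex_derivative.

Section goursat_rectangle.
Variable R : realType.

Lemma horizontal_primitive (f : R[i] -> R[i]) (y x1 x2 e : R) : 0 < e ->
  (forall x, x1 - e < x < x2 + e -> exists L, has_cderiv f (x +i* y) L) ->
  exists P : R -> R, forall x, x1 <= x <= x2 -> is_derive x 1 P (complex.Re (f (x +i* y))).
Proof.
move=> e0 df.
have [|P dP] := @primitive_exists _ (fun t => complex.Re (f (t +i* y))) (x1 - e / 2) (x2 + e / 2).
  move=> x xx; have [|L dL] := df x; last exact: continuous_horizontal dL.
  by case/andP: xx => *; apply/andP; split; lra.
by exists P => x xx; apply: dP; case/andP: xx => *; apply/andP; split; lra.
Qed.

Lemma vertical_primitive (f : R[i] -> R[i]) (x y1 y2 e : R) : 0 < e ->
  (forall y, y1 - e < y < y2 + e -> exists L, has_cderiv f (x +i* y) L) ->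
  exists P : R -> R, forall y, y1 <= y <= y2 -> is_derive y 1 P (complex.Im (f (x +i* y))).
Proof.
move=> e0 df.
have [|P dP] := @primitive_exists _ (fun t => complex.Im (f (x +i* t))) (y1 - e / 2) (y2 + e / 2).
  move=> y yy; have [|L dL] := df y; last exact: continuous_vertical dL.
  by case/andP: yy => *; apply/andP; split; lra.
by exists P => y yy; apply: dP; case/andP: yy => *; apply/andP; split; lra.
Qed.

(** Goursat: the real part of the contour integral of a complex differentiable
    function along the boundary of a rectangle vanishes.  Continuity of the
    derivative is not assumed, so Green's formula does not apply. *)
Lemma goursat_rectangle (f : R[i] -> R[i]) (x1 x2 y1 y2 e : R) (P1 P2 Q1 Q2 : R -> R) :
  0 < e -> x1 <= x2 -> y1 <= y2 ->
  (forall x y, x1 - e < x < x2 + e -> y1 - e < y < y2 + e ->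
     exists L, has_cderiv f (x +i* y) L) ->
  (forall x, x1 <= x <= x2 -> is_derive x 1 P1 (complex.Re (f (x +i* y1)))) ->
  (forall x, x1 <= x <= x2 -> is_derive x 1 P2 (complex.Re (f (x +i* y2)))) ->
  (forall y, y1 <= y <= y2 -> is_derive y 1 Q1 (complex.Im (f (x1 +i* y)))) ->
  (forall y, y1 <= y <= y2 -> is_derive y 1 Q2 (complex.Im (f (x2 +i* y)))) ->
  (P1 x2 - P1 x1) - (P2 x2 - P2 x1) - (Q2 y2 - Q2 y1) + (Q1 y2 - Q1 y1) = 0.
Proof.
move=> e0 xx yy df dP1 dP2 dQ1 dQ2.
have X : x1 + (x2 - x1) = x2 by rewrite addrC subrK.
have Y : y1 + (y2 - y1) = y2 by rewrite addrC subrK.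
pose U y := xget (fun=> 0) [set P : R -> R | forall x, x1 <= x <= x2 ->
  is_derive x 1 P (complex.Re (f (x +i* y)))].
pose W x := xget (fun=> 0) [set P : R -> R | forall y, y1 <= y <= y2 ->
  is_derive y 1 P (complex.Im (f (x +i* y)))].
have dU y : y1 <= y <= y2 -> forall x, x1 <= x <= x2 ->
    is_derive x 1 (U y) (complex.Re (f (x +i* y))).
  move=> yI; have [|P HP] := @horizontal_primitive f y x1 x2 e e0.
    by move=> x xI; apply: df => //; case/andP: yI => *; apply/andP; split; lra.
  by apply: (xgetPex (fun=> 0) (P := [set P : R -> R | forall x, x1 <= x <= x2 ->
    is_derive x 1 P (complex.Re (f (x +i* y)))])); exists P.
have dW x : x1 <= x <= x2 -> forall y, y1 <= y <= y2 ->
    is_derive y 1 (W x) (complex.Im (f (x +i* y))).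
  move=> xI; have [|P HP] := @vertical_primitive f x y1 y2 e e0.
    by move=> y yI; apply: df => //; case/andP: xI => *; apply/andP; split; lra.
  by apply: (xgetPex (fun=> 0) (P := [set P : R -> R | forall y, y1 <= y <= y2 ->
    is_derive y 1 P (complex.Im (f (x +i* y)))])); exists P.
have := @goursat_bisection _ f U W x1 y1 (x2 - x1) (y2 - y1).
rewrite X Y !subr_ge0 => /(_ xx yy) H.
have i1 : y1 <= y1 <= y2 by rewrite lexx.
have i2 : y1 <= y2 <= y2 by rewrite lexx yy.
have j1 : x1 <= x1 <= x2 by rewrite lexx.
have j2 : x1 <= x2 <= x2 by rewrite lexx xx.
rewrite (primitive_unique xx dP1 (dU _ i1)) (primitive_unique xx dP2 (dU _ i2)).
rewrite (primitive_unique yy dQ1 (dW _ j1)) (primitive_unique yy dQ2 (dW _ j2)).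
apply: H.
- by move=> x y xI yI; exact: dU.
- by move=> x y xI yI; exact: dW.
- by move=> x y /andP[? ?] /andP[? ?]; apply: df; apply/andP; split; lra.
Qed.

End goursat_rectangle.

(** * An integral estimate of the derivative *)

Section strip_estimate.
Variable R : realType.

Lemma has_cderivM (f g : R[i] -> R[i]) z a b : has_cderiv f z a -> has_cderiv g z b ->
  has_cderiv (fun w => f w * g w) z (f z * b + g z * a).
Proof.
move=> /has_cderiv_is_derive df /has_cderiv_is_derive dg.
by apply: is_derive_has_cderiv; exact: is_deriveM.
Qed.

Lemma has_cderivB (f g : R[i] -> R[i]) z a b : has_cderiv f z a -> has_cderiv g z b ->
  has_cderiv (fun w => f w - g w) z (a - b).
Proof.
move=> /has_cderiv_is_derive df /has_cderiv_is_derive dg.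
by apply: is_derive_has_cderiv; exact: is_deriveB.
Qed.

Lemma has_cderiv_cst (c : R[i]) z : has_cderiv (fun=> c) z 0.
Proof. by apply: is_derive_has_cderiv; exact: is_derive_cst. Qed.

Lemma has_cderiv_id (z : R[i]) : has_cderiv id z 1.
Proof. by apply: is_derive_has_cderiv; exact: is_derive_id. Qed.

Lemma has_cderivV (f : R[i] -> R[i]) z a : f z != 0 -> has_cderiv f z a ->
  has_cderiv (fun w => (f w)^-1) z (- (f z) ^- 2 * a).
Proof.
move=> fz /has_cderiv_is_derive df.
apply: is_derive_has_cderiv.
apply: DeriveDef; first by apply: derivableV => //; case: df.
have [dz ez] := df; rewrite deriveV //.
by rewrite ez.
Qed.

Lemma has_cderiv_reflect (f : R[i] -> R[i]) z a : has_cderiv f (1 - z) a ->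
  has_cderiv (fun w => f (1 - w)) z (- a).
Proof.
move=> H e e0; have [d d0 hd] := H e e0; exists d => // w wz.
have -> : f (1 - w) - f (1 - z) - - a * (w - z) =
  f (1 - w) - f (1 - z) - a * ((1 - w) - (1 - z)) by ring.
have E : normc (w - z) = normc ((1 - w) - (1 - z)).
  by rewrite normc_distC; congr normc; ring.
by rewrite E; apply: hd; rewrite -E.
Qed.

Local Notation half := ((2^-1 : R)%:C).

Lemma sqr_normc (z : R[i]) : normc z ^+ 2 = complex.Re z ^+ 2 + complex.Im z ^+ 2.
Proof. by case: z => a b /=; rewrite sqr_sqrtr // addr_ge0 ?sqr_ge0. Qed.

Lemma atan_primitive (K t : R) :
  is_derive t 1 (fun s => K * 4 * atan (4 * s)) (K / (1 / 16 + t ^+ 2)).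
Proof.
have d4 : is_derive t 1 (fun s : R => 4 * s) 4.
  by have := is_deriveZ 4 (is_derive_id t (1 : R)); rewrite /GRing.scale /= mulr1.
have dat : is_derive (4 * t) 1 (@atan R) ((1 + (4 * t) ^+ 2)^-1).
  apply: DeriveDef; first exact: derivable_atan.
  by rewrite -derive1E derive1_atan.
have dc : is_derive t 1 (fun s => atan (4 * s)) ((1 + (4 * t) ^+ 2)^-1 * 4).
  by have := is_derive1_comp dat d4.
have := is_deriveZ (K * 4) dc; rewrite /GRing.scale /=.
have -> // : K * 4 * ((1 + (4 * t) ^+ 2)^-1 * 4) = K / (1 / 16 + t ^+ 2).
have t2 := sqr_ge0 t.
have n1 : 1 + (4 * t) ^+ 2 != 0 by apply: lt0r_neq0; nra.
have n2 : 1 / 16 + t ^+ 2 != 0 by apply: lt0r_neq0; nra.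
have -> : 1 + (4 * t) ^+ 2 = 16 * (1 / 16 + t ^+ 2) by field.
by move: n2; set D := _ + _ => n2; field.
Qed.

Let in_wider (a b a' b' x : R) : a <= x <= b -> a' <= a -> b <= b' -> a' <= x <= b'.
Proof. by move=> /andP[ax xb] aa bb; rewrite (le_trans aa ax) (le_trans xb bb). Qed.

(** A rectangle minus a concentric square is the union of four rectangles that
    avoid the centre. *)
Lemma goursat_punctured (f : R[i] -> R[i]) (T del r : R)
  (Pt Pb Pr Ps Ql Qr Ri Ro : R -> R) :
  (forall x y, 0 < x < 1 -> x != 2^-1 \/ y != 0 -> exists L, has_cderiv f (x +i* y) L) ->
  0 < r <= 1 / 8 -> 0 < del <= 1 / 4 -> 1 <= T ->
  (forall x, del <= x <= 1 - del -> is_derive x 1 Pt (complex.Re (f (x +i* T)))) ->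
  (forall x, del <= x <= 1 - del -> is_derive x 1 Pb (complex.Re (f (x +i* - T)))) ->
  (forall x, del <= x <= 1 - del -> is_derive x 1 Pr (complex.Re (f (x +i* r)))) ->
  (forall x, del <= x <= 1 - del -> is_derive x 1 Ps (complex.Re (f (x +i* - r)))) ->
  (forall y, - T <= y <= T -> is_derive y 1 Ql (complex.Im (f (del +i* y)))) ->
  (forall y, - T <= y <= T -> is_derive y 1 Qr (complex.Im (f ((1 - del) +i* y)))) ->
  (forall y, - T <= y <= T -> is_derive y 1 Ri (complex.Im (f ((2^-1 - r) +i* y)))) ->
  (forall y, - T <= y <= T -> is_derive y 1 Ro (complex.Im (f ((2^-1 + r) +i* y)))) ->
  (Ps (2^-1 + r) - Pr (2^-1 + r) - Ro r + Ri r) -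
    (Ps (2^-1 - r) - Pr (2^-1 - r) - Ro (- r) + Ri (- r)) =
  (Pb (1 - del) - Pb del) - (Pt (1 - del) - Pt del) -
    (Qr T - Qr (- T)) + (Ql T - Ql (- T)).
Proof.
move=> df /andP[r0 r8] /andP[del0 del4] T1 dPt dPb dPr dPs dQl dQr dRi dRo.
have e0 : 0 < Num.min r del by rewrite lt_min r0.
have er : Num.min r del <= r by rewrite ge_min lexx.
have ed : Num.min r del <= del by rewrite ge_min lexx orbT.
set e := Num.min r del in e0 er ed.
have dd : del <= 1 - del by lra.
have dl : del <= 2^-1 - r by lra.
have dr : 2^-1 + r <= 1 - del by lra.
have lr : 2^-1 - r <= 1 - del by lra.
have rl : del <= 2^-1 + r by lra.
have rT : r <= T by lra.
have rN : - r <= r by lra.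
have TN : - T <= - r by lra.
have Tr : - T <= r by lra.
have NrT : - r <= T by lra.
suff [top bottom left right] : [/\
    (Pr (1 - del) - Pr del) - (Pt (1 - del) - Pt del) - (Qr T - Qr r) + (Ql T - Ql r) = 0,
    (Pb (1 - del) - Pb del) - (Ps (1 - del) - Ps del) - (Qr (- r) - Qr (- T)) + (Ql (- r) - Ql (- T)) = 0,
    (Ps (2^-1 - r) - Ps del) - (Pr (2^-1 - r) - Pr del) - (Ri r - Ri (- r)) + (Ql r - Ql (- r)) = 0 &
    (Ps (1 - del) - Ps (2^-1 + r)) - (Pr (1 - del) - Pr (2^-1 + r)) - (Qr r - Qr (- r)) + (Ro r - Ro (- r)) = 0].
  clear -top bottom left right; lra.
split.
- apply: (goursat_rectangle (f := f) e0 dd rT) => //.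
  + move=> x y /andP[x1 x2] /andP[y1 y2]; apply: df; last by right; apply: lt0r_neq0; lra.
    by clear -x1 x2 e0 ed; apply/andP; split; lra.
  + by move=> y yI; apply: dQl; apply: in_wider yI _ _.
  + by move=> y yI; apply: dQr; apply: in_wider yI _ _.
- apply: (goursat_rectangle (f := f) e0 dd TN) => //.
  + move=> x y /andP[x1 x2] /andP[y1 y2]; apply: df; last by right; apply: ltr0_neq0; lra.
    by clear -x1 x2 e0 ed; apply/andP; split; lra.
  + by move=> y yI; apply: dQl; apply: in_wider yI _ _.
  + by move=> y yI; apply: dQr; apply: in_wider yI _ _.
- apply: (goursat_rectangle (f := f) e0 dl rN) => //.
  + move=> x y /andP[x1 x2] _; apply: df; last by left; apply/negbT/lt_eqF; clear -x2 er; lra.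
    by clear -x1 x2 e0 ed er r0; apply/andP; split; lra.
  + by move=> x xI; apply: dPs; apply: in_wider xI _ _.
  + by move=> x xI; apply: dPr; apply: in_wider xI _ _.
  + by move=> y yI; apply: dQl; apply: in_wider yI _ _.
  + by move=> y yI; apply: dRi; apply: in_wider yI _ _.
- apply: (goursat_rectangle (f := f) e0 dr rN) => //.
  + move=> x y /andP[x1 x2] _; apply: df; last by left; apply/negbT/gt_eqF; clear -x1 er; lra.
    by clear -x1 x2 e0 ed er r0; apply/andP; split; lra.
  + by move=> x xI; apply: dPs; apply: in_wider xI _ _.
  + by move=> x xI; apply: dPr; apply: in_wider xI _ _.
  + by move=> y yI; apply: dRo; apply: in_wider yI _ _.
  + by move=> y yI; apply: dQr; apply: in_wider yI _ _.
Qed.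

Lemma vertical_side_bound (P p : R -> R) (K T : R) : 0 <= K -> 0 <= T ->
  (forall t, - T <= t <= T -> is_derive t 1 P (p t)) ->
  (forall t, - T <= t <= T -> `|p t| <= K / (1 / 16 + t ^+ 2)) ->
  `|P T - P (- T)| <= 16 * K.
Proof.
move=> K0 T0 dP pK.
have TT : - T <= T by lra.
have bd : K * 4 * atan (4 * T) - K * 4 * atan (4 * - T) <= 16 * K.
  rewrite mulrN atanN; have := atan_ltpi2 (4 * T); have := pihalf_lt2 R.
  by move=> *; nra.
have dN t : - T <= t <= T -> is_derive t 1 (- P) (- p t).
  by move=> tI; have dPt := dP _ tI; exact: is_deriveN.
have up : P T - P (- T) <= K * 4 * atan (4 * T) - K * 4 * atan (4 * - T).
  apply: (increment_le TT dP (fun t _ => atan_primitive K t)) => t tI.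
  by apply: le_trans (pK t tI); rewrite ler_norm.
have dn : (- P) T - (- P) (- T) <= K * 4 * atan (4 * T) - K * 4 * atan (4 * - T).
  apply: (increment_le TT dN (fun t _ => atan_primitive K t)) => t tI.
  by apply: le_trans (pK t tI); rewrite -normrN ler_norm.
rewrite ler_norml; move: dn; rewrite !fctE => dn; apply/andP; split; lra.
Qed.

Section kernel.
Variables (g : R[i] -> R[i]) (L lam : R[i]).
Hypothesis lam1 : normc lam = 1.
Hypothesis lamL : lam * L = - ('i * (normc L)%:C).
Hypothesis g0 : g half = 0.

Let f z := lam * (g z * ((z - half) * (z - half))^-1).

Lemma kernel_norm x y : normc (f (x +i* y)) = normc (g (x +i* y)) / ((x - 2^-1) ^+ 2 + y ^+ 2).
Proof.
rewrite /f normcM lam1 mul1r normcM normcV normcM -expr2 sqr_normc ReB ImB /=.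
by rewrite subr0.
Qed.

Lemma kernel_cderiv x y : (exists L', has_cderiv g (x +i* y) L') ->
  x != 2^-1 \/ y != 0 -> exists L', has_cderiv f (x +i* y) L'.
Proof.
move=> [L' dL'] xy.
have nz : (x +i* y) - half != 0.
  by case: xy => h; rewrite eq_complex /= negb_and subr_eq0 oppr0 addr0 h ?orbT.
have dB := has_cderivB (has_cderiv_id (x +i* y)) (has_cderiv_cst half _).
have dBB := has_cderivM dB dB.
have nz2 : ((x +i* y) - half) * ((x +i* y) - half) != 0 by rewrite mulf_neq0.
have dV := @has_cderivV (fun z => (z - half) * (z - half)) _ _ nz2 dBB.
by eexists; exact: (has_cderivM (has_cderiv_cst lam _) (has_cderivM dL' dV)).
Qed.

(** Near its pole the kernel is [- i |L| / (z - 1/2)] up to [eta / |z - 1/2|]. *)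
Lemma kernel_near (d eta r u v : R) : 0 < r -> 0 <= eta -> r *+ 2 < d ->
  (forall w, normc (w - half) < d ->
    normc (g w - g half - L * (w - half)) <= eta * normc (w - half)) ->
  r ^+ 2 <= u ^+ 2 + v ^+ 2 -> `|u| <= r -> `|v| <= r ->
  `|complex.Re (f ((2^-1 + u) +i* v)) + v * normc L / (u ^+ 2 + v ^+ 2)| <= eta / r /\
  `|complex.Im (f ((2^-1 + u) +i* v)) + u * normc L / (u ^+ 2 + v ^+ 2)| <= eta / r.
Proof.
move=> r0 eta0 rd hd ruv ur vr.
have N0 : 0 < u ^+ 2 + v ^+ 2 by apply: lt_le_trans ruv; rewrite exprn_gt0.
set z := (2^-1 + u) +i* v; set zeta : R[i] := u +i* v.
have zE : z - half = zeta by apply/eqP; rewrite eq_complex /= oppr0 addr0 addrAC subrr add0r !eqxx.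
have zeta0 : zeta != 0.
  rewrite eq_complex /= negb_and; apply: contraTT N0; rewrite negb_or !negbK => /andP[/eqP -> /eqP ->].
  by rewrite expr0n /= addr0 ltxx.
have rz : r <= normc zeta.
  have -> : r = Num.sqrt (r ^+ 2) by rewrite sqrtr_sqr ger0_norm ?ltW.
  exact: ler_wsqrtr.
have zd : normc (z - half) < d.
  rewrite zE; apply: le_lt_trans (normc_le_ReIm _) _; rewrite /=; lra.
have H := hd z zd; rewrite g0 subr0 zE in H.
set N := u ^+ 2 + v ^+ 2 in N0 *.
have fE : f z - (- (v * normc L / N) +i* - (u * normc L / N))
    = lam * (g z - L * zeta) / (zeta * zeta).
  have -> : (- (v * normc L / N) +i* - (u * normc L / N)) = lam * L / zeta.
    rewrite lamL; apply/eqP; rewrite eq_complex /zeta /= -/N; have N0' := lt0r_neq0 N0.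
    by apply/andP; split; apply/eqP; field.
  by rewrite /f zE; field.
have bnd : normc (f z - (- (v * normc L / N) +i* - (u * normc L / N))) <= eta / r.
  have nz0 : 0 < normc zeta by apply: lt_le_trans rz.
  rewrite fE !normcM lam1 mul1r normcV normcM.
  apply: le_trans (ler_wpM2r _ H) _; first by rewrite invr_ge0 mulr_ge0 ?normc_ge0.
  rewrite -mulrA ler_wpM2l // invfM mulrA divff ?lt0r_neq0 // mul1r.
  by rewrite lef_pV2.
split; apply: le_trans bnd.
  by apply: le_trans (Re_le_normc _); rewrite ReB /= opprK.
by apply: le_trans (Im_le_normc _); rewrite ImB /= opprK.
Qed.

Lemma kernel_pole_bound (s r l : R) : 0 < r -> 0 <= l -> `|s| <= r ->
  l / 2 / r <= r * l / (s ^+ 2 + r ^+ 2).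
Proof.
move=> r0 l0; rewrite ler_norml => /andP[s1 s2].
have s2r : s ^+ 2 <= r ^+ 2 by nra.
have D0 : 0 < s ^+ 2 + r ^+ 2 by rewrite ltr_wpDl ?sqr_ge0 // exprn_gt0.
rewrite ler_pdivlMr //.
have -> : l / 2 / r * (s ^+ 2 + r ^+ 2) = (l * (s ^+ 2 + r ^+ 2) / 2) / r by ring.
by rewrite ler_pdivrMr //; nra.
Qed.

Lemma kernel_inner (d eta r : R) (Pr Ps Ri Ro : R -> R) :
  0 < r -> 0 <= eta -> r *+ 2 < d ->
  (forall w, normc (w - half) < d ->
    normc (g w - g half - L * (w - half)) <= eta * normc (w - half)) ->
  (forall s, - r <= s <= r -> is_derive (2^-1 + s) 1 Pr (complex.Re (f ((2^-1 + s) +i* r)))) ->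
  (forall s, - r <= s <= r -> is_derive (2^-1 + s) 1 Ps (complex.Re (f ((2^-1 + s) +i* - r)))) ->
  (forall s, - r <= s <= r -> is_derive s 1 Ri (complex.Im (f ((2^-1 - r) +i* s)))) ->
  (forall s, - r <= s <= r -> is_derive s 1 Ro (complex.Im (f ((2^-1 + r) +i* s)))) ->
  4 * normc L - 8 * eta <=
    (Ps (2^-1 + r) - Pr (2^-1 + r) - Ro r + Ri r) -
    (Ps (2^-1 - r) - Pr (2^-1 - r) - Ro (- r) + Ri (- r)).
Proof.
move=> r0 eta0 rd hd dPr dPs dRi dRo.
have dsh (s : R) : is_derive s 1 (fun t : R => 2^-1 + t) 1.
  have := is_deriveD (is_derive_cst (2^-1 : R) s (1 : R)) (is_derive_id s (1 : R)).
  by rewrite add0r.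
have rr : - r <= r by lra.
have dS (s : R) : - r <= s <= r -> is_derive s 1
    (((Ps \o (fun t => 2^-1 + t)) - (Pr \o (fun t => 2^-1 + t)) - Ro) + Ri)
    (complex.Re (f ((2^-1 + s) +i* (- r))) - complex.Re (f ((2^-1 + s) +i* r))
     - complex.Im (f ((2^-1 + r) +i* s)) + complex.Im (f ((2^-1 - r) +i* s))).
  move=> sI.
  have d1 := is_derive1_comp (dPs _ sI) (dsh s); have d2 := is_derive1_comp (dPr _ sI) (dsh s).
  rewrite !mulr1 in d1 d2.
  have d3 := dRo _ sI; have d4 := dRi _ sI.
  exact: (is_deriveD (is_deriveB (is_deriveB d1 d2) d3) d4).
have dlin (c t : R) : is_derive t 1 (fun s : R => c * s) c.
  by have := is_deriveZ c (is_derive_id t (1 : R)); rewrite /GRing.scale /= mulr1.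
have := increment_le rr (fun s _ => dlin (2 * normc L / r - 4 * eta / r) s) dS.
rewrite !fctE /= => H; apply: le_trans (H _).
  by rewrite le_eqVlt; apply/orP; left; apply/eqP; field; exact: lt0r_neq0.
move=> s /andP[s1 s2]; clear H dS dlin dPr dPs dRi dRo.
have sr : `|s| <= r by rewrite ler_norml s1.
have rR : `|r| <= r by rewrite (gtr0_norm r0) lexx.
have rN : `|- r| <= r by rewrite normrN (gtr0_norm r0) lexx.
have s20 := sqr_ge0 s.
have q1 : r ^+ 2 <= s ^+ 2 + r ^+ 2 by rewrite lerDr.
have q2 : r ^+ 2 <= r ^+ 2 + s ^+ 2 by rewrite lerDl.
have q3 : r ^+ 2 <= s ^+ 2 + (- r) ^+ 2 by rewrite sqrrN lerDr.
have q4 : r ^+ 2 <= (- r) ^+ 2 + s ^+ 2 by rewrite sqrrN lerDl.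
have [b1 _] := kernel_near r0 eta0 rd hd q3 sr rN.
have [b2 _] := kernel_near r0 eta0 rd hd q1 sr rR.
have [_ b3] := kernel_near r0 eta0 rd hd q2 rR sr.
have [_ b4] := kernel_near r0 eta0 rd hd q4 rN sr.
move: b1 b2 b3 b4; rewrite !sqrrN !mulNr (addrC (r ^+ 2)).
have := kernel_pole_bound r0 (normc_ge0 L) sr.
set X := r * normc L / (s ^+ 2 + r ^+ 2) => X2.
have -> : 2 * normc L / r = 4 * (normc L / 2 / r) by field; exact: lt0r_neq0.
have -> : 4 * eta / r = 4 * (eta / r) by rewrite mulrA.
rewrite !ler_norml; clear -X2 => /andP[? ?] /andP[? ?] /andP[? ?] /andP[? ?]; lra.
Qed.

End kernel.

(** The two vertical sides contribute at most [16 K] each, because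
    [1 / |z - 1/2|^2] is integrable along vertical lines; the small square around
    [1/2] isolates the derivative there, because the integral of [1 / (z - 1/2)]
    around it is a nonzero imaginary number. *)
Lemma rectangle_estimate (g : R[i] -> R[i]) (L : R[i]) (B K T del : R) :
  (forall x y, 0 < x < 1 -> exists L', has_cderiv g (x +i* y) L') ->
  has_cderiv g half L -> g half = 0 ->
  (forall x y, 0 < x < 1 -> normc (g (x +i* y)) <= B) ->
  1 <= T -> 0 < del <= 1 / 4 ->
  (forall t, - T <= t <= T -> normc (g (del +i* t)) <= K /\ normc (g ((1 - del) +i* t)) <= K) ->
  4 * normc L <= 32 * K + 2 * B / T ^+ 2.
Proof.
move=> dg dL g0 gB T1 delI; have /andP[del0 del4] := delI => gK.
have T0 : 0 < T by lra.
have K0 : 0 <= K.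
  by have [] := gK 0 => [|h _]; [rewrite lerNl oppr0 ltW | exact: le_trans (normc_ge0 _) h].
have B0 : 0 <= B.
  by apply: le_trans (normc_ge0 _) (gB (1/2) 0 _); apply/andP; split; lra.
(* rotating [g] makes the relevant contour integral real *)
have [lam lam1 lamL] : exists2 lam : R[i], normc lam = 1 & lam * L = - ('i * (normc L)%:C).
  have [->|L0] := eqVneq L 0.
    by exists 1; rewrite ?normc1 // mul1r normc0 /= mulr0 oppr0.
  have nL0 : normc L != 0 by apply: contra L0 => /eqP /normc_eq0P ->.
  exists (- ('i * (normc L)%:C) / L); last by rewrite divfK.
  rewrite normcM normcN normcM normcV normc_real ger0_norm ?normc_ge0 //.
  by rewrite /= expr0n expr1n /= add0r sqrtr1 mul1r divff.
pose f z := lam * (g z * ((z - half) * (z - half))^-1).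
have df x y : 0 < x < 1 -> x != 2^-1 \/ y != 0 -> exists L', has_cderiv f (x +i* y) L'.
  by move=> xI; apply: kernel_cderiv; exact: dg.
have nf x y := kernel_norm g lam1 x y; rewrite -/f in nf.
apply/ler_addgt0Pr => eta eta0.
have [|d d0 hd] := dL (eta / 8); first by rewrite divr_gt0.
have e80 : 0 <= eta / 8 by rewrite ltW // divr_gt0.
have [r [r0 r8 rd]] : exists r : R, [/\ 0 < r, r <= 1 / 8 & r *+ 2 < d].
  exists (Num.min (1 / 8) (d / 4)); split.
  - by rewrite lt_min; apply/andP; split; lra.
  - by rewrite ge_min lexx.
  - have : Num.min (1 / 8) (d / 4) <= d / 4 by rewrite ge_min lexx orbT.
    by clear -d0; lra.
have hprim y : y != 0 -> exists P : R -> R, forall x, del <= x <= 1 - del ->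
    is_derive x 1 P (complex.Re (f (x +i* y))).
  move=> y0; apply: (@horizontal_primitive _ f y del (1 - del) del) => // x /andP[x1 x2].
  by apply: df; [clear -x1 x2; apply/andP; split; lra | right].
have vprim x : 0 < x < 1 -> x != 2^-1 -> exists P : R -> R, forall y, - T <= y <= T ->
    is_derive y 1 P (complex.Im (f (x +i* y))).
  by move=> xI x2; apply: (@vertical_primitive _ f x (- T) T 1) => // y _; apply: df => //; left.
have r0' : r != 0 by exact: lt0r_neq0.
have T0' : T != 0 by exact: lt0r_neq0.
have x1 : 0 < del < 1 /\ del != 2^-1.
  by split; [apply/andP; split; lra | apply/negbT/lt_eqF; lra].
have x2 : 0 < 1 - del < 1 /\ 1 - del != 2^-1.
  by split; [apply/andP; split; lra | apply/negbT/gt_eqF; lra].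
have x3 : 0 < 2^-1 - r < 1 /\ 2^-1 - r != 2^-1.
  by split; [apply/andP; split; lra | apply/negbT/lt_eqF; lra].
have x4 : 0 < 2^-1 + r < 1 /\ 2^-1 + r != 2^-1.
  by split; [apply/andP; split; lra | apply/negbT/gt_eqF; lra].
have i1 : del <= 2^-1 - r by lra.
have i2 : 2^-1 + r <= 1 - del by lra.
have i3 : - T <= - r by lra.
have i4 : r <= T by lra.
have i5 : del <= 1 - del by lra.
have i6 : 1 / 16 <= (del - 2^-1) ^+ 2 by nra.
have i7 : 1 / 16 <= (1 - del - 2^-1) ^+ 2 by nra.
have i8 : 1 - del - del <= 1 by lra.
have [Pt dPt] := hprim T T0'.
have [|Pb dPb] := hprim (- T); first by rewrite oppr_eq0.
have [Pr dPr] := hprim r r0'.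
have [|Ps dPs] := hprim (- r); first by rewrite oppr_eq0.
have [Ql dQl] := vprim del x1.1 x1.2.
have [Qr dQr] := vprim (1 - del) x2.1 x2.2.
have [Ri dRi] := vprim (2^-1 - r) x3.1 x3.2.
have [Ro dRo] := vprim (2^-1 + r) x4.1 x4.2.
have inner : 4 * normc L - 8 * (eta / 8) <=
    (Ps (2^-1 + r) - Pr (2^-1 + r) - Ro r + Ri r) -
    (Ps (2^-1 - r) - Pr (2^-1 - r) - Ro (- r) + Ri (- r)).
  apply: (kernel_inner lam1 lamL g0 r0 e80 rd hd).
  - move=> s /andP[s1 s2]; apply: dPr; apply/andP; split.
      by apply: le_trans i1 _; rewrite lerD2l.
    by apply: le_trans i2; rewrite lerD2l.
  - move=> s /andP[s1 s2]; apply: dPs; apply/andP; split.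
      by apply: le_trans i1 _; rewrite lerD2l.
    by apply: le_trans i2; rewrite lerD2l.
  - by move=> s sI; apply: dRi; apply: in_wider sI _ _.
  - by move=> s sI; apply: dRo; apply: in_wider sI _ _.
have rI : 0 < r <= 1 / 8 by rewrite r0.
rewrite (goursat_punctured df rI delI T1 dPt dPb dPr dPs dQl dQr dRi dRo) in inner.
have hbound y (P : R -> R) : y ^+ 2 = T ^+ 2 -> (forall x, del <= x <= 1 - del ->
    is_derive x 1 P (complex.Re (f (x +i* y)))) -> `|P (1 - del) - P del| <= B / T ^+ 2.
  move=> yT dP; apply: le_trans (increment_bound (M := B / T ^+ 2) i5 dP _) _.
  - move=> x /andP[xx1 xx2]; apply: le_trans (Re_le_normc _) _; rewrite nf yT.
    apply: ler_pM; [exact: normc_ge0 | by rewrite invr_ge0 addr_ge0 // sqr_ge0 | |].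
      by apply: gB; rewrite (lt_le_trans del0 xx1) (le_lt_trans xx2) // ltrBlDr ltrDl.
    rewrite lef_pV2 ?posrE ?exprn_gt0 // ?lerDr ?sqr_ge0 //.
    by rewrite ltr_wpDl ?sqr_ge0 // exprn_gt0.
  - by rewrite ler_piMr ?divr_ge0 ?sqr_ge0.
have vbound x (P : R -> R) : 1 / 16 <= (x - 2^-1) ^+ 2 ->
    (forall t, - T <= t <= T -> normc (g (x +i* t)) <= K) -> (forall y, - T <= y <= T ->
    is_derive y 1 P (complex.Im (f (x +i* y)))) -> `|P T - P (- T)| <= 16 * K.
  move=> x16 gx dP; apply: (vertical_side_bound K0 (ltW T0) dP) => t tI.
  apply: le_trans (Im_le_normc _) _; rewrite nf.
  have t2 := sqr_ge0 t.
  apply: ler_pM; [exact: normc_ge0 | by rewrite invr_ge0 addr_ge0 // sqr_ge0 | exact: gx |].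
  have p16 : 0 < 1 / 16 :> R by rewrite divr_gt0.
  by rewrite lef_pV2 ?posrE ?lerD2r // ltr_wpDr // (lt_le_trans p16).
have ht := hbound T Pt erefl dPt.
have hb : `|Pb (1 - del) - Pb del| <= B / T ^+ 2 by apply: hbound dPb; rewrite sqrrN.
have hl : `|Ql T - Ql (- T)| <= 16 * K by apply: vbound dQl => // t /gK[].
have hr : `|Qr T - Qr (- T)| <= 16 * K by apply: vbound dQr => // t /gK[].
move: ht hb hl hr inner; rewrite -mulrA !ler_norml; clear.
move=> /andP[? ?] /andP[? ?] /andP[? ?] /andP[? ?] ?; lra.
Qed.

End strip_estimate.

(** * Cauchy's estimate in the strip *)

Section strip_boundary.
Variable R : realType.

Local Notation half := ((2^-1 : R)%:C).

Lemma within_eps (A : set (R[i]^o)) (f : R[i]^o -> R[i]^o) z (e : R) :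
  {within A, continuous f} -> A z -> 0 < e ->
  exists2 d : R, 0 < d & forall w, A w -> normc (w - z) < d -> normc (f w - f z) <= e.
Proof.
move=> /subspace_continuousP cf Az e0.
have /cvgrPdist_le /(_ e%:C) := cf z Az; rewrite ltcR e0 => /(_ isT).
rewrite /within /= => /nbhs_ballP[d /= /ltc0_real[r r0 ->] hd].
exists r => // w Aw wz.
have := hd w; rewrite /ball /= /ball_ /= normC_normc ltcR normc_distC => /(_ wz Aw).
by rewrite normC_normc lecR normc_distC.
Qed.

(** Compactness of a segment of a boundary line turns the bound on that line
    into a bound, up to [1], on a parallel line inside the strip. *)
Lemma boundary_tube (h : R[i] -> R[i]) (M T : R) :
  {within @strip R, continuous (h : R[i]^o -> R[i]^o)} ->
  (forall t, normc (h (0 +i* t)) <= M /\ normc (h (1 +i* t)) <= M) ->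
  exists2 del, 0 < del <= 1 / 4 & forall t, - T <= t <= T ->
    normc (h (del +i* t)) <= M + 1 /\ normc (h ((1 - del) +i* t)) <= M + 1.
Proof.
move=> ch hM.
have /compact_near_coveringP cov := @segment_compact R (- T) T.
have key : \forall d \near 0^'+, `[- T, T] `<=` [set t | normc (h (d +i* t)) <= M + 1 /\
    normc (h ((1 - d) +i* t)) <= M + 1].
  apply: (cov _ _ (fun d t => normc (h (d +i* t)) <= M + 1 /\
    normc (h ((1 - d) +i* t)) <= M + 1)) => t _.
  have s0 : @strip R (0 +i* t) by rewrite /strip /= lexx ler01.
  have s1 : @strip R (1 +i* t) by rewrite /strip /= lexx ler01.
  have [d0 d00 hd0] := within_eps ch s0 ltr01.
  have [d1 d10 hd1] := within_eps ch s1 ltr01.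
  near=> t' d; rewrite /=.
  have dpos : 0 < d by near: d; exact: nbhs_right_gt.
  have dlt1 : d < 1 by near: d; exact: nbhs_right_lt.
  have dlt2 : d < d0 / 2 by near: d; apply: nbhs_right_lt; rewrite divr_gt0.
  have dlt3 : d < d1 / 2 by near: d; apply: nbhs_right_lt; rewrite divr_gt0.
  have t2 : `|t - t'| < d0 / 2 by near: t'; apply: cvgr_dist_lt => //; rewrite divr_gt0.
  have t3 : `|t - t'| < d1 / 2 by near: t'; apply: cvgr_dist_lt => //; rewrite divr_gt0.
  split.
    have -> : h (d +i* t') = h (0 +i* t) + (h (d +i* t') - h (0 +i* t)) by rewrite [RHS]addrC subrK.
    apply: le_trans (le_normcD _ _) _; apply: lerD; first by case: (hM t).
    apply: hd0; first by rewrite /strip /= !ltW.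
    apply: le_lt_trans (normc_le_ReIm _) _; rewrite ReB ImB /= subr0 distrC.
    by rewrite (gtr0_norm dpos); lra.
  have -> : h ((1 - d) +i* t') = h (1 +i* t) + (h ((1 - d) +i* t') - h (1 +i* t)) by rewrite [RHS]addrC subrK.
  apply: le_trans (le_normcD _ _) _; apply: lerD; first by case: (hM t).
  apply: hd1; first by rewrite /strip /=; apply/andP; split; lra.
  apply: le_lt_trans (normc_le_ReIm _) _; rewrite ReB ImB /= distrC.
  rewrite (distrC t') (_ : 1 - (1 - d) = d) ?(gtr0_norm dpos); last by ring.
  by clear -t3 dlt3; lra.
near (0 : R)^'+ => d.
exists d.
  apply/andP; split; first by near: d; exact: nbhs_right_gt.
  by near: d; apply: nbhs_right_le; rewrite divr_gt0.
move=> t tI; have : `[- T, T] `<=` [set t | normc (h (d +i* t)) <= M + 1 /\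
    normc (h ((1 - d) +i* t)) <= M + 1] by near: d; exact: key.
by apply; rewrite /= in_itv.
Unshelve. all: by end_near. Qed.

(** Cauchy's estimate for the strip, without the optimal constant.  The bound of
    [h] inside the strip matters only on the horizontal sides of the rectangle,
    and disappears when these are far away. *)
Lemma strip_derivative_bound (h : R[i] -> R[i]) (L : R[i]) (M : R) :
  (exists B : R, forall z, strip z -> normc (h z) <= B) ->
  {within @strip R, continuous (h : R[i]^o -> R[i]^o)} ->
  (forall z, open_strip z -> exists L', has_cderiv h z L') ->
  has_cderiv h half L ->
  (forall t, normc (h (0 +i* t)) <= M /\ normc (h (1 +i* t)) <= M) ->
  normc L <= 10 * (M + 1).
Proof.
move=> [B hB] ch dh dL hM.
have M0 : 0 <= M by apply: le_trans (normc_ge0 _) (hM 0).1.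
have B0 : 0 <= B.
  by apply: le_trans (normc_ge0 _) (hB (0 +i* 0) _); rewrite /strip /= lexx ler01.
pose T := 1 + 4 * B.
have T1 : 1 <= T by rewrite /T; lra.
have [del delI htube] := boundary_tube T ch hM.
(* antisymmetrization makes the value at the centre vanish and doubles the derivative *)
pose g z := h z - h (1 - z).
have refl (x y : R) : 1 - (x +i* y) = (1 - x) +i* (- y).
  by apply/eqP; rewrite eq_complex /= sub0r !eqxx.
have halfr : 1 - half = half by apply/eqP; rewrite eq_complex /= subr0 eqxx andbT; apply/eqP; field.
have dg (x y : R) : 0 < x < 1 -> exists L', has_cderiv g (x +i* y) L'.
  move=> /andP[x0 x1].
  have [L1 d1] := dh (x +i* y) (introT andP (conj x0 x1)).
  have [|L2 d2] := dh (1 - (x +i* y)); first by rewrite refl /open_strip /=; apply/andP; split; lra.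
  by eexists; exact: has_cderivB d1 (has_cderiv_reflect d2).
have dgL : has_cderiv g half (L - - L).
  by apply: has_cderivB => //; apply: has_cderiv_reflect; rewrite halfr.
have g0 : g half = 0 by rewrite /g halfr subrr.
have gB (x y : R) : 0 < x < 1 -> normc (g (x +i* y)) <= 2 * B.
  move=> /andP[x0 x1]; rewrite /g refl.
  apply: le_trans (le_normcD _ _) _; rewrite normcN mulr2n mulrDl mul1r; apply: lerD; apply: hB.
    by rewrite /strip /= !ltW.
  by rewrite /strip /=; apply/andP; split; lra.
have gK t : - T <= t <= T ->
    normc (g (del +i* t)) <= 2 * (M + 1) /\ normc (g ((1 - del) +i* t)) <= 2 * (M + 1).
  move=> tI; have tI' : - T <= - t <= T by rewrite lerN2 lerNl andbC; case/andP: tI => -> ->.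
  have [h1 h2] := htube _ tI; have [h3 h4] := htube _ tI'.
  rewrite /g !refl subKr; split; apply: le_trans (le_normcD _ _) _; rewrite normcN; lra.
have := rectangle_estimate dg dgL g0 gB T1 delI gK.
rewrite opprK.
have -> : normc (L + L) = 2 * normc L.
  by rewrite -mulr2n normcMn mulr_natl.
have T0 : 0 < T ^+ 2 by rewrite exprn_gt0 //; lra.
have : 2 * (2 * B) / T ^+ 2 <= 1.
  by rewrite ler_pdivrMr // mul1r /T; nra.
clear -M0; lra.
Qed.

End strip_boundary.

Section complex_exponential.
Variable R : realType.

Definition cexp (z : R[i]) : R[i] :=
  (expR (complex.Re z))%:C * (cos (complex.Im z) +i* sin (complex.Im z)).

Lemma cexp0 : cexp 0 = 1.
Proof.
by rewrite /cexp /= expR0 cos0 sin0; apply/eqP; rewrite eq_complex /= !mul1r !mul0r addr0 subr0 !eqxx.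
Qed.

Lemma cexpD z w : cexp (z + w) = cexp z * cexp w.
Proof.
case: z w => a b [c d]; rewrite /cexp /= expRD cosD sinD.
by apply/eqP; rewrite eq_complex /=; apply/andP; split; apply/eqP; ring.
Qed.

Lemma normc_cexp z : normc (cexp z) = expR (complex.Re z).
Proof.
rewrite /cexp normcM normc_real ger0_norm ?expR_ge0 //= cos2Dsin2 sqrtr1 mulr1 //.
Qed.

Lemma is_derive_eps (f : R -> R) (x d : R) : is_derive x 1 f d ->
  forall e : R, 0 < e -> exists2 r, 0 < r & forall t, `|t| < r ->
    `|f (x + t) - f x - d * t| <= e * `|t|.
Proof.
move=> [df dL] e e0.
have : h^-1 *: (f (h *: 1 + x) - f x) @[h --> 0^'] --> d by rewrite -dL; exact: df.
move/cvgrPdist_le => /(_ e e0).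
rewrite /dnbhs /within /= => /nbhs_ballP[r /= r0 hr].
exists r => // t tr.
have [->|t0] := eqVneq t 0; first by rewrite addr0 mulr0 subrr subr0 normr0 mulr0.
have := hr t; rewrite /ball /= sub0r normrN => /(_ tr t0).
rewrite /GRing.scale /= mulr1 (addrC t) => H.
have -> : f (x + t) - f x - d * t = - (d - t^-1 * (f (x + t) - f x)) * t by field.
by rewrite normrM normrN ler_wpM2r.
Qed.

Lemma has_cderiv_cexp0 : has_cderiv cexp 0 1.
Proof.
move=> e e0; have [n [n0 n1 ne]] : exists n : R, [/\ 0 < n, n <= 1 & n <= e / 8].
  exists (Num.min (e / 8) 1); split; first by rewrite lt_min divr_gt0 //= ltr01.
    by rewrite ge_min lexx orbT.
  by rewrite ge_min lexx.
have [r1 r10 h1] := is_derive_eps (is_derive_expR 0) n0.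
have [r2 r20 h2] := is_derive_eps (is_derive_cos 0) n0.
have [r3 r30 h3] := is_derive_eps (is_derive_sin 0) n0.
pose r := Num.min (Num.min r1 r2) (Num.min r3 (Num.min 1 n)).
have r0 : 0 < r by rewrite !lt_min r10 r20 r30 n0 ltr01.
exists r => // w; rewrite subr0 cexp0 mul1r => wr.
move: wr; case: w => x y wr.
have xr := le_lt_trans (Re_le_normc (x +i* y)) wr.
have yr := le_lt_trans (Im_le_normc (x +i* y)) wr.
rewrite /= in xr yr.
have [x1 x2 x3 x4] : [/\ `|x| < r1, `|x| < r3, `|x| < 1 & `|x| < n].
  by move: xr; rewrite !lt_min => /andP[/andP[-> _] /and3P[-> -> ->]].
have [y1 y2 y3 y4] : [/\ `|y| < r2, `|y| < r3, `|y| < 1 & `|y| < n].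
  by move: yr; rewrite !lt_min => /andP[/andP[_ ->] /and3P[-> -> ->]].
have := h1 _ x1; have := h2 _ y1; have := h3 _ y2.
rewrite !add0r expR0 cos0 sin0 ?oppr0 ?mul0r ?mul1r !subr0.
move=> s1 c1 e1; rewrite addr0 in s1.
apply: le_trans (normc_le_ReIm _) _.
have nx := Re_le_normc (x +i* y); have ny := Im_le_normc (x +i* y).
rewrite [complex.Re (x +i* y)]/= [complex.Im (x +i* y)]/= in nx ny.
set N := normc _ in nx ny *.
have cy : `|cos y| <= 1 by rewrite ler_norml cos_geN1 cos_le1.
have sy : `|sin y| <= 1 by rewrite ler_norml sin_geN1 sin_le1.
have y00 := normr_ge0 y; have x00 := normr_ge0 x.
have t1 : `|(expR x - 1 - x) * cos y| <= n * `|x|.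
  by rewrite normrM; apply: le_trans (ler_pM _ _ e1 cy) _; rewrite ?mulr1.
have t2 : `|(1 + x) * (cos y - 1)| <= n * `|y| *+ 2.
  rewrite normrM mulr2n -[in leRHS]mulr2n -mulr_natl; apply: ler_pM => //.
  by apply: le_trans (ler_normD _ _) _; rewrite normr1; lra.
have t3 : `|(expR x - 1 - x) * sin y| <= n * `|x|.
  by rewrite normrM; apply: le_trans (ler_pM _ _ e1 sy) _; rewrite ?mulr1.
have sy' : `|sin y| <= 2 * `|y|.
  have -> : sin y = (sin y - y) + y by rewrite subrK.
  by apply: le_trans (ler_normD _ _) _; nra.
have t4 : `|x * sin y| <= n * `|y| *+ 2.
  by rewrite normrM -mulrnAr -mulr_natl; apply: ler_pM => //; exact: ltW.
have -> : complex.Re (cexp (x +i* y) - 1 - (x +i* y)) =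
    (expR x - 1 - x) * cos y + (1 + x) * (cos y - 1).
  by rewrite /cexp /=; ring.
have -> : complex.Im (cexp (x +i* y) - 1 - (x +i* y)) =
    (expR x - 1 - x) * sin y + x * sin y + (sin y - y).
  by rewrite /cexp /=; ring.
have N0 : 0 <= N by exact: normc_ge0.
have nN : n * N <= e / 8 * N by rewrite ler_wpM2r.
have nxN : n * `|x| <= n * N by rewrite ler_wpM2l // ltW.
have nyN : n * `|y| <= n * N by rewrite ler_wpM2l // ltW.
have q1 := ler_normD ((expR x - 1 - x) * cos y) ((1 + x) * (cos y - 1)).
have q2 := ler_normD ((expR x - 1 - x) * sin y + x * sin y) (sin y - y).
have q3 := ler_normD ((expR x - 1 - x) * sin y) (x * sin y).
apply: le_trans (lerD (le_trans q1 (lerD t1 t2))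
  (le_trans q2 (lerD (le_trans q3 (lerD t3 t4)) s1))) _.
have eN : 0 <= e * N by rewrite mulr_ge0 // ltW.
clear -nN nxN nyN eN; lra.
Qed.

Lemma has_cderiv_cexp (c a z : R[i]) :
  has_cderiv (fun w => cexp (c * (w - a))) z (c * cexp (c * (z - a))).
Proof.
move=> e e0; pose E := cexp (c * (z - a)); pose K := normc c * normc E + 1.
have nc := normc_ge0 c; have nE := normc_ge0 E.
have K0 : 0 < K by rewrite ltr_wpDl // mulr_ge0.
have [d d0 hd] := has_cderiv_cexp0 (divr_gt0 e0 K0).
have C0 : 0 < normc c + 1 by rewrite ltr_wpDl.
exists (d / (normc c + 1)); first exact: divr_gt0.
move=> w; rewrite ltr_pdivlMr // => wd.
have nw := normc_ge0 (w - z).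
have := hd (c * (w - z)); rewrite subr0 normcM cexp0 mul1r.
have cwd : normc c * normc (w - z) < d.
  by apply: le_lt_trans wd; rewrite mulrDr mulr1 mulrC lerDl.
move=> /(_ cwd) H.
have -> : c * (w - a) = c * (z - a) + c * (w - z) by ring.
rewrite cexpD -/E.
have -> : E * cexp (c * (w - z)) - E - c * E * (w - z) =
    E * (cexp (c * (w - z)) - 1 - c * (w - z)) by ring.
rewrite normcM; apply: le_trans (ler_wpM2l nE H) _.
have -> : normc E * (e / K * (normc c * normc (w - z))) =
    e * normc (w - z) * ((normc c * normc E) / K) by ring.
apply: ler_piMr; first by rewrite mulr_ge0 // ltW.
by rewrite ler_pdivrMr // mul1r /K lerDl.
Qed.

End complex_exponential.

(** * The Tsirelson space contains no copy of l_1 *)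

Lemma omegaDE (R : realType) (x y : omega R) n : (x + y) n = x n + y n.
Proof. by []. Qed.

Section tsirelson_basics.
Variables (R : realType) (N : omega R -> R).
Hypothesis hN : is_tsirelson_norm N.
Implicit Types (x y : omega R) (v : nat -> R).

Lemma coord_le_tsirelson x n : c00 x -> normc (x n) <= N x.
Proof.
move=> cx; rewrite -lee_fin (tsirelsonE hN cx) le_max; apply/orP; left.
by apply: ereal_sup_ubound; exists n.
Qed.

Lemma tsirelson_ge0 x : c00 x -> 0 <= N x.
Proof. by move=> cx; apply: le_trans (coord_le_tsirelson 0 cx); exact: normc_ge0. Qed.

Lemma tsirelson_admissible x k (E : 'I_k -> {fset nat}) : c00 x -> admissible E ->
  \sum_(j < k) N (restr (E j) x) <= 2 * N x.
Proof.
move=> cx aE; rewrite -ler_pdivrMl // -lee_fin (tsirelsonE hN cx) le_max.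
apply/orP; right; rewrite EFinM; apply: lee_wpmul2l; first by rewrite lee_fin invr_ge0.
by apply: ereal_sup_ubound; exists k, E.
Qed.

Lemma tsirelson_le x c : c00 x -> (forall n, normc (x n) <= c) ->
  (forall k (E : 'I_k -> {fset nat}), admissible E ->
     \sum_(j < k) N (restr (E j) x) <= 2 * c) -> N x <= c.
Proof.
move=> cx xc Ec; rewrite -lee_fin (tsirelsonE hN cx) ge_max; apply/andP; split.
  by apply: ge_ereal_sup => _ [n _ <-]; rewrite lee_fin.
rewrite lee_pdivrMl //.
by apply: ge_ereal_sup => _ [k [E [aE ->]]]; rewrite -EFinM lee_fin Ec.
Qed.

Lemma c00_restr (E : {fset nat}) x : c00 x -> c00 (restr E x).
Proof. by move=> [n xn]; exists n => m nm; rewrite /restr xn //; case: ifP. Qed.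

Lemma restr_restr (E F : {fset nat}) x : restr E (restr F x) = restr (E `&` F)%fset x.
Proof. by apply/funext => n; rewrite /restr in_fsetI; case: (n \in E). Qed.

Lemma tsirelson_restr (E : {fset nat}) x : c00 x -> N (restr E x) <= N x.
Proof.
move=> cx; apply: tsirelson_le; first exact: c00_restr.
  move=> n; rewrite /restr; case: ifP => _; first exact: coord_le_tsirelson.
  by rewrite normc0 tsirelson_ge0.
move=> k F [Fk Flt]; under eq_bigr => j _ do rewrite restr_restr.
apply: tsirelson_admissible => //; split.
  by move=> i n; rewrite in_fsetI => /andP[nF _]; exact: Fk nF.
move=> i j ij m n; rewrite !in_fsetI => /andP[mF _] /andP[nF _].
exact: Flt ij _ _ mF nF.
Qed.

Lemma c000 : c00 (0 : omega R).
Proof. by exists 0%N. Qed.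

Lemma tsirelson0 : N 0 = 0.
Proof.
by have := tsirelsonZ hN 0 c000; rewrite scale0r normc0 mul0r.
Qed.

Lemma c00_unit_vector j : c00 (unit_vector R j).
Proof. by exists j.+1 => m jm; rewrite /unit_vector gtn_eqF. Qed.

Lemma tsirelson_unit_vector j : N (unit_vector R j) <= 1.
Proof.
set v := N _; have v0 : 0 <= v by apply: tsirelson_ge0; exact: c00_unit_vector.
have restrE (E : {fset nat}) : restr E (unit_vector R j) = if j \in E then unit_vector R j else 0.
  apply/funext => n; rewrite /restr /unit_vector; have [->|nj] := eqVneq n j.
    by case: (j \in E) => //; rewrite eqxx.
  by case: (j \in E); case: (n \in E) => //; rewrite (negbTE nj).
have H : v <= Num.max 1 (v / 2).
  apply: tsirelson_le; first exact: c00_unit_vector.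
    move=> n; rewrite le_max; apply/orP; left; rewrite /unit_vector.
    by case: (n == j); rewrite ?normc1 ?normc0.
  move=> k E [_ Elt].
  apply: (@le_trans _ _ v); last first.
    have : v / 2 <= Num.max 1 (v / 2) by rewrite le_max lexx orbT.
    lra.
  have [[i ji]|no] := pselect (exists i, j \in E i).
    rewrite (bigD1 i) //= big1 ?addr0; first by rewrite restrE ji.
    move=> l li; rewrite restrE; case: ifP => [jl|_]; last exact: tsirelson0.
    case: (ltngtP l i) => h.
    - by have := Elt _ _ h _ _ jl ji; rewrite ltnn.
    - by have := Elt _ _ h _ _ ji jl; rewrite ltnn.
    - by move/eqP: li; case; exact: val_inj.
  rewrite big1 // => l _; rewrite restrE; case: ifP => [jl|_]; last exact: tsirelson0.
  by exfalso; apply: no; exists l.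
by move: H; rewrite le_max => /orP[//|]; lra.
Qed.

End tsirelson_basics.

Definition emb (R : realType) (v : nat -> R) : omega R := fun n => (v n)%:C.

Section averages.
Variables (R : realType) (N : omega R -> R).
Hypothesis hN : is_tsirelson_norm N.
Implicit Types (v w : nat -> R).

(** Convex combinations of the unit vectors with indices in [[lo, hi[]. *)
Record block v (lo hi : nat) : Prop := Block {
  block_ge0 : forall n, 0 <= v n;
  block_low : forall n, (n < lo)%N -> v n = 0;
  block_high : forall n, (hi <= n)%N -> v n = 0;
  block_sum : \sum_(n < hi) v n = 1
}.

Lemma c00_emb v hi : (forall n, (hi <= n)%N -> v n = 0) -> c00 (emb v).
Proof. by move=> vh; exists hi => m hm; rewrite /emb vh. Qed.

Lemma embZ c v : emb (fun n => c * v n) = c%:C *: emb v.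
Proof. by apply/funext => n; rewrite /emb /GRing.scale /= rmorphM. Qed.

Lemma emb_sum r (f : nat -> nat -> R) :
  emb (fun n => \sum_(i < r) f i n) = \sum_(i < r) emb (f i).
Proof.
apply/funext => n; rewrite /emb fct_sumE rmorph_sum //.
Qed.

Lemma tsirelson_emb_sum r (f : nat -> nat -> R) : (forall i, (i < r)%N -> c00 (emb (f i))) ->
  c00 (emb (fun n => \sum_(i < r) f i n)) /\
  N (emb (fun n => \sum_(i < r) f i n)) <= \sum_(i < r) N (emb (f i)).
Proof.
rewrite emb_sum; elim: r => [|r IH] cf.
  by rewrite !big_ord0 (tsirelson0 hN); split => //; exact: c000.
rewrite !big_ord_recr /=.
have [|[m h1] h2] := IH; first by move=> i ir; apply: cf; rewrite ltnS ltnW.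
have [m' h3] := cf r (ltnSn r).
split.
  exists (maxn m m') => l; rewrite geq_max => /andP[ml ml'].
  by rewrite omegaDE h1 // h3 // addr0.
apply: le_trans (tsirelsonD hN _ _) _; [by exists m | by exists m' |].
by rewrite lerD2r.
Qed.

Lemma block_wider v lo hi hi' : (hi <= hi')%N -> block v lo hi -> \sum_(n < hi') v n = 1.
Proof.
move=> hh [v0 vl vh <-]; rewrite -(subnKC hh) big_split_ord /=.
by rewrite [X in _ + X]big1 ?addr0 // => i _; rewrite vh // leq_addr.
Qed.

Lemma block_unit j : block (fun n => (n == j)%:R : R) j j.+1.
Proof.
split=> [n|n nj|n jn|].
- by case: eqP.
- by rewrite ltn_eqF.
- by rewrite gtn_eqF.
- rewrite big_ord_recr /= eqxx big1 ?add0r // => i _.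
  by rewrite ltn_eqF //; case: i.
Qed.

Lemma block_nonempty v lo hi : block v lo hi -> (lo < hi)%N.
Proof.
move=> [v0 vl vh s1]; rewrite ltnNge; apply/negP => hl.
move: s1; rewrite big1 => [/eqP|i _]; first by rewrite eq_sym oner_eq0.
by apply: vl; apply: leq_trans hl; case: i.
Qed.

(** The sets [E i] and the supports of the [f j] both come in increasing order,
    so the pairs [(i, j)] that meet form a chain of the product order, and [i + j]
    determines such a pair. *)
Lemma incidence_count k r (E : 'I_k -> {fset nat}) (lo : nat -> nat) (f : nat -> nat -> R) :
  admissible E -> (forall j, block (f j) (lo j) (lo j.+1)) ->
  (#|finset (fun p : 'I_k * 'I_r => `[< exists2 n : nat, n \in E p.1 & f p.2 n != 0%R >])| <= k + r)%N.
Proof.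
move=> [_ Elt] bf.
have lomono : {homo lo : i j / (i <= j)%N}.
  apply: homo_leq => [//|x y z|i]; first exact: leq_trans.
  exact: ltnW (block_nonempty (bf i)).
set P := finset _.
pose s (p : 'I_k * 'I_r) : 'I_(k + r).+1 := inord (p.1 + p.2).
have sE p : s p = (p.1 + p.2)%N :> nat.
  by rewrite /s inordK // ltnS; apply: leq_add; apply: ltnW.
have chain (p q : 'I_k * 'I_r) : p \in P -> q \in P -> (p.1 < q.1)%N -> (q.2 < p.2)%N -> False.
  rewrite !finset.in_set => /asboolP[n nE fn] /asboolP[m mE fm] pq qp.
  have nm := Elt _ _ pq _ _ nE mE.
  have hm : (m < lo q.2.+1)%N.
    by rewrite ltnNge; apply: contra fm => h; rewrite (block_high (bf _) h).
  have hn : (lo p.2 <= n)%N.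
    by rewrite leqNgt; apply: contra fn => h; rewrite (block_low (bf _) h).
  have := lomono _ _ qp; move=> h; have := leq_trans (leq_trans hm h) hn.
  by rewrite ltnNge (ltnW nm).
have inj : {in P &, injective s}.
  move=> p q pP qP /(congr1 val); rewrite /= !sE => e.
  case: (ltngtP p.1 q.1) => h.
  - by exfalso; apply: (chain p q) => //; rewrite -(ltn_add2l q.1) -e ltn_add2r.
  - by exfalso; apply: (chain q p) => //; rewrite -(ltn_add2l p.1) e ltn_add2r.
  - move: e; rewrite h => /addnI e; case: p q h e {pP qP} => [p1 p2] [q1 q2] /= h e.
    by congr pair; exact: val_inj.
rewrite -(card_in_imset inj).
have sub : s @: P \subset finset (fun i : 'I_(k + r).+1 => (i < k + r)%N).
  apply/fintype.subsetP => _ /imsetP[p pP ->]; rewrite finset.in_set sE.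
  by apply: (@leq_ltn_trans (p.1 + r)%N); [rewrite leq_add2l ltnW | rewrite ltn_add2r].
apply: leq_trans (subset_leq_card sub) _.
have -> : finset (fun i : 'I_(k + r).+1 => (i < k + r)%N) = (~: [set ord_max])%SET.
  apply/setP => i; rewrite !inE -val_eqE /= ltn_neqAle.
  by have := ltn_ord i; rewrite ltnS => ->; rewrite andbT.
by rewrite cardsC1 card_ord.
Qed.

Lemma restr_emb (E : {fset nat}) v : restr E (emb v) = emb (fun n => if n \in E then v n else 0).
Proof. by apply/funext => n; rewrite /restr /emb; case: ifP. Qed.

Section averaging.
Variables (D : R) (lo0 K : nat) (v0 : nat -> R) (lo : nat -> nat) (f : nat -> nat -> R) (r : nat).
Hypotheses (D0 : 0 < D) (r0 : (0 < r)%N) (Kr : (10 * K <= r)%N).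
Hypotheses (b0 : block v0 lo0 K) (bf : forall j, block (f j) (lo j) (lo j.+1)).
Hypothesis (loK : lo 0 = K).
Hypothesis (v0D : N (emb v0) <= D) (fD : forall j, N (emb (f j)) <= D).

Let w n : R := \sum_(i < r) r%:R^-1 * f i n.
Let x n : R := v0 n + w n.

Let lomono : {homo lo : i j / (i <= j)%N}.
Proof.
apply: homo_leq => [//|a b c|i]; first exact: leq_trans.
exact: ltnW (block_nonempty (bf i)).
Qed.

Let rpos : 0 < r%:R :> R.
Proof. by rewrite ltr0n. Qed.

Let c00f i : c00 (emb (f i)).
Proof. exact: c00_emb (block_high (bf i)). Qed.

Let c00Zf i : c00 (emb (fun n => r%:R^-1 * f i n)).
Proof. by apply: (@c00_emb _ (lo i.+1)) => n h; rewrite (block_high (bf i)) // mulr0. Qed.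

Lemma average_le : c00 (emb w) /\ N (emb w) <= D.
Proof.
have [//|cw Nw] := @tsirelson_emb_sum r (fun i n => r%:R^-1 * f i n).
split=> //; apply: le_trans Nw _.
apply: le_trans (_ : \sum_(i < r) r%:R^-1 * D <= _).
  apply: ler_sum => i _; rewrite embZ (tsirelsonZ hN) // normc_real.
  by rewrite ger0_norm ?invr_ge0 // ler_pM2l ?invr_gt0.
by rewrite sumr_const card_ord -mulrnAl -[X in X * D]mulr_natr mulVf ?mul1r // lt0r_neq0.
Qed.

Let wlow n : (n < K)%N -> w n = 0.
Proof.
move=> nK; rewrite /w big1 // => i _; rewrite (block_low (bf i)) ?mulr0 //.
by apply: leq_trans nK _; rewrite -loK lomono.
Qed.

Lemma average_block : block w K (lo r).
Proof.
split.
- by move=> n; apply: sumr_ge0 => i _; rewrite mulr_ge0 ?invr_ge0 // (block_ge0 (bf i)).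
- exact: wlow.
- move=> n rn; rewrite /w big1 // => i _; rewrite (block_high (bf i)) ?mulr0 //.
  by apply: leq_trans rn; exact: lomono.
- rewrite exchange_big /=; under eq_bigr => i _.
    rewrite -mulr_sumr (block_wider (lomono (ltn_ord i)) (bf i)) mulr1; over.
  by rewrite /= sumr_const card_ord -[LHS]mulr_natr mulVf // lt0r_neq0.
Qed.

Lemma half_sum_block : block (fun n => 2^-1 * x n) lo0 (lo r).
Proof.
have bw := average_block.
have Kl : (K <= lo r)%N by rewrite -loK lomono.
split.
- by move=> n; rewrite mulr_ge0 // addr_ge0 ?(block_ge0 b0) ?(block_ge0 bw).
- move=> n nl; rewrite /x (block_low b0) // (block_low bw) ?addr0 ?mulr0 //.
  exact: leq_trans nl (ltnW (block_nonempty b0)).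
- move=> n ln; rewrite /x (block_high bw) // (block_high b0) ?addr0 ?mulr0 //.
  exact: leq_trans Kl ln.
- rewrite -mulr_sumr big_split /= (block_sum bw) (block_wider Kl b0).
  by rewrite -mulr2n mulVf.
Qed.

Let c00v0 : c00 (emb v0).
Proof. exact: c00_emb (block_high b0). Qed.

Let xE : emb x = emb v0 + emb w.
Proof. by apply/funext => n; rewrite /emb /x rmorphD. Qed.

Let restrxE E : restr E (emb x) = restr E (emb v0) + restr E (emb w).
Proof.
apply/funext => n; rewrite xE omegaDE /restr omegaDE.
by case: ifP => // _; rewrite addr0.
Qed.

(** The sets [E j] number at most [K] or start beyond the support of [v0].  In the
    second case only the average counts.  In the first, [v0] contributes at most
    [2 D], and the average [11 D / 10]: there are at most [k + r <= 11 r / 10]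
    incidences, each worth [D / r].  The trivial bound would be [2 D]. *)
Lemma sum_norm_le : N (emb x) <= D * (31 / 20).
Proof.
have [cw wD] := average_le.
have cx : c00 (emb x).
  by apply: (@c00_emb _ (lo r)) => n h; have := block_high half_sum_block h; lra.
have D1 : D <= D * (31 / 20) by rewrite ler_peMr ?ltW //; lra.
apply: (tsirelson_le hN) => // [n|k E aE].
  apply: le_trans D1; rewrite xE omegaDE.
  have [nK|Kn] := ltnP n K.
    rewrite (_ : emb w n = 0) ?addr0; last by rewrite /emb wlow.
    exact: le_trans (coord_le_tsirelson hN n c00v0) v0D.
  rewrite (_ : emb v0 n = 0) ?add0r; last by rewrite /emb (block_high b0).
  exact: le_trans (coord_le_tsirelson hN n cw) wD.
have [kK|Kk] := leqP k K; last first.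
  apply: (@le_trans _ _ (\sum_(j < k) N (restr (E j) (emb w)))).
    apply: ler_sum => j _; rewrite restrxE.
    rewrite (_ : restr (E j) (emb v0) = 0) ?add0r //.
    apply/funext => n; rewrite /restr; case: ifP => // nE.
    rewrite /emb (block_high b0) //; have := aE.1 j n nE.
    by move=> h; rewrite -ltnS; exact: leq_trans Kk h.
  apply: le_trans (tsirelson_admissible hN cw aE) _.
  by rewrite ler_pM2l //; exact: le_trans wD D1.
apply: (@le_trans _ _ (\sum_(j < k) (N (restr (E j) (emb v0)) + N (restr (E j) (emb w))))).
  apply: ler_sum => j _; rewrite restrxE.
  by apply: (tsirelsonD hN); exact: c00_restr.
rewrite big_split /=.
pose P := finset (fun p : 'I_k * 'I_r => `[< exists2 n : nat, n \in E p.1 & f p.2 n != 0 >]).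
have inc : \sum_(j < k) N (restr (E j) (emb w)) <= r%:R^-1 * (D *+ #|P|).
  apply: (@le_trans _ _ (\sum_(j < k) \sum_(i < r) r%:R^-1 * N (restr (E j) (emb (f i))))).
    apply: ler_sum => j _.
    have e : restr (E j) (emb w) =
        emb (fun n => \sum_(i < r) r%:R^-1 * (if n \in E j then f i n else 0)).
      rewrite restr_emb; congr emb; apply/funext => n; case: ifP => // _.
      by rewrite big1 // => i _; rewrite mulr0.
    have c00i i : c00 (emb (fun n => r%:R^-1 * (if n \in E j then f i n else 0))).
      apply: (@c00_emb _ (lo i.+1)) => n h; rewrite (block_high (bf i)) //.
      by case: ifP; rewrite mulr0.
    rewrite e.
    have [//|_ h] := @tsirelson_emb_sum r (fun i n => r%:R^-1 * (if n \in E j then f i n else 0)).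
    apply: le_trans h _; apply: ler_sum => i _; rewrite embZ -restr_emb.
    by rewrite (tsirelsonZ hN) ?normc_real ?ger0_norm ?invr_ge0 //; exact: c00_restr.
  rewrite pair_big /= (bigID [in P]) /= [X in _ + X]big1 ?addr0; last first.
    move=> [j i] /=; rewrite inE /= => /asboolP no.
    rewrite (_ : restr _ _ = 0) ?(tsirelson0 hN) ?mulr0 //.
    apply/funext => n; rewrite /restr; case: ifP => // nE; rewrite /emb.
    have [->//|fn] := eqVneq (f i n) 0.
    by exfalso; apply: no; exists n.
  rewrite -sumr_const mulr_sumr.
  apply: ler_sum => -[j i] _ /=; rewrite ler_pM2l ?invr_gt0 //.
  exact: le_trans (tsirelson_restr hN _ (c00f i)) (fD i).
have cardP : (#|P| <= k + r)%N by exact: incidence_count.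
have h2 : r%:R^-1 * (D *+ #|P|) <= D * (11 / 10).
  rewrite -[D *+ _]mulr_natr mulrCA ler_pM2l // mulrC ler_pdivrMr //.
  have h : (10 * #|P| <= 11 * r)%N.
    apply: leq_trans (leq_mul (leqnn 10) cardP) _.
    by rewrite mulnDr mulSn leq_add2r; exact: leq_trans (leq_mul (leqnn 10) kK) Kr.
  by move: h; rewrite -(ler_nat R) !natrM; lra.
have h3 : \sum_(j < k) N (restr (E j) (emb v0)) <= 2 * D.
  by apply: le_trans (tsirelson_admissible hN c00v0 aE) _; rewrite ler_pM2l.
by apply: le_trans (lerD h3 (le_trans inc h2)) _; lra.
Qed.

End averaging.

(** Figiel and Johnson's argument.  Let [D] be the best constant for which the norm
    of the blocks that start far enough is at least [D].  Half the sum of a block and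
    an average of many later ones, all of norm close to [D], is again a block, and
    its norm is at most about [31 D / 40], which is impossible if [D > 0]. *)
Lemma small_average (e : R) : 0 < e -> exists v hi, block v 0 hi /\ N (emb v) <= e.
Proof.
move=> e0; apply: contrapT => no.
have big v lo hi : block v lo hi -> e <= N (emb v).
  move=> b; rewrite leNgt; apply/negP => h; apply: no; exists v, hi; split; last exact: ltW.
  by case: b => *; split.
pose T := [set c : R | exists lo, forall v hi, block v lo hi -> c <= N (emb v)].
have Te : T e by exists 0%N => v hi; exact: big.
have T1 c : T c -> c <= 1.
  move=> [lo h]; apply: le_trans (h _ _ (block_unit lo)) _.
  have -> : emb (fun n => (n == lo)%:R) = unit_vector R lo.
    by apply/funext => n; rewrite /emb /unit_vector rmorph_nat.
  exact: tsirelson_unit_vector.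
have sT : has_sup T by split; [exists e | exists 1 => c; exact: T1].
set D := sup T.
have eD : e <= D by exact: sup_upper_bound.
have D0 : 0 < D by exact: lt_le_trans eD.
have [c [lo0 hlo0] cD] : exists2 c, T c & D - D / 20 < c.
  by apply: sup_adherent => //; rewrite divr_gt0.
have pick lo : {p : (nat -> R) * nat | block p.1 lo p.2 /\ N (emb p.1) <= D * (21 / 20)}.
  apply: cid; apply: contrapT => no'.
  have : T (D * (21 / 20)).
    exists lo => v hi b; rewrite leNgt; apply/negP => h; apply: no'.
    by exists (v, hi); split => //; exact: ltW.
  by move/(sup_upper_bound sT); rewrite -/D; lra.
have [[v0 K] /= [b0 v0D]] := pick lo0.
pose fix lo i := if i is j.+1 then (sval (pick (lo j))).2 else K.
pose f i := (sval (pick (lo i))).1.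
have bf j : block (f j) (lo j) (lo j.+1) by rewrite /f /=; case: (pick _) => ? [].
have fD j : N (emb (f j)) <= D * (21 / 20) by rewrite /f; case: (pick _) => ? [].
pose r := (10 * K).+1.
have D'0 : 0 < D * (21 / 20) by rewrite mulr_gt0.
have bx : block (fun n => 2^-1 * (v0 n + \sum_(i < r) r%:R^-1 * f i n)) lo0 (lo r).
  exact: (@half_sum_block lo0 K v0 lo f r isT b0 bf erefl).
have up : N (emb (fun n => v0 n + \sum_(i < r) r%:R^-1 * f i n)) <= D * (21 / 20) * (31 / 20).
  exact: (@sum_norm_le _ lo0 K v0 lo f r D'0).
have := hlo0 _ _ bx.
rewrite embZ (tsirelsonZ hN); last first.
  by apply: (@c00_emb _ (lo r)) => n h; have := block_high bx h; lra.
rewrite normc_real ger0_norm ?invr_ge0 //; move: up; set X := N _.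
move: cD D0; clear; lra.
Qed.

End averages.

(** * The symmetric Tsirelson space *)

Section pairings.
Variable R : realType.
Implicit Types (x y t : omega R) (p : nat -> nat).

Lemma pairing_finite x y n : (forall m, (n <= m)%N -> x m * y m = 0) ->
  pairing x y = \sum_(i < n) x i * y i.
Proof.
move=> h; rewrite /pairing (fsbig_ord _ n (fun i => x i * y i)).
symmetry; apply: fsbig_widen => // m [_ /= nm].
by apply: h; rewrite leqNgt; apply/negP.
Qed.

Lemma pairingC x y : pairing x y = pairing y x.
Proof. by rewrite /pairing; apply: eq_fsbigr => i _; rewrite mulrC. Qed.

Definition act t x : omega R := fun n => t n * x n.

Lemma pairing_act t x y : pairing (act t x) y = pairing x (act t y).
Proof. by rewrite /pairing; apply: eq_fsbigr => i _; rewrite /act mulrCA mulrA. Qed.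

Lemma pairing_perm p x y : bijective p ->
  pairing (fun n => x (p n)) (fun n => y (p n)) = pairing x y.
Proof. by move=> bp; rewrite /pairing [RHS](reindex_fsbigT p). Qed.

Lemma pairing_unit x j : pairing x (unit_vector R j) = x j.
Proof.
rewrite (@pairing_finite _ _ j.+1) => [|m jm].
  rewrite big_ord_recr /= big1 ?add0r => [|i _].
    by rewrite /unit_vector eqxx mulr1.
  by rewrite /unit_vector ltn_eqF ?mulr0 //; case: i.
by rewrite /unit_vector gtn_eqF ?mulr0.
Qed.

Lemma normc_sum n (f : 'I_n -> R[i]) : normc (\sum_(i < n) f i) <= \sum_(i < n) normc (f i).
Proof.
elim: n f => [|n IH] f; first by rewrite !big_ord0 normc0.
rewrite !big_ord_recr /=; apply: le_trans (le_normcD _ _) _.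
by rewrite lerD2r.
Qed.

Lemma c00_act t x : c00 x -> c00 (act t x).
Proof. by move=> [n h]; exists n => m nm; rewrite /act h // mulr0. Qed.

Lemma c00D x y : c00 x -> c00 y -> c00 (x + y).
Proof.
move=> [n h] [m h']; exists (maxn n m) => l; rewrite geq_max => /andP[nl ml].
by rewrite omegaDE h // h' // addr0.
Qed.

Lemma c00N x : c00 x -> c00 (- x).
Proof.
move=> [n h]; exists n => m nm; have -> : (- x) m = - x m by [].
by rewrite h // oppr0.
Qed.

Lemma c00_perm p x : bijective p -> c00 x -> c00 (fun n => x (p n)).
Proof.
move=> [q pq qp] [m h]; exists (\max_(i < m) q i).+1 => n hn.
apply: h; rewrite leqNgt; apply/negP => pm.
have := leq_bigmax (F := fun i : 'I_m => q i) (Ordinal pm); rewrite /= pq => h'.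
by have := leq_trans hn h'; rewrite ltnn.
Qed.

Lemma pairingDl x y t : c00 x -> c00 y -> pairing (x + y) t = pairing x t + pairing y t.
Proof.
move=> [n h] [m h'].
have hx l : (maxn n m <= l)%N -> x l * t l = 0.
  by rewrite geq_max => /andP[nl ml]; rewrite h // mul0r.
have hy l : (maxn n m <= l)%N -> y l * t l = 0.
  by rewrite geq_max => /andP[nl ml]; rewrite h' // mul0r.
rewrite !(@pairing_finite _ _ (maxn n m)) //; last first.
  by move=> l nl; rewrite omegaDE mulrDl hx // hy // addr0.
by rewrite -big_split /=; apply: eq_bigr => i _; rewrite omegaDE mulrDl.
Qed.

Lemma pairingZ c x t : c00 x -> pairing (act (fun=> c) x) t = c * pairing x t.
Proof.
move=> [n h]; rewrite !(@pairing_finite _ _ n) => [|m nm|m nm].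
- by rewrite mulr_sumr; apply: eq_bigr => i _; rewrite /act mulrA.
- by rewrite h // mul0r.
- by rewrite /act h // mulr0 mul0r.
Qed.

Lemma dual_normP (N : omega R -> \bar R) y (c : R) :
  (dual_norm N y <= c%:E)%E <->
  (forall x, c00 x -> (N x <= 1)%E -> normc (pairing x y) <= c).
Proof.
split=> [h x cx Nx|h].
  rewrite -lee_fin; apply: le_trans h.
  by apply: ereal_sup_ubound; exists x.
by apply: ge_ereal_sup => _ [x [cx Nx] <-]; rewrite lee_fin; exact: h.
Qed.

Lemma dual_norm_ge (N : omega R -> \bar R) x y : c00 x -> (N x <= 1)%E ->
  ((normc (pairing x y))%:E <= dual_norm N y)%E.
Proof. by move=> cx Nx; apply: ereal_sup_ubound; exists x. Qed.

End pairings.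

Section symmetric_space.
Variables (R : realType) (N : omega R -> R).
Hypothesis hN : is_tsirelson_norm N.
Implicit Types (x y t : omega R) (p : nat -> nat) (c : R).

Local Notation T2 := (convexification2 N).
Local Notation T2e := (fun x => (convexification2 N x)%:E).
Local Notation sv := (symmetric_version T2e).
Local Notation NX := (Ts2_norm N).

Let sq x : nat -> R := fun n => normc (x n) ^+ 2.

Let T2E x : T2 x = Num.sqrt (N (emb (sq x))).
Proof. by []. Qed.

Let c00_sq x : c00 x -> c00 (emb (sq x)).
Proof. by move=> [n h]; apply: (@c00_emb _ _ n) => m nm; rewrite /sq h // normc0 expr0n. Qed.

(** Coordinatewise multiplication by such a sequence is [c] times a partial
    isometry of all the norms in play; scalars, phases and restrictions to sets
    of coordinates are instances. *)
Definition multiplier c t := 0 < c /\ forall n, normc (t n) = 0 \/ normc (t n) = c.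

Lemma multiplier_scale c t : multiplier c t -> multiplier 1 (fun n => c^-1%:C * t n).
Proof.
move=> [c0 h]; split=> // n; rewrite normcM normc_real (gtr0_norm (_ : 0 < c^-1)) ?invr_gt0 //.
by case: (h n) => ->; [left; rewrite mulr0 | right; rewrite mulVf // lt0r_neq0].
Qed.

Lemma T2_act t x : multiplier 1 t -> c00 x -> T2 (act t x) <= T2 x.
Proof.
move=> [_ h] cx; rewrite !T2E; apply: ler_wsqrtr.
have [n xn] := cx.
pose E := [fset i in iota 0 n | t i != 0]%fset.
have -> : emb (sq (act t x)) = restr E (emb (sq x)).
  apply/funext => m; rewrite /restr /emb /sq /act !inE /= mem_iota add0n /= normcM.
  have [mn|nm] := ltnP m n; last first.
    by rewrite xn // normc0 mulr0 expr0n.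
  have [->|tm] := eqVneq (t m) 0; first by rewrite normc0 mul0r expr0n.
  case: (h m) => [/normc_eq0P tm0|->]; last by rewrite mul1r.
  by rewrite tm0 eqxx in tm.
by apply: tsirelson_restr => //; exact: c00_sq.
Qed.

Lemma T2_coord x n : c00 x -> normc (x n) <= T2 x.
Proof.
move=> cx; rewrite T2E.
have := coord_le_tsirelson hN n (c00_sq cx).
rewrite /emb normc_real (ger0_norm (sqr_ge0 _)) => h.
have -> : normc (x n) = Num.sqrt (sq x n) by rewrite /sq sqrtr_sqr ger0_norm ?normc_ge0.
exact: ler_wsqrtr.
Qed.

Lemma T2_unit j : T2 (unit_vector R j) <= 1.
Proof.
rewrite T2E -sqrtr1; apply: ler_wsqrtr.
have -> : emb (sq (unit_vector R j)) = unit_vector R j.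
  apply/funext => n; rewrite /emb /sq /unit_vector.
  by case: (n == j); rewrite ?normc1 ?normc0 ?expr1n ?expr0n.
exact: tsirelson_unit_vector.
Qed.

(** The set over which [symmetric_version] takes its supremum, freed of extended
    reals. *)
Definition symmetric_ball y := c00 y /\
  forall p, bijective p -> forall x, c00 x -> T2 x <= 1 ->
    normc (pairing x (fun n => y (p n))) <= 1.

Lemma symmetric_ballE : symmetric_ball = [set y | c00 y /\
    (ereal_sup [set dual_norm T2e (fun n => y (p n))
               | p in [set p : nat -> nat | bijective p]] <= 1)%E].
Proof.
apply/seteqP; split => y [cy h]; split => //.
  apply: ge_ereal_sup => _ [p bp <-]; apply/dual_normP => x cx Nx.
  by apply: h => //; rewrite -lee_fin.
move=> p bp x cx Nx.
have : (dual_norm T2e (fun n => y (p n)) <= 1%:E)%E.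
  by apply: le_trans h; apply: ereal_sup_ubound; exists p.
by move/dual_normP; apply => //; rewrite lee_fin.
Qed.

Lemma svE x : sv x = ereal_sup [set (normc (pairing x y))%:E | y in symmetric_ball].
Proof. by rewrite symmetric_ballE. Qed.

Lemma sv_le x c : (forall y, symmetric_ball y -> normc (pairing x y) <= c) -> (sv x <= c%:E)%E.
Proof. by move=> h; rewrite svE; apply: ge_ereal_sup => _ [y By <-]; rewrite lee_fin h. Qed.

Lemma sv_ge x y : symmetric_ball y -> ((normc (pairing x y))%:E <= sv x)%E.
Proof. by move=> By; rewrite svE; apply: ereal_sup_ubound; exists y. Qed.

Lemma symmetric_ball_act t y : multiplier 1 t -> symmetric_ball y -> symmetric_ball (act t y).
Proof.
move=> [_ ht] [cy h]; split; first exact: c00_act.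
move=> p bp x cx Nx.
have -> : (fun n => act t y (p n)) = act (fun n => t (p n)) (fun n => y (p n)) by [].
rewrite -pairing_act; apply: h => //; first exact: c00_act.
by apply: le_trans Nx; apply: T2_act => //; split.
Qed.

Lemma symmetric_ball_perm p y : bijective p -> symmetric_ball y ->
  symmetric_ball (fun n => y (p n)).
Proof.
move=> bp [cy h]; split; first exact: c00_perm.
by move=> q bq x cx Nx; apply: (h (p \o q)) => //; exact: bij_comp.
Qed.

Lemma symmetric_ball_coord y j : symmetric_ball y -> normc (y j) <= 1.
Proof.
move=> [cy h]; rewrite -(pairing_unit y j) pairingC.
by apply: (h id) => //; [exists id | exact: c00_unit_vector | exact: T2_unit].
Qed.

Lemma symmetric_ball_unit j : symmetric_ball (unit_vector R j).
Proof.
split; first exact: c00_unit_vector.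
move=> p [q pq qp] x cx Nx.
have -> : (fun n => unit_vector R j (p n)) = unit_vector R (q j).
  by apply/funext => n; rewrite /unit_vector -(can2_eq pq qp).
by rewrite pairing_unit; apply: le_trans Nx; exact: T2_coord.
Qed.

Lemma sv_l1 x n : (forall m, (n <= m)%N -> x m = 0) ->
  (sv x <= (\sum_(i < n) normc (x i))%:E)%E.
Proof.
move=> h; apply: sv_le => y By.
rewrite (@pairing_finite _ _ _ n) => [|m nm]; last by rewrite h // mul0r.
apply: le_trans (normc_sum _) _; apply: ler_sum => i _.
by rewrite normcM ler_piMr ?normc_ge0 ?symmetric_ball_coord.
Qed.

Lemma sv_fin x : c00 x -> sv x \is a fin_num.
Proof.
move=> [n h]; rewrite fin_real //; apply/andP; split.
  apply: lt_le_trans (sv_ge x (symmetric_ball_unit 0)); exact: ltNyr.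
by apply: le_lt_trans (sv_l1 h) _; exact: ltry.
Qed.

Lemma svD x y : c00 x -> c00 y -> (sv (x + y)%R <= sv x + sv y)%E.
Proof.
move=> cx cy; rewrite -(fineK (sv_fin cx)) -(fineK (sv_fin cy)) -EFinD.
apply: sv_le => t Bt; rewrite pairingDl //.
apply: le_trans (le_normcD _ _) _; apply: lerD; rewrite -lee_fin fineK ?sv_fin //; exact: sv_ge.
Qed.

Lemma sv_act c t x : multiplier c t -> c00 x -> (sv (act t x) <= c%:E * sv x)%E.
Proof.
move=> mt cx; have [c0 _] := mt; rewrite -(fineK (sv_fin cx)) -EFinM.
apply: sv_le => y By; rewrite pairing_act.
have -> : act t y = act (fun=> c%:C) (act (fun n => c^-1%:C * t n) y).
  apply/funext => n; rewrite /act !mulrA -rmorphM mulfV ?lt0r_neq0 //.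
  by rewrite rmorph1 mul1r.
rewrite -pairing_act pairingZ // normcM normc_real gtr0_norm // ler_pM2l //.
rewrite -lee_fin fineK ?sv_fin //; apply: sv_ge.
by apply: symmetric_ball_act By; exact: multiplier_scale.
Qed.

Lemma sv_perm p x : bijective p -> (sv (fun n => x (p n)) <= sv x)%E.
Proof.
move=> [q pq qp]; have bp : bijective p by exists q.
have bq : bijective q by exists p.
rewrite svE; apply: ge_ereal_sup => _ [y By <-].
have -> : y = (fun n => (fun m => y (q m)) (p n)) by apply/funext => n; rewrite pq.
rewrite (pairing_perm x (fun m => y (q m)) bp); apply: sv_ge.
exact: symmetric_ball_perm.
Qed.

Definition completion_witness x (r : R) (u : nat -> omega R) :=
  [/\ forall k, c00 (u k),
      forall e : R, 0 < e -> exists K, forall k l, (K <= k)%N -> (K <= l)%N ->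
        (sv (u k - u l)%R <= e%:E)%E,
      forall j, (fun k => u k j) @ \oo --> x j &
      sv (u k) @[k --> \oo] --> r%:E].

Lemma NX_le x r u : completion_witness x r u -> (NX x <= r%:E)%E.
Proof. by move=> h; apply: ereal_inf_lbound; exists r => //; exists u. Qed.

Lemma NX_ge x (c : \bar R) :
  (forall r u, completion_witness x r u -> (c <= r%:E)%E) -> (c <= NX x)%E.
Proof. by move=> h; apply: le_ereal_inf_tmp => _ [r [u hu] <-]; exact: h hu. Qed.

Lemma NX_le_sv x : c00 x -> (NX x <= sv x)%E.
Proof.
move=> cx; rewrite -(fineK (sv_fin cx)); apply: (@NX_le _ _ (fun=> x)); split => //.
- move=> e e0; exists 0%N => k l _ _; rewrite subrr.
  by apply: le_trans (@sv_l1 _ 0 _) _ => //; rewrite big_ord0 lee_fin ltW.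
- by move=> j; exact: cvg_cst.
- by rewrite fineK ?sv_fin //; exact: cvg_cst.
Qed.

(** The functionals given by the ball extend to the completion without
    increase of the norm. *)
Lemma pairing_le_NX x y : symmetric_ball y -> ((normc (pairing x y))%:E <= NX x)%E.
Proof.
move=> By; apply: NX_ge => r u [cu _ ux ur]; rewrite lee_fin.
have [[n yn] _] := By.
have fin t : pairing t y = \sum_(i < n) t i * y i.
  by apply: pairing_finite => m nm; rewrite yn // mulr0.
have near_pair : forall e : R, 0 < e ->
    \forall k \near \oo, normc (pairing x y - pairing (u k) y) <= e.
  move=> e e0; have en : 0 < e / n.+1%:R by rewrite divr_gt0.
  have H (i : 'I_n) : \forall k \near \oo, normc (x i - u k i) <= e / n.+1%:R.
    have /cvgrPdist_le /(_ (e / n.+1%:R)%:C) := ux i; rewrite ltcR en => /(_ isT).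
    by apply: filterS => k; rewrite normC_normc lecR.
  have H' : \forall k \near \oo, forall i : 'I_n, normc (x i - u k i) <= e / n.+1%:R.
    exact: filter_forall.
  apply: filterS H' => k hk.
  rewrite !fin -sumrB; apply: le_trans (normc_sum _) _.
  apply: le_trans (_ : \sum_(i < n) e / n.+1%:R <= _).
    apply: ler_sum => i _; rewrite -mulrBl normcM.
    apply: le_trans (hk i); rewrite ler_piMr ?normc_ge0 //.
    exact: symmetric_ball_coord.
  rewrite sumr_const card_ord -[leLHS]mulr_natr -mulrA; apply: ler_piMr; first exact: ltW.
  by rewrite mulrC ler_pdivrMr // mul1r ler_nat.
apply/ler_addgt0Pr => e e0.
have e2 : 0 < e / 2 by rewrite divr_gt0.
have h1 := near_pair _ e2.
have h2 : \forall k \near \oo, fine (sv (u k)) <= r + e / 2.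
  by apply: cvgr_le (fine_cvg ur) _ _; rewrite ltrDl.
near \oo => k.
have k1 : normc (pairing x y - pairing (u k) y) <= e / 2 by near: k.
have k2 : fine (sv (u k)) <= r + e / 2 by near: k.
have k3 : normc (pairing (u k) y) <= fine (sv (u k)).
  by rewrite -lee_fin fineK ?sv_fin //; exact: sv_ge.
have -> : pairing x y = (pairing x y - pairing (u k) y) + pairing (u k) y by rewrite subrK.
apply: le_trans (le_normcD _ _) _; lra.
Unshelve. all: by end_near. Qed.

Lemma NX_ge0 x : (0 <= NX x)%E.
Proof. by apply: le_trans (pairing_le_NX x (symmetric_ball_unit 0)); rewrite lee_fin normc_ge0. Qed.

Lemma NX_coord x j : ((normc (x j))%:E <= NX x)%E.
Proof. by rewrite -(pairing_unit x j); exact: pairing_le_NX (symmetric_ball_unit j). Qed.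

(** The multiplier acts on any sequence of [c00] that converges to [x]; the norms
    of its images converge because they form a Cauchy sequence. *)
Lemma NX_act c t x : multiplier c t -> (NX (act t x) <= c%:E * NX x)%E.
Proof.
move=> mt; have [c0 _] := mt.
rewrite -lee_pdivrMl //; apply: NX_ge => r u [cu cau ux ur].
rewrite lee_pdivrMl //.
pose a k := fine (sv (act t (u k))).
have aE k : (a k)%:E = sv (act t (u k)) by rewrite fineK // sv_fin //; exact: c00_act.
have actB (y z : omega R) : act t (y - z) = act t y - act t z.
  by apply/funext => n; rewrite /act mulrBr.
have svB k l : (sv (act t (u k) - act t (u l))%R <= c%:E * sv (u k - u l)%R)%E.
  by rewrite -actB; apply: sv_act => //; apply: c00D => //; exact: c00N.
have cauchy_a e : 0 < e -> exists K, forall k l, (K <= k)%N -> (K <= l)%N -> `|a k - a l| <= e.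
  move=> e0; have [K hK] := cau (e / c) (divr_gt0 e0 c0).
  exists K => k l Kk Kl.
  have half k' l' : (K <= k')%N -> (K <= l')%N -> a k' - a l' <= e.
    move=> Kk' Kl'; rewrite lerBlDl -lee_fin EFinD !aE.
    have -> : act t (u k') = act t (u l') + (act t (u k') - act t (u l')) by rewrite addrC subrK.
    apply: le_trans (svD _ _) _; [exact: c00_act | |].
      by apply: c00D; [|apply: c00N]; exact: c00_act.
    apply: leeD2l; apply: le_trans (svB _ _) _.
    apply: le_trans (lee_wpmul2l _ (hK _ _ Kk' Kl')) _; first by rewrite lee_fin ltW.
    by rewrite -EFinM lee_fin mulrC divfK // lt0r_neq0.
  by rewrite ler_norml lerNl opprB !half.
have : cvg (a k @[k --> \oo]).
  apply: cauchy_cvg; apply: cauchy_exP => e e0.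
  have [K hK] := cauchy_a (e / 2) (divr_gt0 e0 (ltr0Sn _ _)).
  exists (a K); exists K => // k /= Kk.
  rewrite /ball /=; apply: le_lt_trans (hK K k (leqnn _) Kk) _; lra.
move=> /cvg_ex [r' ar'].
apply: (@le_trans _ _ r'%:E).
  apply: (@NX_le _ _ (fun k => act t (u k))); split.
  - by move=> k; exact: c00_act.
  - move=> e e0; have [K hK] := cau (e / c) (divr_gt0 e0 c0).
    exists K => k l Kk Kl; apply: le_trans (svB _ _) _.
    apply: le_trans (lee_wpmul2l _ (hK _ _ Kk Kl)) _; first by rewrite lee_fin ltW.
    by rewrite -EFinM lee_fin mulrC divfK // lt0r_neq0.
  - by move=> j; apply: cvgM => //; exact: cvg_cst.
  - apply: cvg_EFin; first by apply: nearW => k; apply: sv_fin; exact: c00_act.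
    exact: ar'.
rewrite -EFinM lee_fin.
have cr : c * fine (sv (u k)) @[k --> \oo] --> c * r.
  by apply: cvgM; [exact: cvg_cst | exact: fine_cvg ur].
apply: ler_cvg_to ar' cr _; apply: nearW => k.
rewrite -lee_fin EFinM aE fineK; first exact: sv_act.
exact: sv_fin.
Qed.

Lemma dual_NX_act c t y : multiplier c t ->
  (dual_norm NX (act t y) <= c%:E * dual_norm NX y)%E.
Proof.
move=> mt; have [c0 _] := mt.
apply: ge_ereal_sup => _ [x [cx Nx] <-].
rewrite -pairing_act.
have -> : act t x = act (fun=> c%:C) (act (fun n => c^-1%:C * t n) x).
  apply/funext => n; rewrite /act !mulrA -rmorphM mulfV ?lt0r_neq0 //.
  by rewrite rmorph1 mul1r.
rewrite pairingZ; last exact: c00_act.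
rewrite normcM normc_real gtr0_norm // EFinM; apply: lee_wpmul2l; first by rewrite lee_fin ltW.
apply: dual_norm_ge; first exact: c00_act.
apply: le_trans (NX_act _ (multiplier_scale mt)) _.
by rewrite mul1e.
Qed.

Lemma dual_NX_ge0 y : (0 <= dual_norm NX y)%E.
Proof.
have c0 : c00 (0 : omega R) by exact: c000.
apply: le_trans (dual_norm_ge y c0 _); first by rewrite lee_fin normc_ge0.
apply: le_trans (NX_le_sv c0) _; apply: le_trans (@sv_l1 _ 0 _) _ => //.
by rewrite big_ord0 lee_fin.
Qed.

Lemma NX_l1 x n : (forall m, (n <= m)%N -> x m = 0) ->
  (NX x <= (\sum_(i < n) normc (x i))%:E)%E.
Proof. by move=> h; apply: le_trans (NX_le_sv _) (sv_l1 h); exists n. Qed.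

Lemma dual_NX_l1 y n : (forall m, (n <= m)%N -> y m = 0) ->
  (dual_norm NX y <= (\sum_(i < n) normc (y i))%:E)%E.
Proof.
move=> h; apply/dual_normP => x cx Nx.
rewrite (@pairing_finite _ _ _ n) => [|m nm]; last by rewrite h // mulr0.
apply: le_trans (normc_sum _) _; apply: ler_sum => i _.
rewrite normcM ler_piMl ?normc_ge0 // -lee_fin.
exact: le_trans (NX_coord x i) Nx.
Qed.

End symmetric_space.

Section good_pairs.
Variables (R : realType) (N : omega R -> R).
Hypothesis hN : is_tsirelson_norm N.

Local Notation T2 := (convexification2 N).
Local Notation T2e := (fun x => (convexification2 N x)%:E).
Local Notation sv := (symmetric_version T2e).

(** Nonnegative entries give a meaning to [ln (a n / b n)].  The last two fields
    are in tension when [e] is small: they force the ratio [a n / b n] to be large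
    on average. *)
Record good_pair (e : R) (m : nat) (a b : nat -> R) : Prop := GoodPair {
  good_a_ge0 : forall n, 0 <= a n;
  good_b_ge0 : forall n, 0 <= b n;
  good_a_high : forall n, (m <= n)%N -> a n = 0;
  good_b_high : forall n, (m <= n)%N -> b n = 0;
  good_b_ball : symmetric_ball N (emb b);
  good_a_ball : (sv (emb a) <= 1)%E;
  good_pairing : 1 / 2 <= \sum_(n < m) a n * b n;
  good_b_small : \sum_(n < m) b n ^+ 2 <= e
}.

(** If [v] is a probability vector of small Tsirelson norm, [sqrt v] is a unit
    vector of [l_2], small in the 2-convexification, hence has a large norm [rho]
    as a functional, already before permutations are taken into account.
    Dividing by [rho] gives [b], small in [l_2], and a vector almost attaining
    [rho] gives [a]. *)
Lemma good_pair_exists (e : R) : 0 < e -> exists m a b, good_pair e m a b.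
Proof.
move=> e0; have [v [hi [[v0 _ vh v1] Nv]]] := small_average hN e0.
pose b' n := Num.sqrt (v n).
have b'0 n : 0 <= b' n by exact: sqrtr_ge0.
have b'h n : (hi <= n)%N -> b' n = 0 by move=> h; rewrite /b' vh // sqrtr0.
have b'sq n : b' n ^+ 2 = v n by rewrite sqr_sqrtr.
have cb' : c00 (emb b') by exact: c00_emb b'h.
pose s := Num.sqrt e; have s0 : 0 < s by rewrite sqrtr_gt0.
have T2b' : T2 (emb b') <= s.
  apply: ler_wsqrtr; apply: le_trans Nv; rewrite le_eqVlt; apply/orP; left; apply/eqP.
  congr N; apply/funext => n; rewrite /emb normc_real (ger0_norm (b'0 n)).
  by rewrite b'sq.
pose S := [set r : R | exists p x, [/\ bijective p, c00 x, T2 x <= 1 &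
  r = normc (pairing x (fun n => emb b' (p n)))]].
have Sub r : S r -> r <= \sum_(n < hi) b' n.
  move=> [p [x [[q pq qp] cx Nx ->]]].
  have bp : bijective p by exists q.
  have -> : x = (fun n => (fun m => x (q m)) (p n)) by apply/funext => n; rewrite pq.
  rewrite (pairing_perm (fun m => x (q m)) (emb b') bp).
  rewrite (@pairing_finite _ _ _ hi) => [|n h]; last by rewrite /emb b'h // mulr0.
  apply: le_trans (normc_sum _) _; apply: ler_sum => i _.
  rewrite normcM /emb normc_real (ger0_norm (b'0 i)) ler_piMl //.
  by apply: le_trans Nx; exact: T2_coord.
have supp_pairing (x : omega R) : pairing x (emb b') = \sum_(i < hi) x i * (b' i)%:C.
  by rewrite (@pairing_finite _ _ _ hi) // => n h; rewrite /emb b'h // mulr0.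
(* [emb b'] divided by its norm is a test vector, since [b'] is a unit vector of [l_2] *)
have Ss : S s^-1.
  exists id, (act (fun=> s^-1%:C) (emb b')); split.
  - by exists id.
  - exact: c00_act.
  - have sq_scale : (fun n => (normc (act (fun=> s^-1%:C) (emb b') n) ^+ 2)%:C) =
      act (fun=> (s^-1 ^+ 2)%:C) (fun n => (normc (emb b' n) ^+ 2)%:C) :> omega R.
      apply/funext => n; rewrite /act normcM normc_real exprMn.
      by rewrite (ger0_norm (_ : 0 <= s^-1)) ?invr_ge0 ?ltW // rmorphM.
    have cb'2 : c00 ((fun n => (normc (emb b' n) ^+ 2)%:C) : omega R).
      by exists hi => n h; rewrite /emb b'h // normc0 expr0n.
    have -> : T2 (act (fun=> s^-1%:C) (emb b')) = s^-1 * T2 (emb b').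
      rewrite /convexification2 sq_scale.
      have -> : act (fun=> (s^-1 ^+ 2)%:C) (fun n => (normc (emb b' n) ^+ 2)%:C) =
        (s^-1 ^+ 2)%:C *: ((fun n => (normc (emb b' n) ^+ 2)%:C) : omega R) by [].
      rewrite (tsirelsonZ hN) // normc_real (ger0_norm (sqr_ge0 _)).
      by rewrite sqrtrM ?sqr_ge0 // sqrtr_sqr ger0_norm // invr_ge0 ltW.
    by rewrite mulrC ler_pdivrMr // mul1r.
  - rewrite pairingZ // supp_pairing.
    have -> : \sum_(i < hi) emb b' i * (b' i)%:C = 1.
      rewrite -(rmorph1 (real_complex R)) -v1 rmorph_sum; apply: eq_bigr => i _.
      by rewrite /= -b'sq expr2 rmorphM.
    by rewrite mulr1 normc_real ger0_norm // invr_ge0 ltW.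
have sS : has_sup S by split; [exists s^-1 | exists (\sum_(n < hi) b' n) => r; exact: Sub].
pose rho := sup S.
have srho : s^-1 <= rho by exact: sup_upper_bound.
have rho0 : 0 < rho by apply: lt_le_trans srho; rewrite invr_gt0.
have [_ [p [x [bp cx Nx ->]]] rx] : exists2 r, S r & rho - rho / 2 < r.
  by apply: sup_adherent => //; rewrite divr_gt0.
have [q pq qp] := bp.
have bq : bijective q by exists p.
pose b n := rho^-1 * b' n.
pose a n := normc (x (q n)).
have cx' : c00 (fun n => x (q n)) by exact: c00_perm.
have [m0 hm0] := cx'.
have ca : c00 (emb a) by exists m0 => n h; rewrite /emb /a hm0 // normc0.
have ri : 0 <= rho^-1 by rewrite invr_ge0 ltW.
have b0 n : 0 <= b n by rewrite mulr_ge0.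
have a0 n : 0 <= a n by exact: normc_ge0.
have bh n : (maxn hi m0 <= n)%N -> b n = 0.
  by rewrite geq_max => /andP[h _]; rewrite /b b'h // mulr0.
exists (maxn hi m0), a, b; split => //.
- by move=> n; rewrite geq_max => /andP[_ h]; rewrite /a hm0 // normc0.
- split; first exact: c00_emb bh.
  move=> r br y cy Ny.
  have -> : (fun n => emb b (r n)) = act (fun=> rho^-1%:C) (fun n => emb b' (r n)).
    by apply/funext => n; rewrite /act /emb /b rmorphM.
  rewrite pairingC pairingZ; last exact: c00_perm.
  rewrite normcM normc_real (ger0_norm ri) mulrC ler_pdivrMr // mul1r pairingC.
  by apply: sup_upper_bound => //; exists r, y.
- apply: sv_le => y [cy hy].
  have -> : emb a = (fun n => (fun k => (normc (x k))%:C : R[i]) (q n)) by [].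
  have -> : y = (fun n => (fun k => y (p k)) (q n)) by apply/funext => n; rewrite qp.
  rewrite (pairing_perm (fun k => (normc (x k))%:C : R[i]^o) (fun k => y (p k)) bq).
  apply: hy => //.
    by have [k hk] := cx; exists k => n h; rewrite hk // normc0.
  apply: le_trans Nx; rewrite le_eqVlt; apply/orP; left; apply/eqP.
  rewrite /convexification2; congr (Num.sqrt (N _)); apply/funext => n.
  by rewrite normc_real ger0_norm // normc_ge0.
- have h1 : normc (pairing x (fun n => emb b' (p n))) <= \sum_(n < maxn hi m0) a n * b' n.
    have -> : x = (fun n => (fun k => x (q k)) (p n)) by apply/funext => n; rewrite pq.
    rewrite (pairing_perm (fun k => x (q k)) (emb b') bp).
    rewrite (@pairing_finite _ _ _ (maxn hi m0)); last first.
      by move=> n; rewrite geq_max => /andP[h _]; rewrite /emb b'h // mulr0.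
    apply: le_trans (normc_sum _) _; apply: ler_sum => i _.
    by rewrite normcM /emb normc_real (ger0_norm (b'0 i)).
  have -> : \sum_(n < maxn hi m0) a n * b n = rho^-1 * \sum_(n < maxn hi m0) a n * b' n.
    by rewrite mulr_sumr; apply: eq_bigr => i _; rewrite /b mulrCA.
  by rewrite ler_pdivlMl //; lra.
- have -> : \sum_(n < maxn hi m0) b n ^+ 2 = rho^-1 ^+ 2.
    rewrite -[RHS]mulr1 -v1 mulr_sumr (big_ord_widen_cond _ xpredT (fun i => rho^-1 ^+ 2 * v i) (leq_maxl hi m0)).
    rewrite [RHS]big_mkcond /=; apply: eq_bigr => i _.
    rewrite /b exprMn b'sq; case: ltnP => // h.
    by rewrite vh // mulr0.
  have -> : e = s ^+ 2 by rewrite sqr_sqrtr // ltW.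
  have h : rho^-1 <= s by rewrite -[s]invrK lef_pV2 ?posrE ?invr_gt0.
  by rewrite !expr2; apply: ler_pM.
Qed.

(** The definition of the ball is invariant under permutations, which lets a pair
    sit on prescribed coordinates. *)
Lemma good_pair_perm e m a b (q : nat -> nat) : bijective q -> good_pair e m a b ->
  symmetric_ball N (emb (fun n => b (q n))) /\ (sv (emb (fun n => a (q n))) <= 1)%E.
Proof.
move=> bq [_ _ _ _ Bb Sa _ _]; split; first exact: (symmetric_ball_perm bq Bb).
by apply: le_trans Sa; exact: (sv_perm N (emb a) bq).
Qed.

End good_pairs.

(** * The derived space *)

Section derived_space.
Variables (R : realType) (N : omega R -> R).
Hypothesis hN : is_tsirelson_norm N.
Implicit Types (x y t : omega R) (p : nat -> nat) (c : R).

Local Notation NX := (Ts2_norm N).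
Local Notation sv := (symmetric_version (fun x => (convexification2 N x)%:E)).
Local Notation DN := (derived_norm NX).
Local Notation half := ((2^-1 : R)%:C).

Lemma halfE : (2^-1 : R[i]) = half.
Proof. by rewrite fmorphV rmorph_nat. Qed.

Lemma open_strip_half : @open_strip R 2^-1.
Proof. by rewrite halfE /open_strip /= invr_gt0 ltr0n invf_lt1 // ltr1n. Qed.

Lemma derivable_has_cderiv (f : R[i] -> R[i]) z :
  derivable (f : R[i]^o -> R[i]^o) z 1 -> has_cderiv f z (derive1 (f : R[i]^o -> R[i]^o) z).
Proof. by move=> df; apply: is_derive_has_cderiv; rewrite derive1E; exact: derivableP. Qed.

Lemma has_cderiv_derivable (f : R[i] -> R[i]) z L : has_cderiv f z L ->
  derivable (f : R[i]^o -> R[i]^o) z 1 /\ derive1 (f : R[i]^o -> R[i]^o) z = L.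
Proof. by move=> /has_cderiv_is_derive [df e]; split; [exact: df | rewrite derive1E; exact: e]. Qed.

Lemma has_cderivD (f g : R[i] -> R[i]) z u v : has_cderiv f z u -> has_cderiv g z v ->
  has_cderiv (fun w => f w + g w) z (u + v).
Proof.
move=> /has_cderiv_is_derive df /has_cderiv_is_derive dg.
by apply: is_derive_has_cderiv; exact: is_deriveD.
Qed.

Lemma within_continuousM (A : set R[i]^o) (f g : R[i]^o -> R[i]^o) :
  {within A, continuous f} -> {within A, continuous g} ->
  {within A, continuous (fun z => f z * g z)}.
Proof. by move=> cf cg z; apply: cvgM; [exact: cf | exact: cg]. Qed.

Lemma within_continuous_sum (A : set R[i]^o) n (f : nat -> R[i]^o -> R[i]^o) :
  (forall i, {within A, continuous (f i)}) ->
  {within A, continuous (fun z => \sum_(i < n) f i z)}.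
Proof.
move=> cf; elim: n => [|n IH].
  have -> : (fun z => \sum_(i < 0) f i z) = (fun=> 0) by apply/funext => z; rewrite big_ord0.
  by move=> z; exact: cvg_cst.
have -> : (fun z => \sum_(i < n.+1) f i z) = (fun z => \sum_(i < n) f i z + f n z).
  by apply/funext => z; rewrite big_ord_recr.
by move=> z; apply: cvgD; [exact: IH | exact: cf].
Qed.

Lemma bounded_continuous_act (M : omega R -> \bar R) t c (f : R -> omega R) : 0 < c ->
  (forall x, (0 <= M x)%E) -> (forall x, (M (act t x) <= c%:E * M x)%E) ->
  bounded_continuous_in M f -> bounded_continuous_in M (fun s => act t (f s)).
Proof.
move=> c0 M0 Mt [[B fB] fc]; split.
  exists (c * B) => s; apply: le_trans (Mt _) _; rewrite EFinM.
  by apply: lee_wpmul2l => //; rewrite lee_fin ltW.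
move=> s0.
have cv : (c%:E * M (f s - f s0)%R)%E @[s --> s0] --> 0%E.
  by rewrite -(mule0 c%:E); apply: cvgeZl => //; exact: fc.
apply: squeeze_cvge cv; last exact: cvg_cst.
apply: nearW => s; rewrite M0 /=.
have -> : act t (f s) - act t (f s0) = act t (f s - f s0).
  by apply/funext => n; rewrite /act mulrBr.
exact: Mt.
Qed.

(** Multiplying each coordinate of a function by a constant commutes with
    evaluation and with differentiation at [1/2]. *)
Lemma derived_norm_act c t x y : multiplier c t ->
  (DN (act t x, act t y) <= c%:E * DN (x, y))%E.
Proof.
move=> mt; have [c0 tn] := mt.
have tc n : normc (t n) <= c by case: (tn n) => ->; rewrite // ltW.
rewrite -lee_pdivrMl //; apply: le_ereal_inf_tmp => _ [F [hF Fy Fx] <-] /=.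
rewrite lee_pdivrMl //.
apply: (@le_trans _ _ (calF_norm NX (fun z => act t (F z)))).
  apply: ereal_inf_lbound; exists (fun z => act t (F z)) => //; split => /=.
  - split.
    + move=> j; have [B hB] := calF_bounded hF j; exists (c * B) => z sz.
      by rewrite /act normcM; apply: ler_pM; rewrite ?normc_ge0 ?hB.
    + move=> j; apply: (@within_continuousM _ (fun=> t j) (fun z => F z j)).
        by move=> z; exact: cvg_cst.
      have h := @calF_continuous _ _ _ hF j; exact: h.
    + move=> j z sz; have d := derivable_has_cderiv (@calF_analytic _ _ _ hF j z sz).
      by have [] := has_cderiv_derivable (has_cderivM (has_cderiv_cst (t j) z) d).
    + apply: (@bounded_continuous_act _ t c (fun s => F (0 +i* s))) => //.
      * exact: NX_ge0.
      * by move=> u; exact: NX_act.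
      * exact: calF_left hF.
    + apply: (@bounded_continuous_act _ t c (fun s => F (1 +i* s))) => //.
      * exact: dual_NX_ge0.
      * by move=> u; exact: dual_NX_act.
      * exact: calF_right hF.
  - by rewrite Fy.
  - move=> j; have d := derivable_has_cderiv (@calF_analytic _ _ _ hF j _ open_strip_half).
    have [_ ->] := has_cderiv_derivable (has_cderivM (has_cderiv_cst (t j) 2^-1) d).
    by rewrite mulr0 addr0 Fx.
rewrite /calF_norm ge_max; apply/andP; split.
  apply: ge_ereal_sup => _ [s _ <-]; apply: le_trans (NX_act hN _ mt) _.
  apply: lee_wpmul2l; first by rewrite lee_fin ltW.
  by rewrite le_max; apply/orP; left; apply: ereal_sup_ubound; exists s.
apply: ge_ereal_sup => _ [s _ <-]; apply: le_trans (dual_NX_act hN _ mt) _.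
apply: lee_wpmul2l; first by rewrite lee_fin ltW.
by rewrite le_max; apply/orP; right; apply: ereal_sup_ubound; exists s.
Qed.

(** Constant functions suffice for the vectors [(0, y)]. *)
Lemma derived_norm_l1 y n : (forall m, (n <= m)%N -> y m = 0) ->
  (DN (0%R : omega R, y) <= (\sum_(i < n) normc (y i))%:E)%E.
Proof.
move=> yn.
have z0 (M : omega R -> \bar R) : M 0 = 0%E ->
    forall s0 : R, M ((fun=> y) s - (fun=> y) s0) @[s --> s0] --> 0%E.
  by move=> M0 s0; rewrite subrr M0; exact: cvg_cst.
have NX0 : NX 0 = 0%E.
  apply/eqP; rewrite eq_le (NX_ge0 hN) andbT.
  by apply: le_trans (@NX_l1 _ _ hN 0 0%N _) _ => //; rewrite big_ord0.
have dNX0 : dual_norm NX 0 = 0%E.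
  apply/eqP; rewrite eq_le (dual_NX_ge0 hN) andbT.
  by apply: le_trans (@dual_NX_l1 _ _ hN 0 0%N _) _ => //; rewrite big_ord0.
apply: (@le_trans _ _ (calF_norm NX (fun=> y))).
  apply: ereal_inf_lbound; exists (fun=> y) => //; split => //=.
    split.
    - by move=> j; exists (normc (y j)).
    - by move=> j z; exact: cvg_cst.
    - by move=> j z _; exact: derivable_cst.
    - by split; [exists (\sum_(i < n) normc (y i)) => _; exact: NX_l1 | exact: z0].
    - by split; [exists (\sum_(i < n) normc (y i)) => _; exact: dual_NX_l1 | exact: z0].
  by move=> j; rewrite derive1_cst.
rewrite /calF_norm ge_max; apply/andP; split; apply: ge_ereal_sup => _ [s _ <-].
  exact: NX_l1.
exact: dual_NX_l1.
Qed.

Lemma derived_norm_ge0 xy : (0 <= DN xy)%E.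
Proof.
apply: le_ereal_inf_tmp => _ [F _ <-]; rewrite /calF_norm le_max; apply/orP; left.
apply: le_trans (NX_ge0 hN (F (0 +i* 0))) _.
by apply: ereal_sup_ubound; exists 0.
Qed.

Lemma sum_perm n m (f : nat -> R) (q : nat -> nat) : bijective q ->
  (forall i, (m <= i)%N -> f i = 0) -> (forall i, (n <= i)%N -> f (q i) = 0) ->
  \sum_(i < n) f (q i) = \sum_(i < m) f i.
Proof.
move=> bq fm fn.
rewrite (fsbig_ord _ n (fun i => f (q i))) (fsbig_ord _ m f).
rewrite (@fsbig_widen _ _ _ _ `I_n setT (fun i => f (q i))) //; last first.
  by move=> i [_ /= ni]; apply: fn; rewrite leqNgt; apply/negP.
rewrite (@fsbig_widen _ _ _ _ `I_m setT f) //; last first.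
  by move=> i [_ /= ni]; apply: fm; rewrite leqNgt; apply/negP.
by rewrite [RHS](reindex_fsbigT q).
Qed.

Lemma sqrt_ratio (a b : R) : 0 < a -> 0 < b ->
  Num.sqrt (a * b) * expR (- (ln (a / b)) / 2) = b /\
  Num.sqrt (a * b) * expR (ln (a / b) / 2) = a.
Proof.
have key (u v : R) : 0 < u -> 0 < v -> Num.sqrt (u * v) * expR (ln (u / v) / 2) = u.
  move=> u0 v0; have uv : 0 < u * v by exact: mulr_gt0.
  have h : (Num.sqrt (u * v) * expR (ln (u / v) / 2)) ^+ 2 = u ^+ 2.
    rewrite exprMn sqr_sqrtr ?ltW // -expRM_natl [2 * _]mulrC divfK // lnK ?posrE ?divr_gt0 //.
    by field; exact: lt0r_neq0.
  apply/eqP; rewrite -(@eqrXn2 _ 2) ?h ?eqxx //; exact: ltW.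
move=> a0 b0; split; last exact: key.
rewrite (mulrC a) -lnV ?posrE ?divr_gt0 // invf_div; exact: key.
Qed.

(** This is [ln t <= t - 1] at [t = mu b / a]. *)
Lemma ln_ratio_ge (a b mu : R) : 0 < a -> 0 < b -> 0 < mu ->
  a * b * (ln mu + 1) - mu * b ^+ 2 <= a * b * ln (a / b).
Proof.
move=> a0 b0 mu0.
have r0 : 0 < mu * (b / a) by rewrite mulr_gt0 // divr_gt0.
have h := le_ln1Dx (_ : -1 < mu * (b / a) - 1).
have {h} := h ltac:(by rewrite ltrBrDl subrr).
rewrite addrC subrK lnM ?posrE ?divr_gt0 // => h.
have e : ln (b / a) = - ln (a / b) by rewrite -lnV ?posrE ?divr_gt0 // invf_div.
rewrite e in h.
have -> : mu * b ^+ 2 = a * b * (mu * (b / a)) by field; exact: lt0r_neq0.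
by rewrite -mulrBr ler_pM2l ?mulr_gt0 //; lra.
Qed.

Section lower_bound.
Variables (e : R) (m : nat) (a b : nat -> R) (p q : nat -> nat).
Hypothesis gp : good_pair N e m a b.
Hypotheses (pq : cancel p q) (qp : cancel q p).

Let a' n := a (q n).
Let b' n := b (q n).
Let P n := a' n * b' n.
Let lam n := ln (a' n / b' n).

Let bq : bijective q. Proof. by exists p. Qed.
Let a0 n : 0 <= a' n. Proof. exact: good_a_ge0 gp _. Qed.
Let b0 n : 0 <= b' n. Proof. exact: good_b_ge0 gp _. Qed.

Let pos n : P n != 0 -> 0 < a' n /\ 0 < b' n.
Proof. by rewrite mulf_eq0 negb_or !lt_neqAle a0 b0 !andbT !(eq_sym 0) => /andP[]. Qed.

(** Along the boundary of the strip the modulus of this function is [b'] on one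
    side and [a'] on the other, off the zeros of the product [P]; its logarithmic
    derivative is the logarithm of their ratio. *)
Definition interpolant n (z : R[i]) : R[i] :=
  if P n == 0 then 0
  else (Num.sqrt (P n))%:C * cexp ((lam n)%:C * (z - half)).

(** On the boundary lines the interpolant differs from [b'] and [a'] by
    unimodular factors only. *)
Let phase n (s : R) : R[i] := if P n == 0 then 0 else cexp (0 +i* s).

Let phase_multiplier (s : nat -> R) : multiplier 1 (fun n => phase n (s n)).
Proof.
split=> // n; rewrite /phase; case: eqP => _; first by left; rewrite normc0.
by right; rewrite normc_cexp expR0.
Qed.

Lemma interpolant_left s :
  (fun n => interpolant n (0 +i* s)) = act (fun n => phase n (lam n * s)) (emb b').
Proof.
apply/funext => n; rewrite /interpolant /act /phase /emb; case: eqVneq => [_|Pn]; first by rewrite mul0r.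
have [an bn] := pos Pn.
have -> : (lam n)%:C * ((0 +i* s) - half) = (- lam n / 2)%:C + (0 +i* (lam n * s)).
  by apply/eqP; rewrite eq_complex /=; apply/andP; split; apply/eqP; field.
rewrite cexpD mulrA [RHS]mulrC; congr (_ * _).
rewrite {1}/cexp /= cos0 sin0 -(sqrt_ratio an bn).1.
by apply/eqP; rewrite eq_complex /=; apply/andP; split; apply/eqP; rewrite /lam /P; ring.
Qed.

Lemma interpolant_right s :
  (fun n => interpolant n (1 +i* s)) = act (fun n => phase n (lam n * s)) (emb a').
Proof.
apply/funext => n; rewrite /interpolant /act /phase /emb; case: eqVneq => [_|Pn]; first by rewrite mul0r.
have [an bn] := pos Pn.
have -> : (lam n)%:C * ((1 +i* s) - half) = (lam n / 2)%:C + (0 +i* (lam n * s)).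
  by apply/eqP; rewrite eq_complex /=; apply/andP; split; apply/eqP; field.
rewrite cexpD mulrA [RHS]mulrC; congr (_ * _).
rewrite {1}/cexp /= cos0 sin0 -(sqrt_ratio an bn).2.
by apply/eqP; rewrite eq_complex /=; apply/andP; split; apply/eqP; rewrite /lam /P; ring.
Qed.

Lemma interpolant_cderiv n z : has_cderiv (interpolant n) z ((lam n)%:C * interpolant n z).
Proof.
rewrite /interpolant; case: eqVneq => [_|Pn].
  by rewrite mulr0; exact: has_cderiv_cst.
have := has_cderivM (has_cderiv_cst (Num.sqrt (P n))%:C z) (has_cderiv_cexp (lam n)%:C half z).
by rewrite mulr0 addr0 mulrCA.
Qed.

Lemma interpolant_bounded n : exists B : R, forall z, strip z -> normc (interpolant n z) <= B.
Proof.
exists (Num.sqrt (P n) * expR `|lam n|) => -[x y] /andP[/= x0 x1]; rewrite /interpolant.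
case: eqP => _; first by rewrite normc0 mulr_ge0 ?sqrtr_ge0 ?expR_ge0.
rewrite normcM normc_real ger0_norm ?sqrtr_ge0 // ler_wpM2l ?sqrtr_ge0 //.
rewrite normc_cexp ler_expR /= mul0r subr0.
apply: le_trans (ler_norm _) _; rewrite normrM ler_piMr //.
by rewrite ler_norml; apply/andP; split; lra.
Qed.

Lemma interpolant_half n : interpolant n half = (Num.sqrt (P n))%:C.
Proof.
rewrite /interpolant; case: eqVneq => [->|_]; first by rewrite sqrtr0.
by rewrite subrr mulr0 cexp0 mulr1.
Qed.

(** The pairing of [F] with the interpolant is bounded by [K] on the boundary of
    the strip, and its derivative at [1/2] is the entropy-like sum. *)
Lemma entropy_le (K : R) M : (forall n, (M <= n)%N -> P n = 0) ->
  (DN (0%R : omega R, emb (fun n => Num.sqrt (P n))) < K%:E)%E ->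
  \sum_(n < M) P n * lam n <= 10 * (K + 1).
Proof.
move=> PM /ereal_inf_lt [_ [F [hF Fy Fx] <-] FK]; rewrite /= in Fy Fx.
have FL (s : R) : (NX (F (Complex 0%R s)) <= K%:E)%E.
  apply: le_trans (ltW FK); rewrite /calF_norm le_max; apply/orP; left.
  by apply: ereal_sup_ubound; exists s.
have FR (s : R) : (dual_norm NX (F (Complex 1%R s)) <= K%:E)%E.
  apply: le_trans (ltW FK); rewrite /calF_norm le_max; apply/orP; right.
  by apply: ereal_sup_ubound; exists s.
have [Bb Sa] := good_pair_perm bq gp.
pose h (z : R[i]) := \sum_(n < M) F z n * interpolant n z.
have iM n z : (M <= n)%N -> interpolant n z = 0.
  by move=> Mn; rewrite /interpolant PM // eqxx.
have hE z : h z = pairing (F z) (fun n => interpolant n z).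
  by rewrite (@pairing_finite _ _ _ M) // => n Mn; rewrite iM ?mulr0.
pose S := \sum_(n < M) P n * lam n.
have hF' z : open_strip z -> has_cderiv h z
    (\sum_(n < M) (F z n * ((lam n)%:C * interpolant n z) +
      interpolant n z * derive1 (fun w : R[i]^o => F w n) z)).
  move=> sz; rewrite /h; elim: (M) => [|k IH].
    rewrite big_ord0; have -> : (fun w => \sum_(n < 0) F w n * interpolant n w) = (fun=> 0).
      by apply/funext => w; rewrite big_ord0.
    exact: has_cderiv_cst.
  have -> : (fun w => \sum_(n < k.+1) F w n * interpolant n w) =
      (fun w => \sum_(n < k) F w n * interpolant n w + F w k * interpolant k w).
    by apply/funext => w; rewrite big_ord_recr.
  rewrite big_ord_recr /=; apply: has_cderivD IH _.
  exact: has_cderivM (derivable_has_cderiv (@calF_analytic _ _ _ hF k z sz)) (interpolant_cderiv k z).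
have dh : has_cderiv h half S%:C.
  have sh : open_strip half by rewrite -halfE; exact: open_strip_half.
  apply: (has_cderiv_eq (hF' _ sh)); rewrite /S rmorph_sum; apply: eq_bigr => n _.
  rewrite -halfE Fx mulr0 addr0 Fy halfE interpolant_half /emb /=.
  by rewrite -!rmorphM mulrCA -expr2 sqr_sqrtr ?mulr_ge0 // mulrC.
have := @strip_derivative_bound R h S%:C K _ _ _ dh.
rewrite normc_real => H; apply: le_trans (ler_norm _) _; apply: H.
- have bF n : exists B : R, forall z, strip z -> normc (F z n * interpolant n z) <= B.
    have [B1 h1] := calF_bounded hF n; have [B2 h2] := interpolant_bounded n.
    exists (B1 * B2) => z sz; rewrite normcM.
    by apply: ler_pM; rewrite ?normc_ge0 ?h1 ?h2.
  exists (\sum_(n < M) sval (cid (bF n))) => z sz.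
  apply: le_trans (normc_sum _) _; apply: ler_sum => n _.
  by case: (cid (bF n)) => B hB /=; exact: hB.
- apply: (@within_continuous_sum _ M (fun n z => F z n * interpolant n z)) => n.
  apply: (@within_continuousM _ (fun z => F z n) (interpolant n)).
    have h0 := @calF_continuous _ _ _ hF n; exact: h0.
  apply: continuous_subspaceT => z.
  have /has_cderiv_is_derive [di _] := interpolant_cderiv n z.
  by apply: differentiable_continuous; apply/derivable1_diffP.
- by move=> z sz; eexists; exact: hF'.
- move=> s; split.
    rewrite hE interpolant_left -lee_fin; apply: le_trans (FL s).
    apply: pairing_le_NX => //; exact: symmetric_ball_act.
  rewrite hE pairingC interpolant_right -lee_fin; apply: le_trans (FR s).
  have ca : c00 (emb a').
    exact: (@c00_perm _ q (emb a) bq (c00_emb (good_a_high gp))).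
  apply: dual_norm_ge; first exact: c00_act.
  apply: le_trans (NX_act hN _ (phase_multiplier _)) _; rewrite mul1e.
  exact: le_trans (NX_le_sv hN ca) Sa.
Qed.

Lemma entropy_ge (mu : R) M : (forall n, (M <= n)%N -> a' n = 0 /\ b' n = 0) ->
  0 < mu -> 0 <= ln mu + 1 ->
  (ln mu + 1) / 2 - mu * e <= \sum_(n < M) P n * lam n.
Proof.
move=> hM mu0 lmu.
have h : \sum_(n < M) (P n * (ln mu + 1) - mu * b' n ^+ 2) <= \sum_(n < M) P n * lam n.
  apply: ler_sum => n _; have [Pn|Pn] := eqVneq (P n) 0.
    by rewrite Pn !mul0r sub0r oppr_le0 mulr_ge0 ?sqr_ge0 ?ltW.
  by have [? ?] := pos Pn; exact: ln_ratio_ge.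
apply: le_trans h; rewrite sumrB -mulr_suml -mulr_sumr.
have -> : \sum_(n < M) P n = \sum_(n < m) a n * b n.
  apply: (@sum_perm M m (fun n => a n * b n) q) => //.
    by move=> i mi; rewrite (good_a_high gp) // mul0r.
  by move=> i Mi; have [ai _] := hM i Mi; rewrite -/(a' i) ai mul0r.
have -> : \sum_(n < M) b' n ^+ 2 = \sum_(n < m) b n ^+ 2.
  apply: (@sum_perm M m (fun n => b n ^+ 2) q) => //.
    by move=> i mi; rewrite (good_b_high gp) // expr0n.
  by move=> i Mi; have [_ bi] := hM i Mi; rewrite -/(b' i) bi expr0n.
apply: lerB.
  by rewrite mulrC ler_wpM2r //; have := good_pairing gp; lra.
by rewrite ler_pM2l //; exact: good_b_small gp.
Qed.

End lower_bound.

(** With [mu] the inverse of the smallness [e] of the pair, [entropy_ge] gives at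
    least [(ln mu + 1) / 2 - 1], which exceeds the bound of [entropy_le] for the
    chosen [mu].  The permutation is universally quantified, after the choice of
    [x], so that the applications can prescribe the coordinates. *)
Lemma derived_norm_unbounded (K : R) : 0 <= K -> exists m (x : nat -> R),
  [/\ forall n, (m <= n)%N -> x n = 0, \sum_(n < m) x n ^+ 2 <= 1 &
   forall p q, cancel p q -> cancel q p ->
     ~ (DN (0%R : omega R, emb (fun n => x (q n))) < K%:E)%E].
Proof.
move=> K0; pose mu : R := expR (20 * K + 22).
have mu0 : 0 < mu by exact: expR_gt0.
have [|m [a [b gp]]] := @good_pair_exists _ N hN (mu^-1); first by rewrite invr_gt0.
exists m, (fun n => Num.sqrt (a n * b n)); split.
- by move=> n mn; rewrite (good_a_high gp) // mul0r sqrtr0.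
- have -> : \sum_(n < m) Num.sqrt (a n * b n) ^+ 2 = \sum_(n < m) a n * b n.
    apply: eq_bigr => n _; rewrite sqr_sqrtr // mulr_ge0 //.
      exact: good_a_ge0 gp n.
    exact: good_b_ge0 gp n.
  rewrite -lee_fin; apply: le_trans (good_a_ball gp).
  apply: le_trans (sv_ge _ (good_b_ball gp)); rewrite lee_fin.
  rewrite (@pairing_finite _ _ _ m) => [|n mn]; last first.
    by rewrite /emb (good_a_high gp) // mul0r.
  have -> : \sum_(i < m) emb a i * emb b i = (\sum_(i < m) a i * b i)%:C.
    by rewrite rmorph_sum; apply: eq_bigr => i _; rewrite rmorphM.
  by rewrite normc_real ler_norm.
- move=> p q pq qp lt.
  have bq : bijective q by exists p.
  pose M := (\max_(i < m) p i).+1.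
  have qM n : (M <= n)%N -> (m <= q n)%N.
    move=> Mn; rewrite leqNgt; apply/negP => qn.
    have := leq_bigmax (F := fun i : 'I_m => p i) (Ordinal qn); rewrite /= qp => h.
    by have := leq_trans Mn h; rewrite ltnn.
  have up := entropy_le gp pq qp (M := M) _ lt.
  have dn := @entropy_ge _ _ _ _ p q gp pq qp mu M _ mu0.
  have lmu : ln mu = 20 * K + 22 by rewrite expRK.
  have {}up := up ltac:(by move=> n /qM h; rewrite (good_a_high gp) ?mul0r).
  have {}dn := dn ltac:(by move=> n /qM h; rewrite (good_a_high gp) ?(good_b_high gp)).
  have := dn ltac:(rewrite lmu; lra); move/le_trans => /(_ _ up).
  rewrite mulfV ?lt0r_neq0 // lmu; lra.
Qed.

End derived_space.

(** * Flat vectors in kernels, and signs in Hilbert space *)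

Section elimination.
Variable R : realType.
Implicit Types (g : nat -> nat -> R[i]) (S D : seq nat).

Fixpoint pivot_bound (k : nat) : nat :=
  if k is j.+1 then (1 + j.+1 * pivot_bound j)%N else 1%N.

(** Gaussian elimination on the rows [g j]: choosing as pivot the row with the
    largest entry keeps all the multipliers in the unit disc, so that the coefficients
    stay bounded in terms of [k] alone, whatever the size of [S]. *)
Lemma pivot k g S : exists D (c : nat -> nat -> R[i]),
  [/\ {subset D <= S}, uniq D, (size D <= k)%N &
   forall j, j \in S -> j \notin D ->
     (forall i, (i < k)%N -> g j i = \sum_(l <- D) c j l * g l i) /\
     (forall l, normc (c j l) <= (pivot_bound k)%:R)].
Proof.
elim: k g S => [|k IH] g S.
  by exists [::], (fun _ _ => 0); split => // j _ _; split => // l; rewrite normc0.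
have [[s sS smax]|none] : (exists2 s, s \in S & g s k != 0 /\
    forall j, j \in S -> normc (g j k) <= normc (g s k)) \/
    (forall j, j \in S -> g j k = 0).
  clear IH; elim: S => [|a S [[s sS [s0 smax]]|none]]; first by right.
    left; have [h|h] := leP (normc (g a k)) (normc (g s k)).
      exists s; first by rewrite inE sS orbT.
      by split => // j; rewrite inE => /orP[/eqP ->|] //; exact: smax.
    exists a; first by rewrite inE eqxx.
    split.
      by apply/negP => /eqP e; move: h; rewrite e normc0 ltNge normc_ge0.
    move=> j; rewrite inE => /orP[/eqP ->|jS] //.
    exact: le_trans (smax _ jS) (ltW h).
  have [a0|a0] := eqVneq (g a k) 0.
    by right => j; rewrite inE => /orP[/eqP ->|] //; exact: none.
  left; exists a; first by rewrite inE eqxx.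
  split => // j; rewrite inE => /orP[/eqP ->|jS] //.
  by rewrite none // normc0 normc_ge0.
- have [s0 {}smax] := smax.
  pose rho j := g j k / g s k.
  have rho1 j : j \in S -> normc (rho j) <= 1.
    move=> jS; rewrite /rho normcM normcV ler_pdivrMr ?mul1r ?smax //.
    by rewrite lt_def normc_ge0 andbT; apply: contra s0 => /eqP /normc_eq0P ->.
  have [D [c [DS uD sD hD]]] := IH (fun j i => g j i - rho j * g s i) [seq j <- S | j != s].
  have DS' l : l \in D -> l \in S /\ l != s.
    by move=> /DS; rewrite mem_filter => /andP[-> ->].
  exists (s :: D), (fun j l => if l == s then rho j - \sum_(l <- D) c j l * rho l else c j l).
  split => //=.
  + by move=> l; rewrite inE => /orP[/eqP ->|/DS' []].
  + by rewrite uD andbT; apply/negP => /DS' []; rewrite eqxx.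
  + move=> j jS; rewrite inE negb_or => /andP[js jD].
    have [|h1 h2] := hD j _ jD; first by rewrite mem_filter js.
    have sumE (F : nat -> R[i]) : \sum_(l <- D) (if l == s then
        rho j - \sum_(l <- D) c j l * rho l else c j l) * F l = \sum_(l <- D) c j l * F l.
      rewrite big_seq [RHS]big_seq; apply: eq_bigr => l /DS' [_ ls].
      by rewrite (negbTE ls).
    split.
      move=> i; rewrite ltnS => ik.
      rewrite big_cons eqxx sumE mulrBl mulr_suml -addrA [X in _ + X]addrC -sumrB.
      have rE : \sum_(l <- D) (c j l * g l i - c j l * rho l * g s i) =
          \sum_(l <- D) c j l * (g l i - rho l * g s i).
        by apply: eq_bigr => l _; ring.
      rewrite rE; case: (ltngtP i k) ik => // [ik _|-> _].
        by rewrite -(h1 i ik) addrC subrK.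
      have z l : g l k - rho l * g s k = 0 by rewrite /rho divfK // subrr.
      rewrite big1 ?addr0; first by rewrite /rho divfK.
      by move=> l _; rewrite z mulr0.
    have mono : ((pivot_bound k)%:R : R) <= (1 + k.+1 * pivot_bound k)%:R.
      by rewrite ler_nat addnC -[X in (X <= _)%N]addn0 leq_add // leq_pmull.
    move=> l; case: ifP => _; last exact: le_trans (h2 l) mono.
    apply: le_trans (le_normcD _ _) _; rewrite normcN natrD lerD ?rho1 //.
    have : normc (\sum_(l <- D) c j l * rho l) <= \sum_(l <- D) (pivot_bound k)%:R.
      have : {subset D <= S} by move=> l' /DS' [].
      elim: (D) => [|l' D' IHD] sub; first by rewrite !big_nil normc0.
      rewrite !big_cons; apply: le_trans (le_normcD _ _) _; apply: lerD.
        rewrite normcM; apply: le_trans (h2 l'); rewrite ler_piMr ?normc_ge0 //.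
        by apply: rho1; apply: sub; rewrite inE eqxx.
      by apply: IHD => l'' hl; apply: sub; rewrite inE hl orbT.
    move/le_trans; apply.
    rewrite big_const_seq count_predT iter_addr addr0 natrM -[leLHS]mulr_natl.
    rewrite ler_wpM2r // ler_nat; exact: leq_trans sD (leqnSn _).
- have [D [c [DS uD sD hD]]] := IH g S.
  exists D, c; split => //; first exact: leq_trans sD (leqnSn _).
  move=> j jS jD; have [h1 h2] := hD j jS jD; split.
    move=> i; rewrite ltnS leq_eqVlt => /orP[/eqP ->|]; last exact: h1.
    rewrite none // big_seq big1 // => l lD.
    by rewrite (none l) ?mulr0 // DS.
  move=> l; apply: le_trans (h2 l) _.
  by rewrite ler_nat /= addnC -[X in (X <= _)%N]addn0 leq_add // leq_pmull.
Qed.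

(** Cell, of side [1 / q], of a grid on the square of half-side [B]; the shift by
    [B] makes the arguments of [Num.truncn] nonnegative. *)
Definition cell (B q : nat) (z : R[i]) : 'I_(2 * B * q).+1 * 'I_(2 * B * q).+1 :=
  (inord (Num.truncn ((complex.Re z + B%:R) * q%:R)),
   inord (Num.truncn ((complex.Im z + B%:R) * q%:R))).

Lemma truncn_cell (B q : nat) (u v : R) : (0 < q)%N -> `|u| <= B%:R -> `|v| <= B%:R ->
  (inord (Num.truncn ((u + B%:R) * q%:R)) : 'I_(2 * B * q).+1) =
  inord (Num.truncn ((v + B%:R) * q%:R)) -> `|u - v| <= q%:R^-1.
Proof.
move=> q0 uB vB.
have q0' : 0 < q%:R :> R by rewrite ltr0n.
have rng (t : R) : `|t| <= B%:R -> 0 <= (t + B%:R) * q%:R <= (2 * B * q)%:R.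
  rewrite ler_norml => /andP[t1 t2]; apply/andP; split.
    by rewrite mulr_ge0 //; lra.
  by rewrite natrM ler_pM2r // natrM; lra.
have small (t : R) : `|t| <= B%:R -> (Num.truncn ((t + B%:R) * q%:R) < (2 * B * q).+1)%N.
  move=> /rng /andP[h1 h2]; rewrite ltnS -(ler_nat R).
  by apply: le_trans h2; rewrite truncn_le.
move=> /(congr1 val); rewrite /= !inordK ?small // => e.
have /andP[u1 u2] := rng _ uB; have /andP[v1 v2] := rng _ vB.
have := truncn_itv u1; have := truncn_itv v1; rewrite e.
set n := Num.truncn _ => /andP[a1 a2] /andP[b1 b2].
rewrite -[X in X <= _](mulfK (lt0r_neq0 q0')) -[leRHS]mul1r ler_pM2r ?invr_gt0 //.
rewrite -{1}(gtr0_norm q0') -normrM ler_norml; move: a1 a2 b1 b2.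
rewrite -natr1; move: (n%:R) (q%:R) (B%:R) => *; apply/andP; split; nra.
Qed.

Lemma cell_close (B q : nat) (z w : R[i]) : (0 < q)%N ->
  normc z <= B%:R -> normc w <= B%:R -> cell B q z = cell B q w ->
  normc (z - w) <= 2 / q%:R.
Proof.
move=> q0 zB wB [e1 e2]; apply: le_trans (normc_le_ReIm _) _.
rewrite ReB ImB mulr2n mulrDl mul1r; apply: lerD.
  by apply: truncn_cell e1 => //; [exact: le_trans (Re_le_normc _) zB | exact: le_trans (Re_le_normc _) wB].
by apply: truncn_cell e2 => //; [exact: le_trans (Im_le_normc _) zB | exact: le_trans (Im_le_normc _) wB].
Qed.

(** Take many indices and express the rows [g j] through at most [k] of them, with
    coefficients in a region that depends on [k] alone.  By the pigeonhole
    principle two rows have coefficients that agree up to [1 / (k + 1)]; their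
    difference corrected by the pivot rows lies in the kernel, and its [l_1] norm
    is at most [1 + 1 + k / (k + 1)]. *)
Lemma flat_kernel_vector k g lo : exists a hi (d : nat -> R[i]),
  [/\ (lo <= a < hi)%N, d a = 1, forall n, ~~ (lo <= n < hi)%N -> d n = 0,
   \sum_(n < hi) normc (d n) <= 3 &
   forall i, (i < k)%N -> \sum_(n < hi) d n * g n i = 0].
Proof.
pose B := pivot_bound k; pose q := (2 * k.+1)%N.
have q0 : (0 < q)%N by [].
pose T := {ffun 'I_k -> 'I_(2 * B * q).+1 * 'I_(2 * B * q).+1}.
have [M ME] : exists M, M = (#|{: T}| + k).+1 by eexists.
have [D [c [DS uD sD hD]]] := pivot k g (iota lo M).
pose S' := [seq j <- iota lo M | j \notin D].
pose f j : T := [ffun i : 'I_k => cell B q (c j (nth 0 D i))].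
have sz : (#|{: T}| < size S')%N.
  have e : (count (fun j => j \in D) (iota lo M) +
      count (fun j => j \notin D) (iota lo M))%N = M.
    by rewrite -[RHS](size_iota lo M); exact: count_predC.
  have cD : (count (fun j => j \in D) (iota lo M) <= k)%N.
    rewrite -size_filter; apply: leq_trans sD.
    apply: uniq_leq_size; first by rewrite filter_uniq // iota_uniq.
    by move=> j; rewrite mem_filter => /andP[].
  rewrite /S' size_filter -(ltn_add2l (count (fun j => j \in D) (iota lo M))) e.
  by apply: (@leq_ltn_trans (k + #|{: T}|)%N); [rewrite leq_add2r | rewrite ME addnC].
have [a [b [aS bS ab fab]]] : exists a b, [/\ a \in S', b \in S', a != b & f a = f b].
  apply: contrapT => no.
  have inj : {in S' &, injective f}.
    move=> a b aS bS e; apply/eqP; rewrite -[_ == _]negbK; apply/negP => ab.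
    by apply: no; exists a, b.
  have us : uniq (map f S') by rewrite (map_inj_in_uniq inj) filter_uniq // iota_uniq.
  have := max_card (mem (map f S')); rewrite (card_uniqP us) size_map.
  by rewrite leqNgt sz.
have mS j : j \in S' -> j \in iota lo M /\ j \notin D by rewrite mem_filter => /andP[].
have [aI aD] := mS _ aS; have [bI bD] := mS _ bS.
have [ha hca] := hD a aI aD; have [hb hcb] := hD b bI bD.
have close l : l \in D -> normc (c a l - c b l) <= k.+1%:R^-1.
  move=> lD; have lk : (index l D < k)%N by apply: leq_trans sD; rewrite index_mem.
  have /ffunP/(_ (Ordinal lk)) := fab.
  rewrite !ffunE /= nth_index // => e.
  apply: le_trans (cell_close q0 (hca l) (hcb l) e) _.
  by rewrite /q natrM invfM mulrA divff // mul1r.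
pose d n : R[i] := (n == a)%:R - (n == b)%:R - (if n \in D then c a n - c b n else 0).
have hi_a : (a < lo + M)%N by move: aI; rewrite mem_iota => /andP[].
have hi_b : (b < lo + M)%N by move: bI; rewrite mem_iota => /andP[].
have hi_D l : l \in D -> (l < lo + M)%N by move=> /DS; rewrite mem_iota => /andP[].
have sumD (F : nat -> R[i]) : \sum_(n < lo + M) (if (n : nat) \in D then F n else 0) = \sum_(l <- D) F l.
  rewrite -(big_mkord xpredT (fun n => if n \in D then F n else 0)) /index_iota subn0.
  rewrite -big_mkcond /= -big_filter; apply: perm_big; apply: uniq_perm => //.
    by rewrite filter_uniq // iota_uniq.
  move=> l; rewrite mem_filter mem_iota add0n /=.
  by case: (boolP (l \in D)) => // /hi_D ->.
have sum1 s (F : nat -> R[i]) : (s < lo + M)%N -> \sum_(n < lo + M) (n == s :> nat)%:R * F n = F s.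
  move=> sM; rewrite (bigD1 (Ordinal sM)) //= eqxx mul1r big1 ?addr0 // => i.
  by rewrite -val_eqE /= => /negbTE ->; rewrite mul0r.
exists a, (lo + M)%N, d; split.
- by move: aI; rewrite mem_iota.
- by rewrite /d eqxx (negbTE ab) (negbTE aD) !subr0.
- move=> n nI; have : n \notin iota lo M by rewrite mem_iota.
  move=> nI'.
  have na : (n == a) = false by apply: contraNF nI' => /eqP ->.
  have nb : (n == b) = false by apply: contraNF nI' => /eqP ->.
  have nD : (n \in D) = false by apply: contraNF nI' => /DS.
  by rewrite /d na nb nD !subr0.
- have bnd n : normc (d n) <= (n == a)%:R + (n == b)%:R + (if n \in D then k.+1%:R^-1 else 0).
    apply: le_trans (le_normcD _ _) _; rewrite normcN; apply: lerD; last first.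
      by case: ifP => [/close|_] //; rewrite normc0.
    apply: le_trans (le_normcD _ _) _; rewrite normcN; apply: lerD.
      by case: (n == a); rewrite ?normc1 ?normc0.
    by case: (n == b); rewrite ?normc1 ?normc0.
  apply: (@le_trans _ _ (\sum_(n < lo + M) ((n == a :> nat)%:R + (n == b :> nat)%:R +
      (if (n : nat) \in D then k.+1%:R^-1 else 0)))).
    by apply: ler_sum => n _; exact: bnd.
  rewrite !big_split /=.
  have one s : (s < lo + M)%N -> \sum_(n < lo + M) (n == s :> nat)%:R = 1 :> R.
    move=> sM; rewrite (bigD1 (Ordinal sM)) //= eqxx big1 ?addr0 // => i.
    by rewrite -val_eqE /= => /negbTE ->.
  rewrite !one //.
  have -> : \sum_(n < lo + M) (if (n : nat) \in D then k.+1%:R^-1 else 0) = (size D)%:R / k.+1%:R :> R.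
    rewrite -(big_mkord xpredT (fun n => if n \in D then k.+1%:R^-1 else 0)) /index_iota subn0.
    rewrite -big_mkcond /= -big_filter.
    rewrite (perm_big D) /=; last first.
      apply: uniq_perm => //; first by rewrite filter_uniq // iota_uniq.
      move=> l; rewrite mem_filter mem_iota add0n /=.
      by case: (boolP (l \in D)) => // /hi_D ->.
    by rewrite big_const_seq count_predT iter_addr addr0 -[LHS]mulr_natl.
  have : (size D)%:R / k.+1%:R <= 1 :> R.
    by rewrite ler_pdivrMr // mul1r ler_nat (leq_trans sD).
  by move: (_ / _) => y; lra.
- move=> i ik.
  have -> : \sum_(n < lo + M) d n * g n i = \sum_(n < lo + M) (n == a :> nat)%:R * g n i
     - \sum_(n < lo + M) (n == b :> nat)%:R * g n i
     - \sum_(n < lo + M) (if (n : nat) \in D then (c a n - c b n) * g n i else 0).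
    rewrite -!sumrB; apply: eq_bigr => n _; rewrite /d 2!mulrBl; congr (_ - _).
    by case: ifP => // _; rewrite mul0r.
  rewrite (sum1 a (g^~ i)) // (sum1 b (g^~ i)) // (sumD (fun n => (c a n - c b n) * g n i)).
  under [X in _ - X]eq_bigr => l _ do rewrite mulrBl.
  by rewrite sumrB -ha // -hb // subrr.
Qed.

End elimination.

Section signs.
Variable R : realType.

Lemma l2norm_sqr n (u : 'rV[R[i]]_n) : l2norm u ^+ 2 = \sum_(i < n) normc (u ord0 i) ^+ 2.
Proof. by rewrite /l2norm sqr_sqrtr // sumr_ge0 // => i _; exact: sqr_ge0. Qed.

Lemma l2norm_ge0 n (u : 'rV[R[i]]_n) : 0 <= l2norm u.
Proof. exact: sqrtr_ge0. Qed.

Lemma l2norm_parallelogram n (u v : 'rV[R[i]]_n) :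
  l2norm (u + v) ^+ 2 + l2norm (u - v) ^+ 2 = 2 * l2norm u ^+ 2 + 2 * l2norm v ^+ 2.
Proof.
rewrite !l2norm_sqr !mulr_sumr -!big_split /=; apply: eq_bigr => i _.
rewrite !mxE; case: (u _ _) (v _ _) => a b [c d].
by rewrite !sqr_normc /=; ring.
Qed.

Lemma l2normZ n (c : R) (u : 'rV[R[i]]_n) : l2norm (c%:C *: u) = `|c| * l2norm u.
Proof.
rewrite /l2norm -sqrtr_sqr -sqrtrM ?sqr_ge0 // mulr_sumr; congr Num.sqrt.
by apply: eq_bigr => i _; rewrite mxE normcM exprMn normc_real real_normK ?num_real.
Qed.

Lemma l2norm_eq0 n (u : 'rV[R[i]]_n) : l2norm u = 0 -> u = 0.
Proof.
move=> h; have : l2norm u ^+ 2 = 0 by rewrite h expr0n.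
rewrite l2norm_sqr => /eqP; rewrite psumr_eq0 => [|i _]; last exact: sqr_ge0.
move=> /allP H; apply/rowP => i; rewrite mxE; apply: eq0_normc.
by have := H i (mem_index_enum _); rewrite sqrf_eq0 => /eqP; rewrite (ord1 0).
Qed.

(** Hilbert spaces have type 2: by the parallelogram law, one of the two signs of
    each new vector does at least as well as their average. *)
Lemma sign_choice n (t : nat -> 'rV[R[i]]_n) m : exists s : nat -> bool,
  l2norm (\sum_(j < m) ((-1) ^+ s j : R)%:C *: t j) ^+ 2 <= \sum_(j < m) l2norm (t j) ^+ 2.
Proof.
elim: m => [|m [s hs]].
  exists (fun=> false); rewrite !big_ord0 l2norm_sqr big1 // => i _.
  by rewrite mxE normc0 expr0n.
pose s' b j := if j == m then b else s j.
have sE b : \sum_(j < m) ((-1) ^+ s' b j : R)%:C *: t j = \sum_(j < m) ((-1) ^+ s j : R)%:C *: t j.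
  by apply: eq_bigr => j _; rewrite /s' ltn_eqF.
set u := \sum_(j < m) _ in hs sE.
have p := l2norm_parallelogram u (t m).
have [h|h] := leP (l2norm (u + t m) ^+ 2) (l2norm u ^+ 2 + l2norm (t m) ^+ 2).
  exists (s' false); rewrite !big_ord_recr /= sE /s' eqxx expr0 scale1r.
  by apply: le_trans h _; rewrite lerD2r.
exists (s' true); rewrite !big_ord_recr /= sE /s' eqxx expr1 rmorphN scaleN1r.
apply: (@le_trans _ _ (l2norm u ^+ 2 + l2norm (t m) ^+ 2)); last by rewrite lerD2r.
lra.
Qed.

End signs.

(** * The two properties *)

Section injections.

Definition swap (a b n : nat) : nat := if n == a then b else if n == b then a else n.

Lemma swapK a b : involutive (swap a b).
Proof.
move=> n; rewrite /swap.
have [->|na] := eqVneq n a.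
  by case: (eqVneq b a) => [->|_]; rewrite ?eqxx.
have [->|nb] := eqVneq n b; first by rewrite eqxx.
by rewrite (negbTE na) (negbTE nb).
Qed.

(** The permutations of [derived_norm_unbounded] act on all of [nat], whereas the
    applications place only finitely many coordinates. *)
Lemma extend_injection m (s : nat -> nat) :
  (forall i j, (i < m)%N -> (j < m)%N -> s i = s j -> i = j) ->
  exists p q, [/\ cancel p q, cancel q p & forall j, (j < m)%N -> p j = s j].
Proof.
elim: m => [|m IH] inj; first by exists id, id.
have [|p [q [pq qp ps]]] := IH.
  by move=> i j im jm; apply: inj; exact: leqW.
pose w := swap (p m) (s m).
exists (w \o p), (q \o w); split.
- by move=> n; rewrite /= /w swapK pq.
- by move=> n; rewrite /= qp /w swapK.
- move=> j; rewrite ltnS leq_eqVlt => /orP[/eqP ->|jm]; rewrite /= /w /swap.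
    by rewrite eqxx.
  have -> : (p j == p m) = false.
    by apply/negbTE/eqP => /(can_inj pq) e; move: jm; rewrite e ltnn.
  rewrite ps //; case: eqP => // e.
  by have := inj _ _ (leqW jm) (ltnSn m) e => e'; move: jm; rewrite e' ltnn.
Qed.

End injections.

Section main.
Variables (R : realType) (N : omega R -> R).
Hypothesis hN : is_tsirelson_norm N.

Local Notation NX := (Ts2_norm N).
Local Notation DN := (derived_norm NX).
Local Notation V := (omega R * omega R)%type.

Definition second (y : omega R) : V := (0%R, y).

Lemma second_is_linear (a : R[i]) (x y : omega R) :
  second (a *: x + y) = a *: second x + second y.
Proof. by rewrite /second; congr pair; rewrite /= scaler0 addr0. Qed.

Lemma secondD (x y : omega R) : second (x + y) = second x + second y.
Proof. by rewrite -[x]scale1r second_is_linear !scale1r. Qed.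

Lemma second_sum n (c : nat -> R[i]) (f : nat -> omega R) :
  \sum_(j < n) c j *: second (f j) = second (\sum_(j < n) c j *: f j).
Proof.
elim: n => [|n IH]; first by rewrite !big_ord0.
by rewrite !big_ord_recr /= IH addrC -second_is_linear addrC.
Qed.

Lemma omega_sumE n (c : nat -> R[i]) (f : nat -> omega R) k :
  (\sum_(j < n) c j *: f j) k = \sum_(j < n) c j * f j k.
Proof.
elim: n => [|n IH]; first by rewrite !big_ord0.
by rewrite !big_ord_recr /= omegaDE IH.
Qed.

Lemma sum_units n (c : nat -> R[i]) (p q : nat -> nat) k : cancel p q -> cancel q p ->
  (\sum_(j < n) c j *: unit_vector R (p j)) k = if (q k < n)%N then c (q k) else 0.
Proof.
move=> pq qp; rewrite (omega_sumE n c (fun j => unit_vector R (p j)) k).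
have E j : (k == p j) = (j == q k).
  by apply/eqP/eqP => [->|->]; rewrite ?pq ?qp.
case: ifP => kn.
  rewrite (bigD1 (Ordinal kn)) //= big1 ?addr0 => [|j].
    by rewrite /unit_vector E eqxx mulr1.
  by rewrite -val_eqE /= => jk; rewrite /unit_vector E (negbTE jk) mulr0.
rewrite big1 // => j _; rewrite /unit_vector E; case: eqP => [e|]; last by rewrite mulr0.
by rewrite -e ltn_ord in kn.
Qed.

Lemma derived_unit j : (DN (second (unit_vector R j)) <= 1)%E.
Proof.
have h m : (j.+1 <= m)%N -> unit_vector R j m = 0.
  by move=> jm; rewrite /unit_vector gtn_eqF.
apply: le_trans (derived_norm_l1 hN h) _; rewrite lee_fin big_ord_recr /=.
rewrite big1 => [|i _]; first by rewrite add0r /unit_vector eqxx normc1.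
by rewrite /unit_vector ltn_eqF ?normc0.
Qed.

(** Only the upper estimate of the euclidean property matters: the norms of the
    [(0, e_j)] are at most [1], which bounds the constant [d] by [K].  The exceptional
    set is finite, and all the even-numbered basis vectors beyond it are available. *)
Lemma not_E_property :
  ~ (exists K : R, 1 <= K /\ forall n : nat, E_property DN (derived_basis R) n n K).
Proof.
move=> [K [K1 hE]].
have [|m [x [xm x1 bad]]] := @derived_norm_unbounded _ N hN (K + 1); first by lra.
have [I _ eu] := hE m.+1.
pose L := (\max_(i <- I) i).+1.
have outI i : (L <= i)%N -> i \notin I.
  move=> Li; apply/negP => iI.
  by have := leq_trans Li (@leq_bigmax_seq _ (enum_fset I) xpredT (fun i => i) i iI isT); rewrite ltnn.
(* odd indices carry the vectors [(0, e_j)] *)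
pose s j := ((j + L).*2.+1)%N.
have s_half j : (s j)./2 = (j + L)%N by rewrite /s /= uphalf_double.
have s_inj : injective s by move=> i j /(congr1 half); rewrite !s_half => /addIn.
pose A := [fset i in map s (iota 0 m.+1)]%fset.
have uA : perm_eq (enum_fset A) (map s (iota 0 m.+1)).
  apply: uniq_perm; first exact: fset_uniq.
    by rewrite map_inj_uniq ?iota_uniq.
  by move=> i; rewrite in_fset.
have sumA (T : nmodType) (f : nat -> T) : \sum_(i <- A) f i = \sum_(j < m.+1) f (s j).
  by rewrite -(big_mkord xpredT (fun j => f (s j))) /index_iota subn0 (perm_big _ uA) big_map.
have cA : (#|` A| <= m.+1)%N by rewrite (perm_size uA) size_map size_iota.
have AI : [set` A] `<=` ~` [set` I].
  move=> i /=; rewrite in_fset => /mapP[j _ ->]; apply/negP; apply: outI.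
  by apply: leq_trans (leq_addl j L) _; rewrite /s leqW // -addnn leq_addr.
have [c [d [c0 d0 dc H]]] := eu A AI cA.
have [p [q [pq qp ps]]] := @extend_injection m.+1 (fun j => (j + L)%N) (fun i j _ _ => @addIn L i j).
have basis j : derived_basis R (s j) = second (unit_vector R (j + L)).
  by rewrite /derived_basis s_half /s /= odd_double.
have vec (y : nat -> R[i]) : \sum_(i <- A) y (i./2 - L)%N *: derived_basis R i =
    second (\sum_(j < m.+1) y j *: unit_vector R (p j)).
  rewrite sumA -(second_sum _ y (fun j => unit_vector R (p j))); apply: eq_bigr => j _.
  by rewrite s_half addnK basis ps.
have nrm (y : nat -> R[i]) : \sum_(i <- A) normc (y (i./2 - L)%N) ^+ 2 =
    \sum_(j < m.+1) normc (y j) ^+ 2.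
  by rewrite sumA; apply: eq_bigr => j _; rewrite s_half addnK.
have c1 : c <= 1.
  have [h _] := H (fun i => ((i./2 - L)%N == 0%N)%:R).
  move: h; rewrite (vec (fun j => (j == 0%N)%:R)) (nrm (fun j => (j == 0%N)%:R)).
  have -> : \sum_(j < m.+1) normc (j == 0%N :> nat)%:R ^+ 2 = 1 :> R.
    rewrite big_ord_recl big1 => [|i _]; first by rewrite addr0 eqxx normc1 expr1n.
    by rewrite (_ : (lift ord0 i == 0%N :> nat) = false) // normc0 expr0n.
  have -> : \sum_(j < m.+1) (j == 0%N :> nat)%:R *: unit_vector R (p j) = unit_vector R (p 0%N).
    rewrite big_ord_recl big1 => [|i _]; first by rewrite addr0 eqxx scale1r.
    by rewrite (_ : (lift ord0 i == 0%N :> nat) = false) // scale0r.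
  rewrite sqrtr1 mulr1 => h.
  by rewrite -lee_fin; exact: le_trans h (derived_unit _).
have [_] := H (fun i => (x (i./2 - L)%N)%:C).
rewrite (vec (fun j => (x j)%:C)) (nrm (fun j => (x j)%:C)).
have -> : \sum_(j < m.+1) (x j)%:C *: unit_vector R (p j) = emb (fun n => x (q n)).
  apply/funext => k; rewrite (sum_units _ (fun j => (x j)%:C) _ pq qp) /emb.
  by case: ltnP => // h; rewrite xm // ltnW.
have -> : \sum_(j < m.+1) normc (x j)%:C ^+ 2 = \sum_(n < m) x n ^+ 2.
  transitivity (\sum_(j < m) normc (x j)%:C ^+ 2 + normc (x m)%:C ^+ 2).
    exact: big_ord_recr.
  rewrite (xm m) // normc0 expr0n addr0.
  by apply: eq_bigr => j _; rewrite normc_real real_normK ?num_real.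
move=> up; apply: (bad p q pq qp); apply: le_lt_trans up _; rewrite lte_fin.
have h1 : Num.sqrt (\sum_(n < m) x n ^+ 2) <= 1.
  by rewrite -[leRHS]sqrtr1; exact: ler_wsqrtr.
have h0 := sqrtr_ge0 (\sum_(n < m) x n ^+ 2).
by move: h0 h1; set r := Num.sqrt _; nra.
Qed.

Lemma derived_normZ (lam : R) (v : V) : 0 < lam -> (DN (lam%:C *: v) <= lam%:E * DN v)%E.
Proof.
case: v => x y l0.
have := @derived_norm_act _ N hN lam (fun=> lam%:C) x y.
apply; split => // n; right; by rewrite normc_real gtr0_norm.
Qed.

(** The vectors [t j] have norm at most three times the norm of the inverse of [T],
    so [sign_choice] yields signs for which the preimage of the combination obeys
    the same bound.  Neither [T] nor its inverse is known to be bounded, only the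
    product of their norms is, whence the cases and the slack of [1]. *)
Lemma upper_l2_estimate m (C : R) (T : 'rV[R[i]]_m -> V) (t : nat -> 'rV[R[i]]_m)
    (x : nat -> R) : linear T -> 0 <= C ->
  (ereal_sup [set DN (T a) | a in [set a | (l2norm a <= 1)%R]] *
   ereal_sup [set (l2norm a)%:E | a in [set a | DN (T a) <= 1]] < C%:E)%E ->
  (forall j, (j < m)%N -> (DN (T (t j)) <= 3%:E)%E) ->
  \sum_(j < m) x j ^+ 2 <= 1 ->
  exists s : nat -> bool,
    (DN (T (\sum_(j < m) ((-1) ^+ s j * x j)%:C *: t j)%R) <= (3 * C + 1)%:E)%E.
Proof.
move=> lT C0; set S := ereal_sup _; set S' := ereal_sup _ => SS tD x1.
pose T' : {linear 'rV[R[i]]_m -> V} := HB.pack T (GRing.isLinear.Build _ _ _ _ T lT).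
have TZ c u : T (c *: u) = c *: T u by exact: (linearZ_LR T').
have T0 : T 0 = 0 by exact: (linear0 T').
have zero : (DN (0%R : V) <= 0)%E.
  by apply: le_trans (@derived_norm_l1 _ N hN 0 0 _) _ => //; rewrite big_ord0.
have S0 : (0 <= S)%E.
  apply: (@le_trans _ _ (DN (T 0))); first exact: derived_norm_ge0.
  apply: ereal_sup_ubound; exists 0 => //=.
  by rewrite (_ : l2norm _ = 0) // /l2norm big1 ?sqrtr0 // => i _; rewrite mxE normc0 expr0n.
have S'0 : (0 <= S')%E.
  apply: (@le_trans _ _ (l2norm (0 : 'rV[R[i]]_m))%:E); first by rewrite lee_fin l2norm_ge0.
  by apply: ereal_sup_ubound; exists 0 => //=; rewrite T0; exact: le_trans zero _.
have tS' j : (j < m)%N -> ((l2norm (t j) / 3)%:E <= S')%E.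
  move=> jm; apply: ereal_sup_ubound; exists ((3^-1)%:C *: t j) => /=.
    rewrite TZ; apply: le_trans (derived_normZ _ _) _; first by rewrite invr_gt0.
    apply: (@le_trans _ _ ((3^-1)%:E * 3%:E)%E).
      by apply: lee_wpmul2l; [rewrite lee_fin invr_ge0 | exact: tD].
    by rewrite -EFinM mulVf.
  by rewrite l2normZ ger0_norm ?invr_ge0 // mulrC.
have scaled mu u : 0 < mu -> l2norm u <= mu -> (DN (T u) <= mu%:E * S)%E.
  move=> mu0 um.
  have -> : u = mu%:C *: (mu^-1%:C *: u).
    by rewrite scalerA -rmorphM mulfV ?lt0r_neq0 // rmorph1 scale1r.
  rewrite TZ; apply: le_trans (derived_normZ _ mu0) _.
  apply: lee_wpmul2l; first by rewrite lee_fin ltW.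
  apply: ereal_sup_ubound; exists (mu^-1%:C *: u) => //=.
  by rewrite l2normZ gtr0_norm ?invr_gt0 // mulrC ler_pdivrMr ?mul1r.
have [s hs] := sign_choice (fun j => (x j)%:C *: t j) m.
exists s.
set u := \sum_(j < m) _.
have uE : u = \sum_(j < m) ((-1) ^+ s j : R)%:C *: ((x j)%:C *: t j).
  by apply: eq_bigr => j _; rewrite scalerA -rmorphM.
rewrite -uE in hs.
have [Sz|Sn] := eqVneq S 0%E.
  have := scaled (l2norm u + 1) u.
  rewrite Sz mule0 => h; apply: le_trans (h _ _) _.
  - by rewrite ltr_wpDl ?l2norm_ge0.
  - by rewrite lerDl.
  - by rewrite lee_fin; lra.
have Spos : (0 < S)%E by rewrite lt_neqAle eq_sym Sn.
case: S' S'0 tS' SS => [s'||] //; last first.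
  by move=> _ _; rewrite gt0_muley // ltye_eq.
rewrite lee_fin => s'0 tS' SS.
have tb j : (j < m)%N -> l2norm (t j) <= 3 * s'.
  by move=> /tS'; rewrite lee_fin ler_pdivrMr // mulrC.
have ub : l2norm u ^+ 2 <= (3 * s') ^+ 2.
  apply: le_trans hs _.
  apply: (@le_trans _ _ (\sum_(j < m) x j ^+ 2 * (3 * s') ^+ 2)).
    apply: ler_sum => j _; rewrite l2normZ exprMn real_normK ?num_real //.
    rewrite ler_wpM2l ?sqr_ge0 // lerXn2r ?nnegrE ?l2norm_ge0 ?mulr_ge0 //.
    exact: tb.
  by rewrite -mulr_suml ler_piMl ?sqr_ge0.
have {}ub : l2norm u <= 3 * s'.
  by rewrite -(@ler_pXn2r _ 2) ?nnegrE ?l2norm_ge0 ?mulr_ge0.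
case: S S0 scaled Sn Spos SS => [r||] // S0 scaled Sn Spos SS.
  rewrite lte_fin in Spos; rewrite -EFinM lte_fin in SS.
  pose eta := (r + 1)^-1; have eta0 : 0 < eta by rewrite invr_gt0 ltr_wpDl ?ltW.
  apply: le_trans (scaled (3 * s' + eta) u _ _) _.
  - by rewrite ltr_wpDl ?mulr_ge0.
  - by apply: le_trans ub _; rewrite lerDl ltW.
  rewrite -EFinM lee_fin mulrDl.
  have e1 : eta * r <= 1.
    by rewrite /eta mulrC ler_pdivrMr ?mul1r ?lerDl // ltr_wpDl ?ltW.
  rewrite lerD //; nra.
have s'z : s' = 0.
  apply/eqP; apply/negPn/negP => sn; move: SS.
  by rewrite gt0_mulye ?lte_fin ?lt_neqAle ?(eq_sym 0) ?sn // ltye_eq.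
have u0 : u = 0.
  by apply: l2norm_eq0; apply/eqP; rewrite eq_le l2norm_ge0 andbT (le_trans ub) // s'z mulr0.
rewrite u0 T0; apply: le_trans zero _; rewrite lee_fin; lra.
Qed.

(** The vectors [(0, d j)] of [Y] are obtained one after the other, each beyond the
    support of the previous ones, from the coefficients of the [(0, e_j)] modulo [Y]. *)
Lemma not_asymptotically_hilbertian : ~ asymptotically_hilbertian DN.
Proof.
move=> [C C0 hC].
have [|m [x [xm x1 bad]]] := @derived_norm_unbounded _ N hN (3 * (C + 1) + 2); first by lra.
have [Y [[Y0 Yfin Ylin] [k [w [wfin Yw]]] hE]] := hC m.
have coef j : {c : 'I_k -> R[i] | Y (second (unit_vector R j) - \sum_(i < k) c i *: w i)}.
  apply: cid; apply: Yw; apply: le_lt_trans (derived_unit j) _; exact: ltry.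
pose g j i : R[i] := if insub i is Some i' then sval (coef j) i' else 0.
have gE j (i : 'I_k) : g j i = sval (coef j) i.
  by rewrite /g; case: insubP => [u _ /val_inj ->|/negP[]].
have Ysum n (c : nat -> R[i]) (f : nat -> V) : (forall j, Y (f j)) -> Y (\sum_(j < n) c j *: f j).
  move=> Yf; elim: n => [|n IH]; first by rewrite big_ord0.
  by rewrite big_ord_recr /= addrC; exact: Ylin.
have kernelY n (d : nat -> R[i]) : (forall i, (i < k)%N -> \sum_(j < n) d j * g j i = 0) ->
    Y (second (\sum_(j < n) d j *: unit_vector R j)).
  move=> dk; rewrite -second_sum.
  have -> : \sum_(j < n) d j *: second (unit_vector R j) =
      \sum_(j < n) d j *: (second (unit_vector R j) - \sum_(i < k) sval (coef j) i *: w i).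
    under [RHS]eq_bigr => j _ do rewrite scalerBr.
    rewrite sumrB (_ : \sum_(j < n) d j *: \sum_(i < k) sval (coef j) i *: w i = 0) ?subr0 //.
    under eq_bigr => j _ do rewrite scaler_sumr.
    rewrite exchange_big /= big1 // => i _.
    under eq_bigr => j _ do rewrite scalerA -gE.
    by rewrite -scaler_suml dk // scale0r.
  by apply: (Ysum n d (fun j => second (unit_vector R j) - \sum_(i < k) sval (coef j) i *: w i)) => j;
    exact: svalP (coef j).
have pick lo : {r : nat * nat * (nat -> R[i]) | [/\ (lo <= r.1.1 < r.1.2)%N, r.2 r.1.1 = 1,
    forall n, ~~ (lo <= n < r.1.2)%N -> r.2 n = 0,
    \sum_(n < r.1.2) normc (r.2 n) <= 3 &
    forall i, (i < k)%N -> \sum_(n < r.1.2) r.2 n * g n i = 0]}.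
  by apply: cid; have [a [hi [d H]]] := flat_kernel_vector k g lo; exists (a, hi, d).
pose fix lo j := if j is l.+1 then (sval (pick (lo l))).1.2 else 0%N.
pose a j := (sval (pick (lo j))).1.1.
pose d j := (sval (pick (lo j))).2.
have dP j : [/\ (lo j <= a j < lo j.+1)%N, d j (a j) = 1,
    forall n, ~~ (lo j <= n < lo j.+1)%N -> d j n = 0,
    \sum_(n < lo j.+1) normc (d j n) <= 3 &
    forall i, (i < k)%N -> \sum_(n < lo j.+1) d j n * g n i = 0].
  exact: svalP (pick (lo j)).
have lomono : {homo lo : i j / (i <= j)%N}.
  apply: homo_leq => [//|? ? ?|i]; first exact: leq_trans.
  by have [/andP[h1 h2] _ _ _ _] := dP i; exact: ltnW (leq_ltn_trans h1 h2).
have dd i j : i != j -> d i (a j) = 0.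
  move=> ij; have [/andP[aj1 aj2] _ _ _ _] := dP j; have [_ _ di _ _] := dP i.
  apply: di; apply/negP => /andP[h1 h2].
  case: (ltngtP i j) ij => // h _.
    by have := leq_trans (leq_trans h2 (lomono _ _ h)) aj1; rewrite ltnn.
  by have := leq_trans (leq_trans aj2 (lomono _ _ h)) h1; rewrite ltnn.
have daj j : d j (a j) = 1 by have [_ h _ _ _] := dP j.
have a_inj i j : (i < m)%N -> (j < m)%N -> a i = a j -> i = j.
  move=> _ _ e; apply/eqP/negPn/negP => ij.
  have := dd _ _ ij; rewrite -e daj => /eqP; by rewrite oner_eq0.
have [p [q [pq qp pa]]] := extend_injection a_inj.
pose W j := second (d j).
have dE j : d j = \sum_(n < lo j.+1) d j n *: unit_vector R n.
  apply/funext => n; rewrite (@sum_units _ (d j) id id) //.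
  case: ifP => // h; have [_ _ hd _ _] := dP j; apply: hd.
  by rewrite h andbF.
have WY j : Y (W j).
  by rewrite /W dE; apply: kernelY; have [] := dP j.
have W3 j : (DN (W j) <= 3%:E)%E.
  have [_ _ hd h3 _] := dP j.
  apply: le_trans (@derived_norm_l1 _ N hN (d j) (lo j.+1) _) _; last by rewrite lee_fin.
  by move=> n hn; apply: hd; rewrite ltnNge hn andbF.
pose T0 (r : 'rV[R[i]]_m) : V := \sum_(j < m) r ord0 j *: W j.
have T0E (r : 'rV[R[i]]_m) : T0 r = second (\sum_(j < m) r ord0 j *: d j).
  rewrite /T0; elim/big_ind2 : _ => // [u1 u2 v1 v2 -> ->|j _].
    by rewrite secondD.
  by rewrite /W /second; congr pair; rewrite /= scaler0.
have T0coord (r : 'rV[R[i]]_m) (j : 'I_m) : (T0 r).2 (a j) = r ord0 j.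
  rewrite T0E /=.
  have -> : (\sum_(i < m) r ord0 i *: d i) (a j) = \sum_(i < m) r ord0 i * d i (a j).
    by elim/big_ind2 : _ => // u1 u2 v1 v2 <- <-.
  rewrite (bigD1 j) //= daj mulr1 big1 ?addr0 // => i ij.
  by rewrite dd ?mulr0.
have linT0 : linear T0.
  move=> c u v; rewrite /T0 scaler_sumr -big_split /=; apply: eq_bigr => j _.
  by rewrite !mxE scalerDl scalerA.
have injT0 : injective T0.
  move=> u v e; apply/rowP => j; by rewrite -!T0coord e.
have ET0 : [set y | exists r, T0 r = y] `<=` Y.
  move=> _ [r <-]; rewrite /T0.
  elim/big_ind : _ => //= [y1 y2 h1 h2|j _].
    by rewrite -[y1]scale1r; exact: Ylin.
  by rewrite -[X in Y X]addr0; exact: Ylin.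
have rangeT0 : range T0 = [set y | exists r, T0 r = y].
  by apply/seteqP; split => y [r] => [_ <-|<-]; exists r.
have hd : has_dim (range T0) m by exists T0; split.
rewrite rangeT0 in hd.
have /ereal_inf_lt [_ [T [linT injT rT] <-] TC] :
    (hilbert_distance DN [set y | exists r, T0 r = y] m < (C + 1)%:E)%E.
  by apply: le_lt_trans (hE _ ET0 hd) _; rewrite lte_fin ltrDl.
have inv (j : nat) : {t : 'rV[R[i]]_m | (j < m)%N -> T t = W j}.
  apply: cid; have [jm|] := ltnP j m; last by exists 0.
  have : range T (W j).
    rewrite rT /=; exists (delta_mx ord0 (Ordinal jm)).
    rewrite /T0 (bigD1 (Ordinal jm)) //= mxE !eqxx scale1r big1 ?addr0 // => i ij.
    by rewrite mxE (negbTE ij) andbF scale0r.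
  by move=> [t _ tW]; exists t.
pose t j := sval (inv j).
have tW j : (j < m)%N -> T (t j) = W j by exact: svalP (inv j).
have tD j : (j < m)%N -> (DN (T (t j)) <= 3%:E)%E by move=> jm; rewrite tW.
have C1 : 0 <= C + 1 by rewrite addr_ge0 // ltW.
have [s hs] := upper_l2_estimate linT C1 TC tD x1.
pose T' : {linear 'rV[R[i]]_m -> V} := HB.pack T (GRing.isLinear.Build _ _ _ _ T linT).
have Tu : T (\sum_(j < m) ((-1) ^+ s j * x j)%:C *: t j) =
    second (\sum_(j < m) ((-1) ^+ s j * x j)%:C *: d j).
  rewrite -(second_sum _ (fun j => ((-1) ^+ s j * x j)%:C) d).
  rewrite -[T]/(T' : _ -> _) linear_sum; apply: eq_bigr => j _.
  by rewrite linearZ /= tW.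
rewrite Tu in hs.
(* restriction to the coordinates [a j], together with the signs that restore [x] *)
pose th n : R[i] := if (q n < m)%N then ((-1) ^+ s (q n) : R)%:C else 0.
have mth : multiplier 1 th.
  split=> // n; rewrite /th; case: ifP => _; last by left; rewrite normc0.
  by right; rewrite normc_real normrX normrN1 expr1n.
have := @derived_norm_act _ N hN 1 th 0%R (\sum_(j < m) ((-1) ^+ s j * x j)%:C *: d j) mth.
rewrite mul1e => /le_trans /(_ hs).
have -> : act th 0 = 0 by apply/funext => n; rewrite /act mulr0.
have -> : act th (\sum_(j < m) ((-1) ^+ s j * x j)%:C *: d j) = emb (fun n => x (q n)).
  apply/funext => n; rewrite /act /th /emb.
  rewrite (omega_sumE m (fun j => ((-1) ^+ s j * x j)%:C) d n).
  case: ltnP => qm; last by rewrite mul0r xm.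
  have nE : n = a (q n) by rewrite -pa // qp.
  have dn (j : nat) : d j n = (j == q n)%:R.
    rewrite {1}nE; have [->|jq] := eqVneq j (q n); first exact: daj.
    exact: dd.
  under [X in _ * X]eq_bigr => j _ do rewrite dn.
  rewrite (bigD1 (Ordinal qm)) //= eqxx mulr1 big1 ?addr0 => [|j].
    by rewrite -rmorphM mulrA -expr2 sqrr_sign mul1r.
  by rewrite -val_eqE /= => /negbTE ->; rewrite mulr0.
move=> h; apply: (bad p q pq qp); apply: le_lt_trans h _.
by rewrite lte_fin; lra.
Qed.

End main.

Theorem proposition9 (R : realType) (tnorm : omega R -> R)
    (htnorm : is_tsirelson_norm tnorm) :
  ~ asymptotically_hilbertian (derived_norm (Ts2_norm tnorm)) /\
  ~ (exists K : R, 1 <= K /\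
       forall n : nat,
         E_property (derived_norm (Ts2_norm tnorm)) (derived_basis R) n n K).
Proof.
split; first exact: not_asymptotically_hilbertian.
exact: not_E_property.
Qed.
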